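(* Let $m,n\ge1$ be integers. Suppose that $1<p<q<\infty$ and $0<\frac{\alpha}{m},\frac{\beta}{n}<1$. If both $\sigma=\sigma_1\times\sigma_2$ and $\omega=\omega_1\times\omega_2$ are product measures on $\mathbb{R}^m\times\mathbb{R}^n$ (with $\sigma_1,\omega_1$ locally finite positive Borel measures on $\mathbb{R}^m$ and $\sigma_2,\omega_2$ on $\mathbb{R}^n$), then the norm inequality $$\left\{\int_{\mathbb{R}^m}\int_{\mathbb{R}^n}I_{\alpha,\beta}^{m,n}(f\sigma)(x,y)^q\,d\omega(x,y)\right\}^{1/q}\le\mathbb{N}\left\{\int_{\mathbb{R}^m}\int_{\mathbb{R}^n}f(x,y)^p\,d\sigma(x,y)\right\}^{1/p}\quad\text{for all }f\ge0$$ is characterized by the two-tailed Muckenhoupt condition, i.e. its best constant $\mathbb{N}_{p,q}^{(\alpha,\beta),(m,n)}(\sigma,\omega)$ satisfies $$\mathbb{N}_{p,q}^{(\alpha,\beta),(m,n)}(\sigma,\omega)\approx\widehat{\mathbb{A}}_{p,q}^{(\alpha,\beta),(m,n)}(\sigma,\omega).$$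
   Context: $p'=p/(p-1)$. For a positive measure $\mu$, $$I_{\alpha,\beta}^{m,n}\mu(x,y)=\iint_{\mathbb{R}^m\times\mathbb{R}^n}|x-u|^{\alpha-m}|y-t|^{\beta-n}\,d\mu(u,t).$$ The two-tailed characteristic is $$\widehat{\mathbb{A}}_{p,q}^{(\alpha,\beta),(m,n)}(\sigma,\omega)=\sup_{I\subset\mathbb{R}^m,\,J\subset\mathbb{R}^n}|I|^{\frac\alpha m-1}|J|^{\frac\beta n-1}\left(\iint_{\mathbb{R}^m\times\mathbb{R}^n}\widehat{s}_{I\times J}^{\,q}\,d\omega\right)^{1/q}\left(\iint_{\mathbb{R}^m\times\mathbb{R}^n}\widehat{s}_{I\times J}^{\,p'}\,d\sigma\right)^{1/p'},$$ over axis-parallel cubes $I,J$ with centers $c_I,c_J$, where $$\widehat{s}_{I\times J}(x,y)=\left(1+\frac{|x-c_I|}{|I|^{1/m}}\right)^{\alpha-m}\left(1+\frac{|y-c_J|}{|J|^{1/n}}\right)^{\beta-n}.$$ $A\approx B$ means $c^{-1}A\le B\le cA$ with a positive constant $c$ depending only on $m,n,\alpha,\beta,p,q$. *)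

(* Defs.v *)
From HB Require Import structures.
From mathcomp Require Import all_boot all_order all_algebra.
From mathcomp Require Import all_classical all_reals all_analysis.
From mathcomp Require Import measurable_realfun.

Set Implicit Arguments.
Unset Strict Implicit.
Unset Printing Implicit Defensive.

Import Order.TTheory GRing.Theory Num.Theory.
Import numFieldNormedType.Exports.

Local Open Scope classical_set_scope.
Local Open Scope ring_scope.
Local Open Scope ereal_scope.

(* MathComp-Analysis. [borel R m] is the space ['rV[R]_m] equipped with the
   sigma-algebra generated by its open sets. *)
Definition borel (R : realType) (m : nat) : Type := 'rV[R]_m.

HB.instance Definition _ (R : realType) (m : nat) :=
  Measurable.copy (borel R m) (g_sigma_algebraType (@open 'rV[R]_m)).

Definition locally_finite (R : realType) (m : nat)
    (mu : set (borel R m) -> \bar R) : Prop :=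
  forall x : 'rV[R]_m, exists U : set 'rV[R]_m,
    [/\ open U, U x & mu U < +oo].

(* The library norm on ['rV[R]_m] is the sup norm, hence this definition. *)
Definition enorm (R : realType) (m : nat) (x : 'rV[R]_m) : R :=
  Num.sqrt (\sum_(i < m) x ord0 i ^+ 2)%R.

(* |x|^s for a negative exponent s. The value at x = 0 has to be +oo, whereas
   [powR] returns 0 there. *)
Definition enorm_npow (R : realType) (m : nat) (x : 'rV[R]_m) (s : R) : \bar R :=
  if x == 0%R then +oo else (enorm x `^ s)%:E.

Definition frac_integral (R : realType) (m n : nat) (alpha beta : R)
    (mu : set (borel R m * borel R n) -> \bar R)
    (z : borel R m * borel R n) : \bar R :=
  \int[mu]_w (enorm_npow (z.1 - w.1 : 'rV[R]_m)%R (alpha - m%:R)%R *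
              enorm_npow (z.2 - w.2 : 'rV[R]_n)%R (beta - n%:R)%R).

(* The measure written f sigma. *)
Definition density d (T : measurableType d) (R : realType)
    (f : T -> \bar R) (sigma : set T -> \bar R) : set T -> \bar R :=
  fun A => \int[sigma]_(w in A) f w.

Definition norm_inequality (R : realType) (m n : nat) (alpha beta p q : R)
    (sigma omega : set (borel R m * borel R n) -> \bar R) (N : R) : Prop :=
  forall f : borel R m * borel R n -> \bar R,
    measurable_fun setT f -> (forall z, 0 <= f z) ->
    (\int[omega]_z (frac_integral alpha beta (density f sigma) z `^ q)) `^ q^-1
    <= N%:E * (\int[sigma]_z (f z `^ p)) `^ p^-1.

(* Equal to +oo when no finite constant is admissible. *)
Definition best_constant (R : realType) (m n : nat) (alpha beta p q : R)
    (sigma omega : set (borel R m * borel R n) -> \bar R) : \bar R :=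
  ereal_inf [set N%:E | N in
    [set N : R | (0 <= N)%R /\ norm_inequality alpha beta p q sigma omega N]].

(* The axis-parallel cube of R^m with the given center and side length. *)
Record cube (R : realType) (m : nat) := Cube {
  cube_center : 'rV[R]_m;
  cube_side : R;
  cube_side_gt0 : (0 < cube_side)%R }.

Definition volume (R : realType) (m : nat) (I : cube R m) : R :=
  (cube_side I ^+ m)%R.

Definition tail (R : realType) (m n : nat) (alpha beta : R)
    (I : cube R m) (J : cube R n) (z : borel R m * borel R n) : R :=
  ((1 + enorm (z.1 - cube_center I : 'rV[R]_m) / volume I `^ (m%:R^-1))
     `^ (alpha - m%:R) *
   (1 + enorm (z.2 - cube_center J : 'rV[R]_n) / volume J `^ (n%:R^-1))
     `^ (beta - n%:R))%R.

(* In the products below 0 * +oo = 0. *)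
Definition two_tailed_char (R : realType) (m n : nat) (alpha beta p q : R)
    (sigma omega : set (borel R m * borel R n) -> \bar R) : \bar R :=
  let p' := (p / (p - 1))%R in
  ereal_sup [set
    (volume IJ.1 `^ (alpha / m%:R - 1) * volume IJ.2 `^ (beta / n%:R - 1))%:E *
    (\int[omega]_z (tail alpha beta IJ.1 IJ.2 z `^ q)%:E) `^ q^-1 *
    (\int[sigma]_z (tail alpha beta IJ.1 IJ.2 z `^ p')%:E) `^ p'^-1
    | IJ in [set: cube R m * cube R n]].

Definition comparable_up_to (R : realType) (c : R) (A B : \bar R) : Prop :=
  (c^-1)%:E * A <= B /\ B <= c%:E * A.

(* Main.v *)
(** Lower bound: from [|x - u| <= 2 (|x - c| + |u - c|)] one gets
    [|x - u|^-th >= (2 l)^-th t(x) t(u)], where [t] is the tail of the cube of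
    centre [c] and side [l], so the product kernel dominates a multiple of
    [tail (x) * tail (u)]; testing the norm inequality on functions [g] of unit
    [L^p]-norm and using the duality of [L^p] and [L^p'] gives the characteristic.

    Upper bound: for product measures the supremum over [I * J] splits into the
    product of two one-parameter characteristics, and because [q / p > 1] the
    two-parameter estimate is the iteration of two one-parameter estimates
    through Minkowski's integral inequality.  In one parameter the kernel is
    dominated by finitely many shifted dyadic kernels, which leaves the sum
    [\sum_Q a Q * \int_Q f dsigma * \int_Q g domega] over a laminar family.  To
    each cube [Q] are attached the largest cubes above it of comparable
    [sigma]-mass and of comparable [omega]-mass.  When the latter lies below
    the former, Young's inequality separates [f] from [g]; the characteristic
    bounds the sum along the chain of [omega]-cubes below a [sigma]-cube, and a
    maximal function argument, in which [p < q] pays for the loss of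
    disjointness, bounds what remains.  The other case is symmetric. *)

Require Import Defs.
From HB Require Import structures.
From mathcomp Require Import all_boot all_order all_algebra.
From mathcomp Require Import all_classical all_reals all_analysis.
From mathcomp Require Import measurable_realfun ring lra zify.

Set Implicit Arguments.
Unset Strict Implicit.
Unset Printing Implicit Defensive.

Import Order.TTheory GRing.Theory Num.Theory.
Import numFieldNormedType.Exports.

Local Open Scope classical_set_scope.
Local Open Scope ring_scope.

(** * Dyadic levels and sums over laminar families *)

Section dyadic_levels.
Context {R : realType}.
Implicit Types (x th : R) (k : int).

(** The weights [a] are powers of the side length, so they decrease geometrically along the cubes
    above a given cube [Q0], and the sum of [a ^ q * omega] over these cubes is dominated by an
    integral of a power of the tail centred in [Q0]. This is how the characteristic enters, once for
    each order of the two measures. The obstacle is that the cubes of a chain overlap completely, so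
    that neither masses nor averages can be summed over all of them. Keeping one cube for each
    dyadic size of the mass repairs this: the kept cubes of one size are pairwise incomparable, and
    with an exponent [1 + e > 1] on the mass the sizes add up to a geometric series. Each excess [e]
    is bought with the gap between [p] and [q]. The constants must not depend on the measures. Hence
    [f] and [g] are normalised to unit norm, the weights are divided by the bound [A] of the
    characteristic, and the laminar sums are finite with bounds independent of the number of cubes,
    so that a limit reaches the full kernel. *)

Definition pow2 k : R := 2 `^ k%:~R.
Definition lg x : int := Num.floor (ln x / ln 2).

Lemma ln2_gt0 : 0 < ln (2 : R).
Proof. by rewrite ln_gt0// ltr1n. Qed.

Lemma pow2_gt0 k : 0 < pow2 k.
Proof. by rewrite powR_gt0. Qed.

Lemma pow2D k k' : pow2 (k + k') = pow2 k * pow2 k'.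
Proof. by rewrite /pow2 intrD powRD// pnatr_eq0 implybT. Qed.

Lemma pow2_1 : pow2 1 = 2.
Proof. by rewrite /pow2 powRr1. Qed.

Lemma pow2S k : pow2 (k + 1) = 2 * pow2 k.
Proof. by rewrite pow2D pow2_1 mulrC. Qed.

Lemma pow2B1 k : pow2 (k - 1) = pow2 k / 2.
Proof. by have := pow2S (k - 1); rewrite subrK => ->; rewrite mulrAC divff ?mul1r ?pnatr_eq0. Qed.

Lemma pow2N k : pow2 (- k) = (pow2 k)^-1.
Proof. by rewrite /pow2 mulrNz powRN. Qed.

Lemma le_pow2 k k' : (k <= k')%R -> pow2 k <= pow2 k'.
Proof. by move=> kk'; rewrite ler_powR ?ler1n// ler_int. Qed.

Lemma expR_lg x y : 0 < x -> 2 `^ y = expR (y * ln 2) :> R.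
Proof. by rewrite /powR pnatr_eq0. Qed.

Lemma pow2_lg x : 0 < x -> pow2 (lg x) <= x.
Proof.
move=> x0; rewrite /pow2 (expR_lg _ x0) -[leRHS]lnK ?posrE// ler_expR.
by rewrite -ler_pdivlMr ?ln2_gt0// floor_le.
Qed.

Lemma lt_pow2_lg x : 0 < x -> x < 2 * pow2 (lg x).
Proof.
move=> x0; rewrite -pow2S /pow2 (expR_lg _ x0) -[ltLHS]lnK ?posrE// ltr_expR.
by rewrite -ltr_pdivrMr ?ln2_gt0// floorD1_gt.
Qed.

Lemma le_lg x y : 0 < x -> x <= y -> (lg x <= lg y)%R.
Proof.
move=> x0 xy; apply: le_floor; rewrite ler_pM2r ?invr_gt0 ?ln2_gt0//.
by rewrite ler_ln ?posrE// (lt_le_trans x0).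
Qed.

(** Sum of the geometric series of ratio [2 ^ (- th)]. *)
Definition geom_cst th : R := (1 - 2 `^ (- th))^-1.

Lemma geom_ratio_lt1 th : 0 < th -> 2 `^ (- th) < 1 :> R.
Proof.
by move=> th0; rewrite (expR_lg _ ltr01) expR_lt1 mulNr oppr_lt0 mulr_gt0 ?ln2_gt0.
Qed.

Lemma geom_cst_gt0 th : 0 < th -> 0 < geom_cst th.
Proof. by move=> th0; rewrite invr_gt0 subr_gt0 geom_ratio_lt1. Qed.

(** Induction on the number of levels: once the largest level [K] is removed, the others are at most
    [K - 1], and [1 + 2 ^ (- th) * geom_cst th = geom_cst th]. *)
Lemma geom_sum_seq th x (r : seq int) : 0 < th -> uniq r ->
  (forall k, k \in r -> pow2 k <= x) ->
  \sum_(k <- r) pow2 k `^ th <= geom_cst th * x `^ th.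
Proof.
move=> th0; have [n] := ubnP (size r); elim: n r x => // n IHn r x sr ur rx.
have [->|[k0 k0r]] : r = [::] \/ exists k, k \in r.
  by case: r {sr ur rx} => [|k r]; [left | right; exists k; rewrite mem_head].
- by rewrite big_nil mulr_ge0 ?powR_ge0 ?ltW ?geom_cst_gt0.
pose s := sort (fun a b : int => b <= a)%R r.
have rs : perm_eq s r by rewrite perm_sort.
have : sorted (fun a b : int => b <= a)%R s.
  by apply: sort_sorted => a b; exact: le_total.
case: s rs => [/perm_size/esym/eqP|K s rs sK].
  by rewrite size_eq0 => /eqP r0; rewrite r0 in k0r.
have tr : transitive (fun a b : int => b <= a)%R by move=> a b c ba cb; exact: le_trans ba.
have us : uniq (K :: s) by rewrite (perm_uniq rs).
have sK' k : k \in s -> (k <= K - 1)%R.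
  move=> ks; have := order_path_min tr sK => /allP/(_ _ ks) kK.
  have kEK : k <> K by move=> kEK; move: us; rewrite /= -kEK ks.
  lia.
rewrite -(perm_big _ rs)/= big_cons.
have Kx : pow2 K <= x by apply: rx; rewrite -(perm_mem rs) mem_head.
have IH : \sum_(k <- s) pow2 k `^ th <= geom_cst th * (pow2 K / 2) `^ th.
  apply: IHn.
  - by move: sr; rewrite -(perm_size rs)/= ltnS.
  - by move: us => /= /andP[].
  - by move=> k /sK' kK; rewrite -pow2B1 le_pow2.
apply: (@le_trans _ _ (geom_cst th * pow2 K `^ th)); last first.
  rewrite ler_pM2l ?geom_cst_gt0// ge0_ler_powR// ?nnegrE ?ltW//.
    exact: pow2_gt0.
  by rewrite (lt_le_trans _ Kx)// pow2_gt0.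
apply: (le_trans (lerD (lexx _) IH)).
rewrite powRM ?invr_ge0 ?ler0n//; last exact/ltW/pow2_gt0.
have -> : 2^-1 `^ th = 2 `^ (- th) :> R by rewrite -powR_inv1 ?ler0n// -powRrM mulN1r.
have c0 : 1 - 2 `^ (- th) != 0 :> R by rewrite subr_eq0 gt_eqF// geom_ratio_lt1.
rewrite le_eqVlt; apply/orP; left; apply/eqP.
by rewrite /geom_cst; field.
Qed.

Lemma geom_sum (I : finType) (P : pred I) (key : I -> int) th x : 0 < th ->
  {in P &, injective key} -> (forall i, P i -> pow2 (key i) <= x) ->
  \sum_(i | P i) pow2 (key i) `^ th <= geom_cst th * x `^ th.
Proof.
move=> th0 injk kx.
rewrite -big_filter -(big_map key xpredT (fun k => pow2 k `^ th)).
apply: geom_sum_seq => //.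
- rewrite map_inj_in_uniq; first by rewrite filter_uniq// /index_enum -enumT enum_uniq.
  by move=> i j; rewrite !mem_filter => /andP[Pi _] /andP[Pj _]; exact: injk.
- by move=> k /mapP[i]; rewrite mem_filter => /andP[Pi _] ->; exact: kx.
Qed.

End dyadic_levels.

(** Abstract form of a family of nested cubes: the members above a given one form a chain, along
    which the level [gen] increases strictly; antisymmetry follows from [gen]. *)
Record laminar (T : finType) (le : rel T) (gen : T -> nat) : Prop := Laminar {
  laminar_refl : reflexive le;
  laminar_trans : transitive le;
  laminar_gen : forall Q P, le Q P -> (gen Q <= gen P)%N;
  laminar_inj : forall Q P, le Q P -> gen Q = gen P -> Q = P;
  laminar_total : forall Q P P', le Q P -> le Q P' -> le P P' || le P' P }.

(* Superadditivity on incomparable members is the only trace of disjointness kept from measures. *)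
Record laminar_weight (R : realType) (T : finType) (le : rel T) (s : T -> R) : Prop :=
  LaminarWeight {
  lweight_gt0 : forall Q, 0 < s Q;
  lweight_mono : forall Q P, le Q P -> s Q <= s P;
  lweight_super : forall Q Q' P, le Q P -> le Q' P -> ~~ le Q Q' -> ~~ le Q' Q ->
    s Q + s Q' <= s P }.

Definition antichain (T : finType) (le : rel T) (S : pred T) : Prop :=
  forall Q Q', S Q -> S Q' -> le Q Q' -> Q = Q'.

Section sum_by_key.
Context {R : realType} {T : finType}.
Variable key : T -> int.

Definition keys : seq int := undup [seq key Q | Q <- enum T].

Lemma keys_uniq : uniq keys.
Proof. exact: undup_uniq. Qed.

Lemma sum_by_key (S : pred T) (F : T -> R) :
  \sum_(Q | S Q) F Q = \sum_(k <- keys) \sum_(Q | S Q && (key Q == k)) F Q.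
Proof.
rewrite (exchange_big_dep S)/=; last by move=> ? ? _ /andP[].
apply: eq_bigr => Q SQ; rewrite SQ /= -big_filter.
under eq_filter => k do rewrite eq_sym.
rewrite filter_pred1_uniq ?keys_uniq// ?big_seq1//.
by rewrite mem_undup map_f// mem_enum.
Qed.

End sum_by_key.

Section level_tops.
Context {R : realType} {T : finType} {le : rel T} {gen : T -> nat} {s : T -> R}.
Hypotheses (lam : laminar le gen) (sw : laminar_weight le s).

(* The largest member above [Q] whose weight has the same dyadic size. *)
Definition top Q : T :=
  [arg max_(P > Q | le Q P && (lg (s P) == lg (s Q))) gen P]%N.

Let top_spec Q : [/\ le Q (top Q), lg (s (top Q)) = lg (s Q) &
  forall P, le Q P -> lg (s P) = lg (s Q) -> (gen P <= gen (top Q))%N].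
Proof.
rewrite /top; case: arg_maxnP => [|P /andP[QP /eqP PQ] H].
  by rewrite (laminar_refl lam) eqxx.
by split=> // P' QP' PQ'; apply: H; rewrite QP' PQ' eqxx.
Qed.

Lemma le_top Q : le Q (top Q).
Proof. by have [] := top_spec Q. Qed.

Lemma lg_top Q : lg (s (top Q)) = lg (s Q).
Proof. by have [] := top_spec Q. Qed.

Lemma laminar_anti Q P : le Q P -> le P Q -> Q = P.
Proof.
move=> QP PQ; apply: (laminar_inj lam QP); apply/eqP.
by rewrite eqn_leq (laminar_gen lam QP) (laminar_gen lam PQ).
Qed.

(** [P] and the top of [Q] are comparable, both being above [Q]; so maximality in [gen] becomes
    maximality in the order. *)
Lemma top_max Q P : le Q P -> lg (s P) = lg (s Q) -> le P (top Q).
Proof.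
move=> QP PQ; have [Qt tQ H] := top_spec Q.
have /orP[//|tP] := laminar_total lam QP Qt.
suff -> : top Q = P by exact: laminar_refl lam P.
apply: (laminar_inj lam tP); apply/eqP.
by rewrite eqn_leq (laminar_gen lam tP) H.
Qed.

Lemma top_eq Q P : le Q P -> lg (s P) = lg (s Q) -> top P = top Q.
Proof.
move=> QP PQ; apply: laminar_anti.
  apply: top_max; last by rewrite lg_top.
  exact: (laminar_trans lam QP (le_top P)).
by apply: top_max; [exact: top_max | rewrite lg_top PQ].
Qed.

Lemma top_idem Q : top (top Q) = top Q.
Proof. by apply: top_eq; [exact: le_top | exact: lg_top]. Qed.

Lemma le_lg_weight Q P : le Q P -> lg (s Q) <= lg (s P).
Proof. by move=> QP; apply: le_lg; [exact: lweight_gt0 sw _ | exact: lweight_mono sw _ _ QP]. Qed.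

Lemma top_between Q P : le Q P -> le P (top Q) -> top P = top Q.
Proof.
move=> QP PQ; apply: top_eq => //; apply/eqP.
by rewrite eq_le -{1}(lg_top Q) !le_lg_weight.
Qed.

(** If the common top has size [2 ^ k], two incomparable members below it would each weigh at least
    [2 ^ k], and superadditivity would push the top to [2 ^ (k + 1)], beyond its dyadic size. *)
Lemma top_comparable Q Q' : top Q = top Q' -> le Q Q' || le Q' Q.
Proof.
move=> tQQ'; apply: contraT; rewrite negb_or => /andP[QQ' Q'Q].
have := lweight_super sw (le_top Q) _ QQ' Q'Q.
rewrite {1}tQQ' => /(_ (le_top Q')); apply: contraTT => _; rewrite -ltNge.
have := lt_pow2_lg (lweight_gt0 sw (top Q)).
have := pow2_lg (lweight_gt0 sw Q); have := pow2_lg (lweight_gt0 sw Q').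
rewrite -(lg_top Q') -tQQ' lg_top; lra.
Qed.

Lemma tops_antichain P P' : top P = P -> top P' = P' -> lg (s P) = lg (s P') ->
  le P P' -> P = P'.
Proof.
by move=> tP tP' PP' PleP'; rewrite -tP -tP'; apply/esym/top_eq.
Qed.

Lemma weight_top_le Q : s (top Q) <= 2 * s Q.
Proof.
apply/ltW/(lt_le_trans (lt_pow2_lg (lweight_gt0 sw _))).
by rewrite lg_top ler_pM2l// pow2_lg// (lweight_gt0 sw).
Qed.

(** The gain from an exponent above 1. Tops of size [2 ^ k] form an antichain, so they contribute at
    most [Phi * (2 * 2 ^ k) ^ e]. A single member is an antichain too, so only levels with
    [2 ^ k <= Phi] occur, and the contributions form a geometric series. *)
Lemma tops_sum (S : pred T) (Phi e : R) : 0 < e ->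
  (forall Q, S Q -> top Q = Q) ->
  (forall S' : pred T, {subset S' <= S} -> antichain le S' ->
     \sum_(Q | S' Q) s Q <= Phi) ->
  \sum_(Q | S Q) s Q `^ (1 + e) <= 2 `^ e * geom_cst e * Phi `^ (1 + e).
Proof.
move=> e0 topS SPhi.
have Phi0 : 0 <= Phi by apply: le_trans (SPhi pred0 _ _) => //; rewrite big_pred0.
have sPhi Q : S Q -> s Q <= Phi.
  move=> SQ; apply: le_trans (SPhi (pred1 Q) _ _).
  - by rewrite big_pred1_eq.
  - by move=> P; rewrite !inE => /eqP->.
  - by move=> P P' /eqP-> /eqP->.
rewrite (sum_by_key (fun Q => lg (s Q))).
set I := keys _.
(* Levels without a member of [S] are dropped here, which is what lets the remaining ones be bounded
   by [Phi]. *)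
apply: (@le_trans _ _ (\sum_(k <- I | has (fun Q => S Q && (lg (s Q) == k)) (enum T))
   Phi * (2 * pow2 k) `^ e)).
  rewrite [leRHS]big_mkcond/=; apply: ler_sum => k _; case: ifPn => [_|/hasPn H]; last first.
    by rewrite big_pred0// => Q; apply/negbTE/H; rewrite mem_enum.
  apply: (@le_trans _ _ (\sum_(Q | S Q && (lg (s Q) == k)) s Q * (2 * pow2 k) `^ e)).
    apply: ler_sum => Q /andP[SQ /eqP <-].
    have sQ0 := lweight_gt0 sw Q.
    rewrite powRD; last by rewrite gt_eqF// addr_gt0.
    rewrite powRr1 ?ler_pM2l//; last exact: ltW.
    apply: ge0_ler_powR; rewrite ?nnegrE; [exact: ltW|exact: ltW| |exact/ltW/lt_pow2_lg].
    by rewrite mulr_ge0// ltW// pow2_gt0.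
  rewrite -mulr_suml ler_wpM2r ?powR_ge0//; apply: SPhi => [Q|P P'].
    by rewrite unfold_in => /andP[].
  move=> /andP[SP /eqP kP] /andP[SP' /eqP kP']; apply: tops_antichain; rewrite ?topS//.
  by rewrite kP.
have -> : \sum_(k <- I | has (fun Q => S Q && (lg (s Q) == k)) (enum T))
    Phi * (2 * pow2 k) `^ e =
  2 `^ e * (Phi * \sum_(k <- [seq k <- I | has (fun Q => S Q && (lg (s Q) == k)) (enum T)])
    pow2 k `^ e).
  rewrite big_filter !mulr_sumr; apply: eq_bigr => k _.
  rewrite powRM; [|by []|exact/ltW/pow2_gt0].
  by rewrite mulrCA.
rewrite -mulrA ler_pM2l ?powR_gt0//.
have [->|Phi1] := eqVneq Phi 0.
  by rewrite mul0r mulr_ge0 ?powR_ge0// ltW// geom_cst_gt0.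
rewrite powRD; last by rewrite Phi1 implybT.
rewrite powRr1// mulrCA ler_wpM2l//.
apply: geom_sum_seq => //; first by rewrite filter_uniq// keys_uniq.
move=> k; rewrite mem_filter => /andP[/hasP[Q _ /andP[SQ /eqP <-]] _].
by apply: le_trans (sPhi _ SQ); rewrite pow2_lg// (lweight_gt0 sw).
Qed.

End level_tops.

Arguments top {R T} le gen s Q.

(** * Convexity inequalities for real powers *)

Section powR_facts.
Context {R : realType}.
Implicit Types x y z p q k : R.

Lemma le_powR_base x y p : 0 <= p -> 0 <= x -> x <= y -> x `^ p <= y `^ p.
Proof. by move=> p0 x0 xy; apply: ge0_ler_powR => //; rewrite nnegrE// (le_trans x0). Qed.

(** The tangent at [x] of the convex function [z ^ k], obtained from Young's inequality for [z] and
    [x ^ (k - 1)]. *)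
Lemma powR_tangent k x z : 1 < k -> 0 <= x -> 0 <= z ->
  k * x `^ (k - 1) * z <= z `^ k + (k - 1) * x `^ k.
Proof.
move=> k1 x0 z0.
have k0 : 0 < k by apply: lt_trans k1.
have k10 : 0 < k - 1 by rewrite subr_gt0.
have := @conjugate_powR _ z (x `^ (k - 1)) k (k / (k - 1)) z0 (powR_ge0 _ _) k0.
rewrite divr_gt0// => /(_ isT); rewrite -powRrM mulrCA divff ?gt_eqF// mulr1 !invfM !invrK.
have -> : k^-1 + k^-1 * (k - 1) = 1.
  by rewrite mulrBr mulVf ?gt_eqF// mulr1 addrCA subrr addr0.
move=> /(_ erefl); rewrite -(ler_pM2l k0) => H.
apply: le_trans (le_trans H _).
  by rewrite mulrAC mulrA.
rewrite le_eqVlt; apply/orP; left; apply/eqP; field.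
by rewrite gt_eqF.
Qed.

(** Jensen's inequality for weights of total mass at most 1: the tangent at [m] is averaged, and
    missing mass only helps since the constant term of the tangent is nonpositive. *)
Lemma jensen_powR (I : Type) (r : seq I) (y z : I -> R) k : 1 < k ->
  (forall i, 0 <= y i) -> (forall i, 0 <= z i) -> \sum_(i <- r) y i <= 1 ->
  (\sum_(i <- r) y i * z i) `^ k <= \sum_(i <- r) y i * z i `^ k.
Proof.
move=> k1 y0 z0 y1; set m := \sum_(i <- r) y i * z i.
have m0 : 0 <= m by apply: sumr_ge0 => i _; rewrite mulr_ge0.
have H : \sum_(i <- r) y i * (k * m `^ (k - 1) * z i - (k - 1) * m `^ k) <=
    \sum_(i <- r) y i * z i `^ k.
  apply: ler_sum => i _; rewrite ler_wpM2l// lerBlDr.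
  exact: powR_tangent.
apply: le_trans H.
under eq_bigr do rewrite mulrBr mulrCA.
rewrite sumrB -mulr_sumr -mulr_suml -/m.
have mk : m `^ (k - 1) * m = m `^ k by rewrite mulrC mulr_powRB1// (lt_trans _ k1).
rewrite -mulrA mk mulrA -mulrBl -{1}[m `^ k]mul1r ler_wpM2r ?powR_ge0//.
have k10 : 0 < k - 1 by rewrite subr_gt0.
have : (\sum_(i <- r) y i) * (k - 1) <= 1 * (k - 1) by rewrite ler_pM2r.
lra.
Qed.

Lemma young_powR x y p q : 0 <= x -> 0 <= y -> 1 < p -> 1 < q -> p^-1 + q^-1 = 1 ->
  x * y <= x `^ p + y `^ q.
Proof.
move=> x0 y0 p1 q1 pq.
apply: (le_trans (conjugate_powR x0 y0 (lt_trans ltr01 p1) (lt_trans ltr01 q1) pq)).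
by apply: lerD; rewrite ler_piMr ?powR_ge0// invf_le1 ?ltW// (lt_trans ltr01).
Qed.

Lemma sum_powR_le (I : Type) (r : seq I) (x : I -> R) M e : 0 <= e ->
  (forall i, 0 <= x i) -> \sum_(i <- r) x i <= M ->
  \sum_(i <- r) x i `^ (1 + e) <= M `^ (1 + e).
Proof.
move=> e0 x0 xM.
have M0 : 0 <= M by apply: le_trans xM; apply: sumr_ge0 => i _; exact: x0.
have S z : 0 <= z -> z `^ (1 + e) = z * z `^ e.
  move=> z0; rewrite powRD ?powRr1//; apply/implyP => /eqP ?; exfalso; lra.
rewrite S//; apply: (@le_trans _ _ ((\sum_(i <- r) x i) * M `^ e)); last first.
  by rewrite ler_wpM2r// powR_ge0.
elim: r xM => [|i r IH] xM; first by rewrite !big_nil mul0r.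
move: xM; rewrite !big_cons => xM; rewrite S// mulrDl.
have r0 : 0 <= \sum_(j <- r) x j by apply: sumr_ge0 => j _; exact: x0.
apply: lerD; last by apply: IH; move: (x0 i); lra.
by rewrite ler_wpM2l// le_powR_base//; lra.
Qed.

End powR_facts.

(** * Averages over the largest members of each size *)

Section average_sum.
Context {R : realType} {T : finType} {le : rel T} {gen : T -> nat} {s phi : T -> R}.
Variables (Phi : int -> R) (p M : R).
Hypotheses (lam : laminar le gen) (sw : laminar_weight le s).
Hypothesis phi0 : forall Q, 0 < phi Q.
Hypothesis p0 : 0 < p.
Hypothesis PhiP : forall i (S : pred T), (forall Q, S Q -> pow2 i * s Q <= phi Q) ->
  antichain le S -> \sum_(Q | S Q) s Q <= Phi i.
Hypothesis PhiM : forall r, uniq r -> \sum_(i <- r) pow2 i `^ p * Phi i <= M.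

(** [phi Q] stands for the integral of a function over [Q] and [Phi i] for the measure of the set
    where its maximal function exceeds [2 ^ i]; [PhiM] then plays the role of the maximal theorem in
    [L ^ p]. *)
Definition avg_level Q := lg (phi Q / s Q).

Let s0 := lweight_gt0 sw.

Lemma avg_gt0 Q : 0 < phi Q / s Q.
Proof. by rewrite divr_gt0. Qed.

Lemma Phi_ge0 i : 0 <= Phi i.
Proof. by apply: le_trans (@PhiP i pred0 _ _) => //; rewrite big_pred0. Qed.

Lemma level_tops_sum (S : pred T) i e : 0 < e ->
  (forall Q, S Q -> top le gen s Q = Q) ->
  (forall Q, S Q -> avg_level Q = i) ->
  \sum_(Q | S Q) s Q `^ (1 + e) <= 2 `^ e * geom_cst e * Phi i `^ (1 + e).
Proof.
move=> e0 topS Si; apply: (tops_sum lam sw) => // S' S'S anti; apply: PhiP => // Q S'Q.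
rewrite -ler_pdivlMr// -(Si Q (S'S _ S'Q)) pow2_lg//; exact: avg_gt0.
Qed.

(** A Carleson embedding. The tops of average level [i] contribute, up to constants,
    [2 ^ (i * r) * Phi i ^ (r / p)], which is the power [r / p > 1] of the summable term
    [2 ^ (i * p) * Phi i]. *)
Lemma average_pow_sum r : p < r ->
  \sum_(Q | top le gen s Q == Q)
    (phi Q / s Q) `^ r * s Q `^ (r / p) <=
  2 `^ r * (2 `^ (r / p - 1) * geom_cst (r / p - 1)) * M `^ (r / p).
Proof.
move=> pr; set e := r / p - 1.
have e0 : 0 < e by rewrite subr_gt0 ltr_pdivlMr// mul1r.
have rpe : r / p = 1 + e by rewrite /e addrCA subrr addr0.
have r0 : 0 < r by exact: lt_trans pr.
rewrite (sum_by_key avg_level).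
apply: (@le_trans _ _ (\sum_(i <- keys avg_level) (2 `^ r * (2 `^ e * geom_cst e)) *
    (pow2 i `^ p * Phi i) `^ (1 + e))); last first.
  rewrite -mulr_sumr ler_wpM2l//.
    by rewrite !mulr_ge0 ?powR_ge0// ltW// geom_cst_gt0.
  rewrite rpe; apply: sum_powR_le; first exact: ltW.
    by move=> i; rewrite mulr_ge0 ?powR_ge0 ?Phi_ge0.
  by apply: PhiM; exact: keys_uniq.
apply: ler_sum => i _.
apply: (@le_trans _ _ (\sum_(Q | (top le gen s Q == Q) && (avg_level Q == i))
  (2 * pow2 i) `^ r * s Q `^ (1 + e))).
  apply: ler_sum => Q /andP[_ /eqP <-]; rewrite rpe ler_wpM2r ?powR_ge0//.
  by rewrite le_powR_base ?ltW ?avg_gt0//; exact/lt_pow2_lg/avg_gt0.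
rewrite -mulr_sumr powRM//; last exact/ltW/pow2_gt0.
have -> : (pow2 i `^ p * Phi i) `^ (1 + e) = pow2 i `^ r * Phi i `^ (1 + e).
  rewrite powRM; [|exact: powR_ge0|exact: Phi_ge0].
  rewrite -powRrM.
  rewrite -[in X in X * _]rpe.
  congr (_ `^ _ * _).
  by rewrite mulrC divfK// gt_eqF.
rewrite [leRHS](_ : _ = 2 `^ r * pow2 i `^ r * (2 `^ e * geom_cst e * Phi i `^ (1 + e))); last ring.
rewrite ler_wpM2l ?mulr_ge0 ?powR_ge0//.
by apply: level_tops_sum => // Q /andP[/eqP + /eqP].
Qed.

End average_sum.

(** * Powers of sums along chains *)

Section chain_sum.
Context {R : realType} {T : finType} {le : rel T} {gen : T -> nat} {s w gam : T -> R}.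
Variables (Gam : int -> R) (q M : R).
Hypotheses (lam : laminar le gen) (sw : laminar_weight le s) (ww : laminar_weight le w).
Hypothesis gam0 : forall Q, 0 < gam Q.
Hypothesis q0 : 0 < q.
Hypothesis M0 : 0 < M.
Hypothesis GamP : forall i (S : pred T), (forall Q, S Q -> pow2 i * w Q <= gam Q) ->
  antichain le S -> \sum_(Q | S Q) w Q <= Gam i.
Hypothesis GamM : forall r, uniq r -> \sum_(i <- r) pow2 i `^ q * Gam i <= M.

(* Two members with the same [s]-top are comparable, so these form a chain with distinct
   dyadic sizes of [w]. *)
Definition chain_over P : pred T := fun D => (top le gen w D == D) && (top le gen s D == P).

Lemma chain_over_inj P : {in chain_over P &, injective (fun D => lg (w D))}.
Proof.
move=> D D' /andP[/eqP tD /eqP sD] /andP[/eqP tD' /eqP sD'] DD'.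
have /orP[H|H] : le D D' || le D' D by apply: (top_comparable lam sw); rewrite sD sD'.
  exact: tops_antichain lam _ _ tD tD' DD' H.
by apply/esym; exact: tops_antichain lam _ _ tD' tD (esym DD') H.
Qed.

(** The chain has at most one member of each dyadic size of [w], so its total weight is comparable
    to its largest weight, whose power is one of the terms on the right. *)
Lemma chain_pow_le P (S : pred T) k : 0 < k -> {subset S <= chain_over P} ->
  (\sum_(D | S D) w D) `^ k <=
  (2 * geom_cst 1) `^ k * \sum_(D | S D) w D `^ k.
Proof.
move=> k0 SP; have [S0|[D SD]] : S =1 pred0 \/ exists D, S D.
  by case: (pickP S) => [D SD|S0]; [right; exists D | left].
- by rewrite !big_pred0// powR0 ?mulr0// gt_eqF.
have g0 := geom_cst_gt0 (ltr01 : 0 < (1 : R)).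
have w0 := lweight_gt0 ww.
case: (arg_maxP w SD) => D0 SD0 D0max.
have H : \sum_(D | S D) w D <= 2 * geom_cst 1 * w D0.
  apply: (@le_trans _ _ (\sum_(D | S D) 2 * pow2 (lg (w D)) `^ 1)).
    by apply: ler_sum => D' _; rewrite powRr1 ?ltW ?pow2_gt0//; exact/lt_pow2_lg.
  rewrite -mulr_sumr -mulrA ler_pM2l// -[w D0]powRr1 ?(ltW (w0 _))//.
  apply: (geom_sum (key := fun D => lg (w D))) => // [D1 D2 SD1 SD2|D1 SD1].
    by apply: (@chain_over_inj P); exact: SP.
  by apply: le_trans (pow2_lg (w0 _)) _; exact: D0max.
apply: (le_trans (le_powR_base (ltW k0) _ H)).
  by apply: sumr_ge0 => D' _; exact: ltW.
rewrite powRM ?mulr_ge0 ?(ltW (w0 _)) ?(ltW g0)//.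
rewrite ler_wpM2l ?powR_ge0// (bigD1 D0)//= lerDl.
by apply: sumr_ge0 => ? _; exact: powR_ge0.
Qed.

(** Jensen's inequality over the average levels [j], with weights [y j], takes the power [k] inside.
    For a fixed level, [chain_pow_le] and [level_tops_sum] bound the remaining sum by a multiple of
    [Gam j ^ k]. *)
Lemma chain_pow_sum k : 1 < k ->
  \sum_(P | top le gen s P == P)
    (\sum_(D | chain_over P D) (gam D / w D) `^ q * w D) `^ k <=
  (2 `^ q * M) `^ k * ((2 * geom_cst 1) `^ k * (2 `^ (k - 1) * geom_cst (k - 1))).
Proof.
move=> k1; have k0 : 0 < k by exact: lt_trans k1.
have w0 := lweight_gt0 ww.
pose lev D := lg (gam D / w D); pose J := keys lev.
have ag0 D : 0 < gam D / w D by rewrite divr_gt0.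
have Gam0 j : 0 <= Gam j by exact: (Phi_ge0 GamP).
(* Needed to divide by [Gam j]: a single member of level [j] is an antichain of positive weight. *)
have GamJ j : j \in J -> 0 < Gam j.
  rewrite mem_undup => /mapP[D _ ->].
  apply: (lt_le_trans (w0 D)).
  have := @GamP (lev D) (pred1 D); rewrite big_pred1_eq; apply.
    by move=> _ /eqP ->; rewrite -ler_pdivlMr// pow2_lg.
  by move=> ? ? /eqP -> /eqP ->.
pose W P j := \sum_(D | chain_over P D && (lev D == j)) w D.
pose y j := pow2 j `^ q * Gam j / M.
have y0 j : 0 <= y j by rewrite !mulr_ge0 ?powR_ge0// invr_ge0 ltW.
have W0 P j : 0 <= W P j by apply: sumr_ge0 => ? _; exact: ltW.
have yM : \sum_(j <- J) y j <= 1.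
  by rewrite -mulr_suml ler_pdivrMr// mul1r; apply: GamM; exact: keys_uniq.
apply: (@le_trans _ _ (\sum_(P | top le gen s P == P) (2 `^ q * M) `^ k *
    \sum_(j <- J) y j * (W P j / Gam j) `^ k)).
  apply: ler_sum => P _.
  have Wd0 j : 0 <= W P j / Gam j by rewrite mulr_ge0// invr_ge0.
  apply: (@le_trans _ _ ((2 `^ q * M) `^ k * (\sum_(j <- J) y j * (W P j / Gam j)) `^ k)); last first.
    by rewrite ler_wpM2l ?powR_ge0// jensen_powR.
  rewrite -powRM; [|by rewrite mulr_ge0 ?powR_ge0// ltW|by apply: sumr_ge0 => j _; rewrite mulr_ge0].
  apply: le_powR_base; first exact: ltW.
    by apply: sumr_ge0 => D _; rewrite mulr_ge0 ?powR_ge0// ltW.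
  rewrite (sum_by_key lev) mulr_sumr !big_seq; apply: ler_sum => j /GamJ Gj.
  apply: (@le_trans _ _ (\sum_(D | chain_over P D && (lev D == j)) (2 * pow2 j) `^ q * w D)).
    apply: ler_sum => D /andP[_ /eqP <-]; rewrite ler_wpM2r ?(ltW (w0 _))//.
    by rewrite le_powR_base ?ltW//; exact/lt_pow2_lg.
  rewrite -mulr_sumr -/(W P j) powRM//; last exact/ltW/pow2_gt0.
  rewrite le_eqVlt; apply/orP; left; apply/eqP; rewrite /y; field.
  by rewrite !gt_eqF.
rewrite -mulr_sumr ler_wpM2l ?powR_ge0// exchange_big/=.
set K := (X in _ <= X).
have K0 : 0 <= K by rewrite !mulr_ge0 ?powR_ge0// ltW// geom_cst_gt0// subr_gt0.
apply: (@le_trans _ _ (\sum_(j <- J) y j * K)); last first.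
  by rewrite -mulr_suml ler_piMl.
rewrite !big_seq; apply: ler_sum => j /GamJ Gj.
rewrite -mulr_sumr ler_wpM2l//.
under eq_bigr do rewrite powRM ?invr_ge0//.
rewrite -mulr_suml.
have -> : (Gam j)^-1 `^ k = (Gam j `^ k)^-1 by rewrite -powR_inv1// -powRrM mulN1r powRN.
rewrite ler_pdivrMr ?powR_gt0//.
apply: (@le_trans _ _ (\sum_(P | top le gen s P == P) (2 * geom_cst 1) `^ k *
   \sum_(D | chain_over P D && (lev D == j)) w D `^ k)).
  by apply: ler_sum => P _; apply: (@chain_pow_le P) => // D /andP[].
rewrite -mulr_sumr /K -mulrA ler_wpM2l ?powR_ge0//.
(* Each [D] lies in the chain over one [P] only, its own [s]-top. *)
apply: (@le_trans _ _ (\sum_(D | (top le gen w D == D) && (lev D == j)) w D `^ k)).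
  rewrite (exchange_big_dep (fun D => (top le gen w D == D) && (lev D == j)))/=; last first.
    by move=> P D _ /andP[/andP[-> _] ->].
  apply: ler_sum => D /andP[tD lD].
  rewrite (big_pred1 (top le gen s D))// => P; rewrite /chain_over tD lD/= andbT.
  apply/andP/eqP => [[_ /eqP//]|->]; split=> //.
  by rewrite (top_idem lam).
have ke : 1 + (k - 1) = k by rewrite addrCA subrr addr0.
have := @level_tops_sum _ _ _ _ _ _ _ lam ww gam0 GamP
  [pred D | (top le gen w D == D) && (lev D == j)] j (k - 1).
rewrite subr_gt0 ke; apply=> //; by move=> D /andP[/eqP + /eqP].
Qed.

End chain_sum.

(** * The half of the sum where the [w]-top lies below the [s]-top *)

Section one_sided_sum.
Context {R : realType}.

Definition average_cst (p M r : R) : R :=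
  2 `^ r * (2 `^ (r / p - 1) * geom_cst (r / p - 1)) * M `^ (r / p).

Definition chain_cst (q M k : R) : R :=
  (2 `^ q * M) `^ k * ((2 * geom_cst 1) `^ k * (2 `^ (k - 1) * geom_cst (k - 1))).

(** Fixed before the family and its weights are introduced, hence independent of them. The first
    summand comes from [F ^ r], the other two from the second use of Young's inequality. *)
Definition one_sided_cst (p p' q q' C0 M : R) : R :=
  let r := (p + q) / 2 in
  let e := (1 - r / q) * q' in
  2 `^ (q / p') * 2 * C0 `^ q * M * average_cst p M r +
  (average_cst p M (p + e) + chain_cst q' M (1 + e / p)).

Context {T : finType} {le : rel T} {gen : T -> nat} {s w phi gam a : T -> R}.
Variables (Phi Gam : int -> R) (p p' q q' C0 M : R).
Hypotheses (lam : laminar le gen) (sw : laminar_weight le s) (ww : laminar_weight le w).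
Hypotheses (phi0 : forall Q, 0 < phi Q) (gam0 : forall Q, 0 < gam Q).
Hypotheses (a0 : forall Q, 0 <= a Q).
Hypotheses (phi_mono : forall Q P, le Q P -> phi Q <= phi P)
  (gam_mono : forall Q P, le Q P -> gam Q <= gam P).
Hypotheses (p1 : 1 < p) (p'1 : 1 < p') (pp' : p^-1 + p'^-1 = 1).
Hypotheses (q1 : 1 < q) (q'1 : 1 < q') (qq' : q^-1 + q'^-1 = 1).
Hypotheses (pq : p < q) (M0 : 0 < M) (C00 : 0 < C0).
Hypothesis PhiP : forall i (S : pred T), (forall Q, S Q -> pow2 i * s Q <= phi Q) ->
  antichain le S -> \sum_(Q | S Q) s Q <= Phi i.
Hypothesis PhiM : forall r, uniq r -> \sum_(i <- r) pow2 i `^ p * Phi i <= M.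
Hypothesis GamP : forall i (S : pred T), (forall Q, S Q -> pow2 i * w Q <= gam Q) ->
  antichain le S -> \sum_(Q | S Q) w Q <= Gam i.
Hypothesis GamM : forall r, uniq r -> \sum_(i <- r) pow2 i `^ q' * Gam i <= M.
Hypothesis aG : forall (S : pred T) Q0, (forall Q, S Q -> le Q0 Q) ->
  \sum_(Q | S Q) a Q <= C0 * a Q0.
Hypothesis aT : forall Q0,
  s Q0 `^ (q / p') * \sum_(Q | le Q0 Q) a Q `^ q * w Q <= M.

Local Notation tl := (top le gen s).
Local Notation tk := (top le gen w).

Let s0 := lweight_gt0 sw.
Let w0 := lweight_gt0 ww.

Lemma chain_min (S : pred T) Q1 : S Q1 ->
  (forall Q Q', S Q -> S Q' -> le Q Q' || le Q' Q) ->
  S [arg min_(Q < Q1 | S Q) gen Q]%N /\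
  forall Q, S Q -> le [arg min_(Q < Q1 | S Q) gen Q]%N Q.
Proof.
move=> SQ1 comp; case: arg_minnP => // Q0 SQ0 min; split=> // Q SQ.
have /orP[//|QQ0] := comp _ _ SQ0 SQ.
suff -> : Q = Q0 by exact: laminar_refl lam _.
apply: (laminar_inj lam QQ0); apply/eqP.
by rewrite eqn_leq (laminar_gen lam QQ0) min.
Qed.

(** For a [w]-top [D], the members with that [w]-top whose [s]-top lies above [D]. They form a chain
    with bottom [low D], and the geometric decay of [a] bounds their sum [at_ D] by a multiple of
    [a (low D)]. *)
Let branch D : pred T := fun Q => (tk Q == D) && le (tk Q) (tl Q).
Let low D := [arg min_(Q < D | branch D Q) gen Q]%N.
Let at_ D := \sum_(Q | branch D Q) a Q.

Let branch_top D : tk D = D -> branch D D.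
Proof. by move=> tD; rewrite /branch tD eqxx/=; exact: le_top lam _. Qed.

Let lowP D : tk D = D -> branch D (low D) /\ forall Q, branch D Q -> le (low D) Q.
Proof.
move=> tD; apply: chain_min; first exact: branch_top.
move=> Q Q' /andP[/eqP tQ _] /andP[/eqP tQ' _].
by apply: (top_comparable lam ww); rewrite tQ tQ'.
Qed.

(** [D] lies between [Q] and the [s]-top of [Q]. *)
Let tl_branch D Q : branch D Q -> tl D = tl Q.
Proof.
by move=> /andP[/eqP <- H]; apply: (top_between lam sw) => //; exact: le_top lam _.
Qed.

Let at_ge0 D : 0 <= at_ D.
Proof. by apply: sumr_ge0. Qed.

Let at_le D : tk D = D -> at_ D <= C0 * a (low D).
Proof. by move=> /lowP[_ H]; exact: aG. Qed.

(** Let [Q0] be the lowest member with [s]-top [P], so that [s P <= 2 * s Q0]. Replacing each [D] by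
    [low D], which lies above [Q0], costs factors 2 and [C0] and leaves a part of the testing sum at
    [Q0]. *)
Let chain_carleson P : tl P = P ->
  \sum_(D | chain_over (le := le) (gen := gen) (s := s) (w := w) P D)
     s P `^ (q / p') * w D * at_ D `^ q <=
  2 `^ (q / p') * 2 * C0 `^ q * M.
Proof.
move=> tP.
have q0 : 0 < q by exact: lt_trans q1.
have qp0 : 0 <= q / p' by rewrite divr_ge0 ?ltW// (lt_trans ltr01).
pose S := [pred Q | tl Q == P].
have [] := @chain_min S P; first by rewrite inE tP.
  by move=> Q Q' /eqP tQ /eqP tQ'; apply: (top_comparable lam sw); rewrite tQ tQ'.
set Q0 := (X in S X) => /eqP tQ0 minQ0.
set K := 2 `^ (q / p') * 2 * C0 `^ q.
have K0 : 0 <= K by rewrite !mulr_ge0 ?powR_ge0.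
apply: (@le_trans _ _ (K * (s Q0 `^ (q / p') * \sum_(Q | le Q0 Q) a Q `^ q * w Q))); last first.
  by rewrite ler_wpM2l.
apply: (@le_trans _ _ (K * (s Q0 `^ (q / p') *
  \sum_(D | chain_over (le := le) (gen := gen) (s := s) (w := w) P D) a (low D) `^ q * w (low D)))).
  rewrite !mulr_sumr; apply: ler_sum => D /andP[/eqP tD /eqP sD].
  have [/andP[/eqP lD _] _] := lowP tD.
  have sP : s P <= 2 * s Q0 by rewrite -tQ0 (weight_top_le lam sw).
  have wD : w D <= 2 * w (low D) by rewrite -{1}lD (weight_top_le lam ww).
  apply: (@le_trans _ _ ((2 * s Q0) `^ (q / p') * (2 * w (low D)) * (C0 * a (low D)) `^ q)).
    apply: ler_pM; rewrite ?powR_ge0 ?mulr_ge0 ?powR_ge0 ?(ltW (w0 _))//.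
      by apply: ler_pM; rewrite ?powR_ge0 ?(ltW (w0 _))// le_powR_base ?(ltW (s0 _)).
    by apply: le_powR_base; [exact: ltW|exact: at_ge0|exact: at_le].
  rewrite !powRM ?(ltW (s0 _))// ?(ltW C00)//.
  rewrite le_eqVlt; apply/orP; left; apply/eqP; rewrite /K; ring.
rewrite ler_wpM2l// ler_wpM2l ?powR_ge0//.
(* Sorting by [w]-top shows that different [D] have different [low D]. *)
rewrite [leRHS](partition_big tk predT)//=.
rewrite [leLHS]big_mkcond/=; apply: ler_sum => D _; case: ifPn => [/andP[/eqP tD /eqP sD]|_]; last first.
  by apply: sumr_ge0 => Q _; rewrite mulr_ge0 ?powR_ge0 ?(ltW (w0 _)).
have [bD _] := lowP tD; rewrite (bigD1 (low D))/=.
  by rewrite lerDl; apply: sumr_ge0 => Q _; rewrite mulr_ge0 ?powR_ge0 ?(ltW (w0 _)).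
have /andP[-> _] := bD; rewrite andbT; apply: minQ0.
by rewrite inE -(tl_branch bD) sD.
Qed.

Let r := (p + q) / 2.
Let e := (1 - r / q) * q'.

(* The exponent [r] strictly between [p] and [q] leaves a positive power [e] of the average of
   [phi] on the side of [gam], to be absorbed by a second application of Young's inequality. *)
Let young_term P D : 0 <= at_ D ->
  phi P * gam D * at_ D <=
  ((phi P / s P) `^ r * s P `^ (r / p)) * (s P `^ (q / p') * w D * at_ D `^ q) +
  ((phi P / s P) * s P `^ p^-1) `^ e * ((gam D / w D) `^ q' * w D).
Proof.
move=> at0.
have p0 : 0 < p by exact: lt_trans p1.
have q0 : 0 < q by exact: lt_trans q1.
have q'0 : 0 < q' by exact: lt_trans q'1.
have sP := s0 P; have wD := w0 D.
set F := (phi P / s P) * s P `^ p^-1.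
set G := (gam D / w D) * w D `^ q'^-1.
set B := s P `^ p'^-1 * w D `^ q^-1 * at_ D.
have F0 : 0 < F by rewrite mulr_gt0 ?powR_gt0// divr_gt0.
have G0 : 0 < G by rewrite mulr_gt0 ?powR_gt0// divr_gt0.
have B0 : 0 <= B by rewrite !mulr_ge0 ?powR_ge0.
have -> : phi P * gam D * at_ D = (F `^ (r / q) * B) * (F `^ (1 - r / q) * G).
  rewrite mulrACA -powRD; last by rewrite (gt_eqF F0) implybT.
  rewrite addrC subrK powRr1 ?(ltW F0)//.
  have E1 : s P `^ p^-1 * s P `^ p'^-1 = s P.
    by rewrite -powRD ?pp' ?powRr1 ?(ltW sP)// (gt_eqF sP) implybT.
  have E2 : w D `^ q^-1 * w D `^ q'^-1 = w D.
    by rewrite -powRD ?qq' ?powRr1 ?(ltW wD)// (gt_eqF wD) implybT.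
  rewrite /F /G /B.
  transitivity ((phi P / s P) * (gam D / w D) * at_ D * (s P `^ p^-1 * s P `^ p'^-1) * (w D `^ q^-1 * w D `^ q'^-1)); last by ring.
  rewrite E1 E2; field; by rewrite !gt_eqF.
apply: (le_trans (young_powR _ _ q1 q'1 qq')).
- by rewrite mulr_ge0 ?powR_ge0.
- by rewrite mulr_ge0 ?powR_ge0 ?(ltW G0).
have Fs t : F `^ t = (phi P / s P) `^ t * s P `^ (t / p).
  rewrite [LHS]powRM ?powR_ge0 ?divr_ge0 ?(ltW (phi0 _)) ?(ltW sP)//.
  by rewrite -powRrM [p^-1 * t]mulrC.
rewrite [(F `^ (r / q) * B) `^ q]powRM ?powR_ge0// -[(F `^ (r / q)) `^ q]powRrM divfK ?gt_eqF// Fs.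
rewrite [(F `^ (1 - r / q) * G) `^ q']powRM ?powR_ge0 ?(ltW G0)// -[(F `^ (1 - r / q)) `^ q']powRrM -/e.
have -> : B `^ q = s P `^ (q / p') * w D * at_ D `^ q.
  rewrite /B [LHS]powRM ?mulr_ge0 ?powR_ge0//.
  rewrite [(s P `^ _ * _) `^ q]powRM ?powR_ge0// -!powRrM mulVf ?gt_eqF// powRr1 ?(ltW wD)//.
  by rewrite [p'^-1 * q]mulrC.
have -> : G `^ q' = (gam D / w D) `^ q' * w D.
  rewrite /G [LHS]powRM ?powR_ge0 ?divr_ge0 ?(ltW (gam0 _)) ?(ltW wD)//.
  by rewrite -powRrM mulVf ?gt_eqF// powRr1 ?(ltW wD).
by [].
Qed.

Lemma one_sided_sum :
  \sum_(Q | le (tk Q) (tl Q)) a Q * (phi Q * gam Q) <= one_sided_cst p p' q q' C0 M.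
Proof.
have p0 : 0 < p by exact: lt_trans p1.
have q0 : 0 < q by exact: lt_trans q1.
have q'0 : 0 < q' by exact: lt_trans q'1.
have pr : p < r by rewrite /r ltr_pdivlMr// mulr_natr mulr2n ltrD2l.
have rq : r / q < 1 by rewrite ltr_pdivrMr// mul1r /r ltr_pdivrMr// mulr_natr mulr2n ltrD2r.
have e0 : 0 < e by rewrite mulr_gt0// subr_gt0.
(* Evaluating [phi] at the [s]-top and [gam] at the [w]-top only increases the terms, and makes them
   constant along a branch. *)
have step1 : \sum_(Q | le (tk Q) (tl Q)) a Q * (phi Q * gam Q) <=
    \sum_(D | tk D == D) phi (tl D) * gam D * at_ D.
  rewrite (partition_big tk (fun D => tk D == D))/=; last by move=> Q _; rewrite (top_idem lam).
  apply: ler_sum => D _; rewrite mulr_sumr.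
  rewrite (eq_bigl (branch D)); last by move=> Q; rewrite /branch andbC.
  apply: ler_sum => Q bQ; rewrite [leRHS]mulrC ler_wpM2l//.
  rewrite (tl_branch bQ); have /andP[/eqP <- _] := bQ.
  by apply: ler_pM; rewrite ?(ltW (phi0 _)) ?(ltW (gam0 _))// ?phi_mono ?gam_mono//; exact: le_top lam _.
apply: (le_trans step1).
rewrite (partition_big tl (fun P => tl P == P))/=; last by move=> Q _; rewrite (top_idem lam).
set KB := 2 `^ (q / p') * 2 * C0 `^ q * M.
pose F P := (phi P / s P) * s P `^ p^-1.
pose H P := \sum_(D | chain_over (le := le) (gen := gen) (s := s) (w := w) P D) (gam D / w D) `^ q' * w D.
have F0 P : 0 < F P by rewrite mulr_gt0 ?powR_gt0// divr_gt0.
have H0 P : 0 <= H P.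
  by apply: sumr_ge0 => D _; rewrite mulr_ge0 ?powR_ge0 ?(ltW (w0 _)).
have Fs P t : F P `^ t = (phi P / s P) `^ t * s P `^ (t / p).
  rewrite [LHS]powRM ?powR_ge0 ?divr_ge0 ?(ltW (phi0 _)) ?(ltW (s0 _))//.
  by rewrite -powRrM [p^-1 * t]mulrC.
apply: (@le_trans _ _ (\sum_(P | tl P == P) (KB * F P `^ r + (F P `^ (p + e) + H P `^ (1 + e / p))))).
  apply: ler_sum => P /eqP tP.
  apply: (@le_trans _ _ (\sum_(D | chain_over (le := le) (gen := gen) (s := s) (w := w) P D)
     ((F P `^ r) * (s P `^ (q / p') * w D * at_ D `^ q) +
      F P `^ e * ((gam D / w D) `^ q' * w D)))).
    apply: ler_sum => D /andP[_ /eqP ->]; rewrite Fs; exact: young_term.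
  rewrite big_split/= -!mulr_sumr -/(H P); apply: lerD.
    by rewrite mulrC ler_wpM2r ?powR_ge0//; exact: chain_carleson.
  have ep0 : 0 < e / p by rewrite divr_gt0.
  have pe0 : 0 < p / e by rewrite divr_gt0.
  (* The exponents [1 + p / e] and [1 + e / p] turn [F P ^ e] into [F P ^ (p + e)], an exponent
     above [p] as [average_pow_sum] requires, and give [H P] an exponent above 1 as [chain_pow_sum]
     requires. *)
  have := @young_powR _ (F P `^ e) (H P) (1 + p / e) (1 + e / p) (powR_ge0 _ _) (H0 P).
  rewrite !ltrDl => /(_ pe0 ep0); rewrite -powRrM mulrDr mulr1 mulrCA divff ?gt_eqF// mulr1.
  rewrite [e + p]addrC; apply; field.
  by rewrite !gt_eqF// ?addr_gt0.
rewrite big_split big_split/= -mulr_sumr /one_sided_cst -/r -/e -/KB.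
have KB0 : 0 <= KB by rewrite !mulr_ge0 ?powR_ge0 ?(ltW M0).
apply: lerD.
  rewrite ler_wpM2l//; under eq_bigr do rewrite Fs.
  exact: (average_pow_sum lam sw phi0 p0 PhiP PhiM).
apply: lerD.
  under eq_bigr do rewrite Fs.
  by apply: (average_pow_sum lam sw phi0 p0 PhiP PhiM); rewrite ltrDl.
by apply: (chain_pow_sum lam sw ww gam0 q'0 M0 GamP GamM); rewrite ltrDl divr_gt0.
Qed.

End one_sided_sum.

Section two_sided_sum.
Context {R : realType}.

Definition laminar_cst (p p' q q' C0 M : R) : R :=
  one_sided_cst p p' q q' C0 M + one_sided_cst q' q p' p C0 M.

Context {T : finType} {le : rel T} {gen : T -> nat} {s w phi gam a : T -> R}.
Variables (Phi Gam : int -> R) (p p' q q' C0 M : R).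
Hypotheses (lam : laminar le gen) (sw : laminar_weight le s) (ww : laminar_weight le w).
Hypotheses (phi0 : forall Q, 0 < phi Q) (gam0 : forall Q, 0 < gam Q).
Hypotheses (a0 : forall Q, 0 <= a Q).
Hypotheses (phi_mono : forall Q P, le Q P -> phi Q <= phi P)
  (gam_mono : forall Q P, le Q P -> gam Q <= gam P).
Hypotheses (p1 : 1 < p) (p'1 : 1 < p') (pp' : p^-1 + p'^-1 = 1).
Hypotheses (q1 : 1 < q) (q'1 : 1 < q') (qq' : q^-1 + q'^-1 = 1).
Hypotheses (pq : p < q) (M0 : 0 < M) (C00 : 0 < C0).
Hypothesis PhiP : forall i (S : pred T), (forall Q, S Q -> pow2 i * s Q <= phi Q) ->
  antichain le S -> \sum_(Q | S Q) s Q <= Phi i.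
Hypothesis PhiM : forall r, uniq r -> \sum_(i <- r) pow2 i `^ p * Phi i <= M.
Hypothesis GamP : forall i (S : pred T), (forall Q, S Q -> pow2 i * w Q <= gam Q) ->
  antichain le S -> \sum_(Q | S Q) w Q <= Gam i.
Hypothesis GamM : forall r, uniq r -> \sum_(i <- r) pow2 i `^ q' * Gam i <= M.
Hypothesis aG : forall (S : pred T) Q0, (forall Q, S Q -> le Q0 Q) ->
  \sum_(Q | S Q) a Q <= C0 * a Q0.
Hypothesis aT : forall Q0,
  s Q0 `^ (q / p') * \sum_(Q | le Q0 Q) a Q `^ q * w Q <= M.
Hypothesis aT' : forall Q0,
  w Q0 `^ (p' / q) * \sum_(Q | le Q0 Q) a Q `^ p' * s Q <= M.

(** Both tops of [Q] lie above [Q], hence are comparable. Exchanging the weights replaces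
    [(p, p', q, q')] by [(q', q, p', p)], and [p < q] gives [q' < p'], so the one-sided bound covers
    both halves. *)
Lemma laminar_sum :
  \sum_Q a Q * (phi Q * gam Q) <= laminar_cst p p' q q' C0 M.
Proof.
have q'p' : q' < p'.
  rewrite -ltf_pV2 ?posrE ?(lt_trans ltr01)//.
  have -> : q'^-1 = 1 - q^-1 by rewrite -qq' addrAC subrr add0r.
  have -> : p'^-1 = 1 - p^-1 by rewrite -pp' addrAC subrr add0r.
  by rewrite ltrD2l ltrN2 ltf_pV2// posrE (lt_trans ltr01).
rewrite (bigID (fun Q => le (top le gen w Q) (top le gen s Q)))/=.
apply: lerD.
  exact: (one_sided_sum lam sw ww phi0 gam0 a0 phi_mono gam_mono p1 p'1 pp'
    q1 q'1 qq' pq M0 C00 PhiP PhiM GamP GamM aG aT).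
apply: (@le_trans _ _ (\sum_(Q | le (top le gen s Q) (top le gen w Q)) a Q * (gam Q * phi Q))).
  rewrite big_mkcond [leRHS]big_mkcond/=; apply: ler_sum => Q _.
  have -> : a Q * (gam Q * phi Q) = a Q * (phi Q * gam Q) by rewrite [gam Q * _]mulrC.
  have /orP[->|->] := laminar_total lam (le_top (s := w) lam Q) (le_top (s := s) lam Q).
    by case: ifPn => // _; rewrite !mulr_ge0 ?(ltW (phi0 _)) ?(ltW (gam0 _)).
  by case: ifPn => // _; rewrite !mulr_ge0 ?(ltW (phi0 _)) ?(ltW (gam0 _)).
have qq'' : q'^-1 + q^-1 = 1 by rewrite addrC.
have pp'' : p'^-1 + p^-1 = 1 by rewrite addrC.
exact: (one_sided_sum lam ww sw gam0 phi0 a0 gam_mono phi_mono q'1 q1 qq''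
    p'1 p1 pp'' q'p' M0 C00 GamP GamM PhiP PhiM aG aT').
Qed.

End two_sided_sum.

(** * Shifted dyadic grids *)

Section shifted_grid.
Context {R : realType}.
Implicit Types (x y : R) (k : int) (b : bool).

(* The sign alternates so that [2 * shift (k + 1)] and [shift k] differ by an integer, which
   makes the shifted grids nested. *)
Definition shift k : R := (-1) ^ k / 3.

Definition grid_index b k x : int := Num.floor (x / pow2 k - b%:R * shift k).

Lemma shiftS k : shift (k + 1) = - shift k.
Proof. by rewrite /shift expfzDr ?oppr_eq0 ?oner_eq0// expr1z mulrN1 mulNr. Qed.

Lemma shiftE k : shift k = 3^-1 \/ shift k = - 3^-1 :> R.
Proof.
have S n : - n.+1%:Z + 1 = - n%:Z by rewrite -addn1 PoszD opprD subrK.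
elim/int_rect: k => [|n [IH|IH]|n [IH|IH]].
- by left; rewrite /shift expr0z mul1r.
- by right; rewrite -addn1 PoszD shiftS IH.
- by left; rewrite -addn1 PoszD shiftS IH opprK.
- by right; have := shiftS (- n.+1%:Z); rewrite S IH => ->; rewrite opprK.
- by left; have := shiftS (- n.+1%:Z); rewrite S IH => /oppr_inj ->.
Qed.

Lemma shift_int k : exists n : int, 3 * shift k = n%:~R :> R.
Proof.
have [->|->] := shiftE k; [exists 1|exists (-1)].
  by rewrite mulfV ?pnatr_eq0.
by rewrite mulrN mulfV ?pnatr_eq0.
Qed.

(** An integer [j] is at most [floor ((z + n) / 2)] exactly when [2 * j - n] is at most
    [floor z]. *)
Lemma floor_half x y (n : int) : Num.floor x = Num.floor y ->
  Num.floor ((x + n%:~R) / 2) = Num.floor ((y + n%:~R) / 2).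
Proof.
have H (z : R) (j : int) : (j <= Num.floor ((z + n%:~R) / 2)) = (2 * j - n <= Num.floor z).
  rewrite !floor_ge_int ler_pdivlMr// intrB intrM lerBlDr.
  by rewrite [2%:~R * _]mulrC.
move=> xy; apply/eqP; rewrite eq_le; apply/andP; split.
  by rewrite H -xy -H.
by rewrite H xy -H.
Qed.

Lemma grid_index_succ b k x y : grid_index b k x = grid_index b k y ->
  grid_index b (k + 1) x = grid_index b (k + 1) y.
Proof.
have [n n3] := shift_int k.
(* Here [n = 3 * shift k], and [- shift (k + 1) = (- shift k + 3 * shift k) / 2]. *)
have E (z : R) : z / pow2 (k + 1) - b%:R * shift (k + 1) =
    ((z / pow2 k - b%:R * shift k) + (b%:Z * n)%:~R) / 2.
  rewrite shiftS pow2S intrM -n3 -pmulrn; field.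
  by rewrite gt_eqF// pow2_gt0.
by rewrite /grid_index !E; exact: floor_half.
Qed.

Lemma grid_index_nested b k k' x y : k <= k' ->
  grid_index b k x = grid_index b k y -> grid_index b k' x = grid_index b k' y.
Proof.
move=> kk' xy; have -> : k' = k + `|k' - k|%N by lia.
elim: (`|k' - k|)%N => [|n IH]; first by rewrite addr0.
by rewrite -addn1 PoszD addrA; exact: grid_index_succ.
Qed.

Lemma grid_index_dist b k x y : grid_index b k x = grid_index b k y ->
  `|x - y| <= pow2 k.
Proof.
have k0 := @pow2_gt0 R k.
rewrite /grid_index => xy.
have := floor_itv (x / pow2 k - b%:R * shift k).
have := floor_itv (y / pow2 k - b%:R * shift k); rewrite xy !intrD mulr1z.
move=> /andP[y1 y2] /andP[x1 x2].
have H : `|x / pow2 k - y / pow2 k| <= 1 by rewrite ler_norml; lra.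
by rewrite -mulrBl normrM normfV (gtr0_norm k0) ler_pdivrMr// mul1r in H.
Qed.

(* The end points of the two grids of mesh [2^k] are at distance at least [2^k / 3]. *)
Lemma one_third_trick k x y : 3 * `|x - y| < pow2 k ->
  exists b, grid_index b k x = grid_index b k y.
Proof.
wlog xy : x y / x <= y.
  move=> H; have [/H//|/ltW yx] := leP x y.
  by rewrite distrC => /(H _ _ yx)[b]; exists b.
have k0 := @pow2_gt0 R k.
rewrite ler0_norm ?subr_le0// opprB => d.
have {}d : y / pow2 k - x / pow2 k < 3^-1.
  by rewrite -mulrBl ltr_pdivrMr// mulrC ltr_pdivlMr// mulrC.
have {}xy : x / pow2 k <= y / pow2 k by rewrite ler_pM2r// invr_gt0.
rewrite /grid_index; move: (x / _) (y / _) d xy => {}x {}y d xy.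
have [E|E] := eqVneq (Num.floor x) (Num.floor y).
  by exists false; rewrite !mul0r !subr0.
exists true; rewrite !mul1r; apply/eqP/negPn/negP => F.
have sep (u v : R) : u <= v -> Num.floor u != Num.floor v ->
    u < (Num.floor v)%:~R /\ (Num.floor v)%:~R <= v.
  move=> uv uv'; split; last exact: floor_le.
  by rewrite -floor_lt_int lt_neqAle uv'/= le_floor.
(* If both grids separated the points, [j1] and [j2 + shift k] would lie in a common interval
   shorter than 1/3, and [j1 - j2] would be, up to sign, an integer strictly between 0 and 2/3. *)
have [a1 a2] := sep _ _ xy E.
have [b1 b2] := sep _ _ (lerB xy (lexx (shift k))) F.
set j1 := Num.floor y in a1 a2; set j2 := Num.floor (y - shift k) in b1 b2.
have [s|s] := shiftE k; rewrite s in b1 b2.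
- have : (0 : R) < (j1 - j2)%:~R by rewrite intrB; lra.
  have : ((j1 - j2)%:~R : R) < 1%:~R by rewrite intrB mulr1z; lra.
  by rewrite ltr0z ltr_int; lia.
- have : (0 : R) < (j2 - j1)%:~R by rewrite intrB; lra.
  have : ((j2 - j1)%:~R : R) < 1%:~R by rewrite intrB mulr1z; lra.
  by rewrite ltr0z ltr_int; lia.
Qed.

End shifted_grid.

(** * Cells, boxes and tails in several coordinates *)

Section enorm_facts.
Context {R : realType} {m : nat}.
Implicit Types x u c : 'rV[R]_m.

Lemma enorm_ge0 x : 0 <= enorm x.
Proof. exact: sqrtr_ge0. Qed.

Lemma coord_le_enorm x i : `|x ord0 i| <= enorm x.
Proof.
rewrite -sqrtr_sqr ler_wsqrtr// (bigD1 i)//= lerDl.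
by apply: sumr_ge0 => j _; exact: sqr_ge0.
Qed.

Lemma enorm_le x d : 0 <= d -> (forall i, `|x ord0 i| <= d) -> enorm x <= m%:R * d.
Proof.
move=> d0 xd.
have md0 : 0 <= m%:R * d by rewrite mulr_ge0.
rewrite /enorm -[leRHS](ger0_norm md0) -sqrtr_sqr ler_wsqrtr//.
apply: (@le_trans _ _ (\sum_(i < m) d ^+ 2)).
  by apply: ler_sum => i _; rewrite -[leLHS]real_normK ?num_real// ler_pXn2r// nnegrE.
rewrite sumr_const card_ord -[leLHS]mulr_natl exprMn ler_wpM2r ?sqr_ge0// expr2.
by rewrite -natrM ler_nat; case: (m) => // n; rewrite leq_pmulr.
Qed.

(** The factor 2 lets [(a + b) ^ 2 <= 2 * (a ^ 2 + b ^ 2)], used in each coordinate, take the place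
    of the Cauchy-Schwarz inequality. *)
Lemma enorm_subr_le x u c : enorm (x - u) <= 2 * (enorm (x - c) + enorm (u - c)).
Proof.
have a0 := enorm_ge0 (x - c); have b0 := enorm_ge0 (u - c).
have ab0 : 0 <= 2 * (enorm (x - c) + enorm (u - c)) by rewrite mulr_ge0// addr_ge0.
have sq (y : 'rV[R]_m) : enorm y ^+ 2 = \sum_(i < m) y ord0 i ^+ 2.
  by rewrite sqr_sqrtr//; apply: sumr_ge0 => i _; exact: sqr_ge0.
rewrite -ler_sqr ?nnegrE ?enorm_ge0// exprMn.
apply: (@le_trans _ _ (2 * (enorm (x - c) ^+ 2 + enorm (u - c) ^+ 2))); last by nra.
rewrite !sq -big_split/= mulr_sumr; apply: ler_sum => i _; rewrite !mxE.
set a := x _ _; set b := u _ _; set e := c _ _.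
have := sqr_ge0 (a - e + (b - e)); rewrite !expr2; nra.
Qed.

Lemma enorm_gt0 x : x != 0 -> 0 < enorm x.
Proof.
move=> x0; rewrite lt_neqAle enorm_ge0 andbT eq_sym; apply: contra x0 => /eqP x0.
apply/eqP/rowP => i; rewrite mxE; apply/eqP; rewrite -normr_eq0 eq_le normr_ge0 andbT.
by rewrite -x0 coord_le_enorm.
Qed.

End enorm_facts.

Section cells.
Context {R : realType} {m : nat}.

Lemma measurable_coord i :
  measurable_fun setT (fun x : borel R m => (x : 'rV[R]_m) ord0 i).
Proof.
apply: (measurability _ (RGenOInfty.measurableE R)) => // _ [_ [a ->] <-].
rewrite setTI; apply: sub_sigma_algebra.
have co : continuous (fun x : 'rV[R]_m => x ord0 i) by exact: coord_continuous.
apply: open_comp; first by move=> x _; exact: co.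
exact: interval_open.
Qed.

Lemma measurable_enorm_sub (d : measure_display) (T : measurableType d)
    (f g : T -> borel R m) : measurable_fun setT f -> measurable_fun setT g ->
  measurable_fun setT (fun x => enorm (f x - g x : 'rV[R]_m)).
Proof.
move=> mf mg; apply: (@measurableT_comp _ _ _ _ _ _ (@Num.sqrt R)).
  by apply: continuous_measurable_fun; exact: sqrt_continuous.
apply: measurable_sum => i; apply: measurable_funX.
under eq_fun do rewrite !mxE.
by apply: measurable_funB; [apply: (measurableT_comp (measurable_coord i) mf)|
  apply: (measurableT_comp (measurable_coord i) mg)].
Qed.

(** A half-open cube of side [2 ^ k]. The choice between the standard and the shifted grid is made
    in each coordinate separately, which gives [2 ^ m] grids. *)
Definition cell (t : 'I_m -> bool) (k : int) (v : 'I_m -> int) : set (borel R m) :=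
  [set x | forall i, grid_index (t i) k ((x : 'rV[R]_m) ord0 i) = v i].

Lemma measurable_cell t k v : measurable (cell t k v).
Proof.
have -> : cell t k v = \bigcap_(i : 'I_m) [set x : borel R m |
    grid_index (t i) k ((x : 'rV[R]_m) ord0 i) = v i].
  by apply/seteqP; split => [x H i _|x H i]; [exact: H | exact: H].
apply: fin_bigcap_measurable => [|i _]; first exact: finite_finset.
have -> : [set x : borel R m | grid_index (t i) k ((x : 'rV[R]_m) ord0 i) = v i] =
  setT `&` (fun x : borel R m => (x : 'rV[R]_m) ord0 i) @^-1`
    `[((v i)%:~R + (t i)%:R * shift k) * pow2 k, ((v i + 1)%:~R + (t i)%:R * shift k) * pow2 k[.
  rewrite setTI; apply/seteqP; split => x /=; rewrite in_itv/= /grid_index.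
    move=> /eqP; rewrite floor_eq => /andP[a b].
    rewrite -ler_pdivlMr ?pow2_gt0// -lerBrDr a/=.
    by rewrite -ltr_pdivrMr ?pow2_gt0// -ltrBlDr.
  move=> /andP[]; rewrite -ler_pdivlMr ?pow2_gt0// -lerBrDr => a.
  rewrite -ltr_pdivrMr ?pow2_gt0// -ltrBlDr => b.
  by apply/eqP; rewrite floor_eq a.
exact: measurable_coord.
Qed.

Lemma cell_nested t k k' v v' : k <= k' -> cell t k v `&` cell t k' v' !=set0 ->
  cell t k v `<=` cell t k' v'.
Proof.
move=> kk' [y [yv yv']] x xv i; rewrite -(yv' i).
by apply: (grid_index_nested kk'); rewrite (xv i) (yv i).
Qed.

Lemma cell_enorm t k v x y : cell t k v x -> cell t k v y ->
  enorm (x - y : 'rV[R]_m) <= m%:R * pow2 k.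
Proof.
move=> xv yv; apply: enorm_le => [|i]; first exact/ltW/pow2_gt0.
by rewrite !mxE; apply: (@grid_index_dist _ (t i)); rewrite (xv i) (yv i).
Qed.

Lemma common_cell (x u : 'rV[R]_m) k : 3 * enorm (x - u) < pow2 k ->
  exists t : {ffun 'I_m -> bool}, forall i,
    grid_index (t i) k (x ord0 i) = grid_index (t i) k (u ord0 i).
Proof.
move=> xu.
have H i : exists b, grid_index b k (x ord0 i) == grid_index b k (u ord0 i).
  suff [b /eqP Hb] : exists b, grid_index b k (x ord0 i) = grid_index b k (u ord0 i) by exists b.
  apply: one_third_trick; apply: le_lt_trans xu; rewrite ler_pM2l//.
  by have := coord_le_enorm (x - u) i; rewrite !mxE.
pose t := [ffun i => xchoose (H i)]; exists t => i.
by rewrite ffunE; apply/eqP; exact: xchooseP (H i).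
Qed.

End cells.

Section grid.
Context {R : realType} {m : nat}.
Variables (th : R) (t : 'I_m -> bool) (N : nat).
Hypothesis th0 : 0 < th.

Local Notation grid_box := ('I_N.*2.+1 * {ffun 'I_m -> 'I_N.*2.+1})%type.

Implicit Types z : grid_box.

(** Levels and indices run from [- N] to [N] and are coded by ordinals, so that the boxes form a
    finite type. *)
Definition box_level (z : grid_box) : int := (z.1 : nat)%:Z - N%:Z.
Definition box_index (z : grid_box) (i : 'I_m) : int := (z.2 i : nat)%:Z - N%:Z.
Definition box (z : grid_box) : set (borel R m) := cell t (box_level z) (box_index z).
Definition box_weight (z : grid_box) : R := pow2 (- box_level z) `^ th.
Definition box_le (z z' : grid_box) : bool :=
  (z.1 <= z'.1)%N && `[< box z `<=` box z' >].

Lemma measurable_box z : measurable (box z).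
Proof. exact: measurable_cell. Qed.

Lemma box_level_le z z' : (box_level z <= box_level z') = (z.1 <= z'.1)%N.
Proof. by rewrite lerD2r. Qed.

Lemma box_nested z z' : (z.1 <= z'.1)%N -> box z `&` box z' !=set0 -> box_le z z'.
Proof.
move=> zz' zz'0; rewrite /box_le zz'; apply/asboolP; apply: cell_nested => //.
by rewrite box_level_le.
Qed.

Lemma box_inj z z' : box z `&` box z' !=set0 -> z.1 = z'.1 -> z = z'.
Proof.
case: z z' => [k v] [k' v'] [x [xz xz']] /= kk'; subst k'; congr pair.
apply/ffunP => i; apply/val_inj/eqP; rewrite -eqz_nat -(inj_eq (addIr (- N%:Z))).
by apply/eqP; have := xz i; rewrite (xz' i) => /esym.
Qed.

Lemma box_le_disjoint z z' : ~~ box_le z z' -> ~~ box_le z' z -> box z `&` box z' = set0.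
Proof.
move=> a b; apply/eqP/negPn/negP => /set0P zz'.
have /orP[h|h] := leq_total z.1 z'.1.
  by move: a; rewrite box_nested.
by move: b; rewrite box_nested// setIC.
Qed.

Lemma box_le_sub z z' : box_le z z' -> box z `<=` box z'.
Proof. by move=> /andP[_ /asboolP]. Qed.

Variable good : {pred grid_box}.
Hypothesis good0 : forall z, z \in good -> box z !=set0.
Let I := {z | z \in good}.

(** A point of a [good] box lies in every box above it, and boxes sharing a point are nested. *)
Lemma box_laminar : laminar (relpre val box_le : rel I) (fun i => (val i).1 : nat).
Proof.
split => [i|k i j|i j|i j|i j k]/=.
- by rewrite /box_le leqnn; exact/asboolP.
- move=> /andP[ik /asboolP sik] /andP[kj /asboolP skj].
  by rewrite /box_le (leq_trans ik kj); apply/asboolP; exact: subset_trans skj.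
- by move=> /andP[].
- move=> /andP[_ /asboolP ij] eij; apply/val_inj/box_inj; last exact/val_inj.
  by have [x xi] := good0 (valP i); exists x; split=> //; exact: ij.
- move=> /andP[_ /asboolP ij] /andP[_ /asboolP ik]; have [x xi] := good0 (valP i).
  have [jk|kj] := leP (val j).1 (val k).1.
    by rewrite box_nested//; exists x; split; [exact: ij|exact: ik].
  by rewrite orbC box_nested//; [exact: ltnW|exists x; split; [exact: ik|exact: ij]].
Qed.

(** The boxes containing a fixed point have distinct levels, so their weights are terms of a
    geometric series. *)
Lemma box_weight_sum (S : pred I) (i0 : I) : (forall i, S i -> box_le (val i0) (val i)) ->
  \sum_(i | S i) box_weight (val i) <= geom_cst th * box_weight (val i0).
Proof.
move=> Si; rewrite /box_weight; apply: (geom_sum (key := fun i : I => - box_level (val i))) => //.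
  move=> i j Si' Sj /oppr_inj/addIr[] ij; apply/val_inj/box_inj; last exact: val_inj.
  by have [x xi] := good0 (valP i0); exists x; split; apply: (box_le_sub _ xi); exact: Si.
by move=> i /Si /andP[H _]; rewrite le_pow2// lerN2 box_level_le.
Qed.

Definition tail1 (c : 'rV[R]_m) (l : R) (x : borel R m) : R :=
  (1 + enorm (x - c : 'rV[R]_m) / l) `^ (- th).

Lemma tail1_gt0 c l x : 0 < l -> 0 < tail1 c l x.
Proof.
by move=> l0; rewrite powR_gt0// ltr_pwDl// divr_ge0 ?enorm_ge0// ltW.
Qed.

Lemma measurable_tail1 c l : measurable_fun setT (tail1 c l).
Proof.
apply: (@measurableT_comp _ _ _ _ _ _ (fun x : R => x `^ (- th))) => //.
apply: measurable_funD => //; apply: measurable_funM => //.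
by apply: measurable_enorm_sub => //; exact: measurable_cst.
Qed.

(** Adding [|x - x0| <= m * P] to [P0 <= P], where [P0] and [P] are the sides, gives
    [P0 * (1 + |x - x0| / P0) <= (1 + m) * P]. *)
Lemma box_weight_le z0 z x0 x : box z0 x0 -> box z x0 -> box z x -> (z0.1 <= z.1)%N ->
  pow2 (- box_level z) <= (1 + m%:R) * pow2 (- box_level z0) *
    (1 + enorm (x - x0 : 'rV[R]_m) / pow2 (box_level z0))^-1.
Proof.
move=> z0x0 zx0 zx; rewrite -box_level_le => zz.
have p0 := @pow2_gt0 R (box_level z0); have p1 := @pow2_gt0 R (box_level z).
rewrite !pow2N; set P0 := pow2 _ in p0 *; set P := pow2 _ in p1 *; set e := enorm _.
have eP : e <= m%:R * P by exact: cell_enorm zx zx0.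
have P0P : P0 <= P by exact: le_pow2.
have e0 : 0 <= e by exact: enorm_ge0.
rewrite -mulrA -invfM -[leLHS]mul1r ler_pdivrMr// mulrAC ler_pdivlMr; last first.
  by rewrite mulr_gt0// ltr_pwDl// divr_ge0// ltW.
by rewrite mul1r mulrDr mulr1 mulrCA divff ?gt_eqF// mulr1 mulrDl mul1r lerD.
Qed.

Local Open Scope ereal_scope.

Lemma measurable_tail1_pow c l (r : R) :
  measurable_fun setT (fun x => (tail1 c l x `^ r)%:E).
Proof.
apply/measurable_EFinP.
by apply: (@measurableT_comp _ _ _ _ _ _ (fun x : R => x `^ r)%R) => //; exact: measurable_tail1.
Qed.

(** On the box the tail is at least [(1 + m) ^ (- th)]. Any point [x0] of the box may be its centre,
    since the characteristic runs over all cubes. *)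
Lemma box_measure_le (mu : {measure set (borel R m) -> \bar R}) (r : R) z0 x0 :
  (0 < r)%R -> box z0 x0 ->
  mu (box z0) <= ((1 + m%:R) `^ (th * r))%:E *
    \int[mu]_x (tail1 x0 (pow2 (box_level z0)) x `^ r)%:E.
Proof.
move=> r0 zx0; rewrite -ge0_integralZl_EFin ?powR_ge0//; last 2 first.
  by move=> x _; rewrite lee_fin powR_ge0.
  exact: measurable_tail1_pow.
apply: (@le_trans _ _ (\int[mu]_(x in box z0) 1)).
  by rewrite integral_cst ?mul1e//; exact: measurable_box.
have m1 : (0 <= 1 + m%:R :> R)%R by rewrite addr_ge0.
apply: (@le_trans _ _ (\int[mu]_(x in box z0) (((1 + m%:R) `^ (th * r))%:E *
    (tail1 x0 (pow2 (box_level z0)) x `^ r)%:E))); last first.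
  apply: ge0_subset_integral => //; first exact: measurable_box.
    by apply: measurable_funeM; exact: measurable_tail1_pow.
  by move=> x _; rewrite -EFinM lee_fin mulr_ge0// powR_ge0.
apply: ge0_le_integral => //; first exact: measurable_box.
- by apply: measurable_funTS; apply: measurable_funeM; exact: measurable_tail1_pow.
move=> x zx; rewrite -EFinM lee_fin /tail1.
have := box_weight_le zx0 zx0 zx (leqnn _).
set p0 := pow2 (- _); have p00 : (0 < p0)%R by exact: pow2_gt0.
rewrite mulrAC -[X in (X <= _)%R]mul1r ler_pM2r//; set e := (1 + enorm _ / _)%R => H.
have e0 : (0 <= e)%R by rewrite addr_ge0// divr_ge0 ?enorm_ge0// ltW// pow2_gt0.
have -> : ((e `^ - th) `^ r = e^-1 `^ (th * r))%R.
  by rewrite -powRrM -[e^-1%R]powR_inv1// -powRrM mulN1r mulNr.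
rewrite -powRM ?invr_ge0// -[X in (X <= _)%R](congr1 (fun f => f (th * r)%R) (@powR1 R)).
by apply: le_powR_base => //; rewrite mulr_ge0 ?(ltW th0) ?(ltW r0).
Qed.

(** For fixed [x], the boxes above [i0] that contain [x] have weights in a geometric series, whose
    largest term is at most a multiple of the tail at [x] by [box_weight_le]. This is the origin of
    the tail in place of the indicator of a cube. *)
Lemma box_testing (mu : {measure set (borel R m) -> \bar R}) (r : R) (i0 : I) x0 :
  (0 < r)%R -> box (val i0) x0 ->
  \sum_(i : I | box_le (val i0) (val i)) (box_weight (val i) `^ r)%:E * mu (box (val i)) <=
  (geom_cst (th * r) * ((1 + m%:R) * pow2 (- box_level (val i0))) `^ (th * r))%:E *
    \int[mu]_x (tail1 x0 (pow2 (box_level (val i0))) x `^ r)%:E.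
Proof.
move=> r0 ix0; have thr0 : (0 < th * r)%R by rewrite mulr_gt0.
set c := (1 + m%:R)%R; set P0 := pow2 (- _).
have c0 : (0 <= c)%R by rewrite addr_ge0.
have P00 : (0 <= P0)%R by exact/ltW/pow2_gt0.
have K0 : (0 <= geom_cst (th * r) * (c * P0) `^ (th * r))%R.
  by rewrite mulr_ge0 ?powR_ge0// ltW// geom_cst_gt0.
rewrite -ge0_integralZl_EFin//; last 2 first.
  by move=> x _; rewrite lee_fin powR_ge0.
  exact: measurable_tail1_pow.
have -> : \sum_(i : I | box_le (val i0) (val i)) (box_weight (val i) `^ r)%:E * mu (box (val i)) =
    \sum_(i : I | box_le (val i0) (val i)) \int[mu]_x ((box_weight (val i) `^ r)%:E * (\1_(box (val i)) x)%:E).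
  apply: eq_bigr => i _; rewrite ge0_integralZl_EFin ?powR_ge0//.
  - by rewrite integral_indic ?setIT//; exact: measurable_box.
  - by apply/measurable_EFinP; apply: measurable_indic; exact: measurable_box.
rewrite -big_filter -ge0_integral_sum//; last 2 first.
  move=> i; apply: measurable_funeM.
  by apply/measurable_EFinP; apply: measurable_indic; exact: measurable_box.
  by move=> i x _; rewrite -EFinM lee_fin mulr_ge0 ?powR_ge0.
apply: ge0_le_integral => //.
- by move=> x _; apply: sume_ge0 => i _; rewrite -EFinM lee_fin mulr_ge0 ?powR_ge0.
- apply: emeasurable_sum => i; apply: measurable_funeM.
  by apply/measurable_EFinP; apply: measurable_indic; exact: measurable_box.
- by apply: measurable_funeM; exact: measurable_tail1_pow.
move=> x _; rewrite big_filter -EFinM sumEFin lee_fin.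
rewrite /tail1; set e := (1 + enorm _ / _)%R.
have e0 : (0 < e)%R by rewrite ltr_pwDl// divr_ge0 ?enorm_ge0// ltW// pow2_gt0.
apply: (@le_trans _ _ (\sum_(i : I | box_le (val i0) (val i) && (x \in box (val i)))
    pow2 (- box_level (val i)) `^ (th * r))%R).
  rewrite [leRHS]big_mkcondr/=; apply: ler_sum => i _; rewrite indicE.
  by case: ifPn => xi; rewrite ?mulr1 ?mulr0// powRrM.
have -> : (geom_cst (th * r) * (c * P0) `^ (th * r) * (e `^ - th) `^ r =
   geom_cst (th * r) * (c * P0 * e^-1) `^ (th * r))%R.
  rewrite -mulrA; congr (_ * _)%R; rewrite [RHS]powRM ?mulr_ge0 ?invr_ge0 ?(ltW e0)//.
  by congr (_ * _)%R; rewrite -powRrM -[e^-1%R]powR_inv1 ?(ltW e0)// -powRrM mulN1r mulNr.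
apply: (geom_sum (key := fun i : I => - box_level (val i))%R) => //.
  move=> i j; rewrite !unfold_in => /andP[_ /set_mem xi] /andP[_ /set_mem xj] /oppr_inj/addIr[] ij.
  by apply/val_inj/box_inj; [exists x|exact: val_inj].
move=> i /andP[ile /set_mem xi]; apply: box_weight_le => //; last by case/andP: ile.
exact: (box_le_sub ile).
Qed.

(** The factor [(1 + m) ^ (th * q)] occurs twice: from [box_measure_le] and from [box_testing]. *)
Definition testing_cst (q : R) : R := (geom_cst (th * q) * (1 + m%:R) `^ (2 * (th * q)))%R.

Section testing.
Variables (sigma omega : {measure set (borel R m) -> \bar R}) (q p' A : R).
Hypotheses (q0 : (0 < q)%R) (p'0 : (0 < p')%R) (A0 : (0 < A)%R).
Hypothesis HA : forall c l, (0 < l)%R -> (l `^ (- th))%:E *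
     (\int[omega]_x (tail1 c l x `^ q)%:E) `^ q^-1 *
     (\int[sigma]_x (tail1 c l x `^ p')%:E) `^ p'^-1 <= A%:E.
Hypotheses (sI0 : forall i : I, 0 < sigma (box (val i)))
  (wI0 : forall i : I, 0 < omega (box (val i))).

(** Both tail integrals are positive because the box has positive mass for both measures; if one
    were infinite, so would be the product that [A] bounds. *)
Lemma box_tail_fin (i0 : I) x0 : box (val i0) x0 -> exists s w : R,
  [/\ (0 < s)%R, (0 < w)%R,
     \int[sigma]_x (tail1 x0 (pow2 (box_level (val i0))) x `^ p')%:E = s%:E,
     \int[omega]_x (tail1 x0 (pow2 (box_level (val i0))) x `^ q)%:E = w%:E &
     (pow2 (box_level (val i0)) `^ (- th) * w `^ q^-1 * s `^ p'^-1 <= A)%R].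
Proof.
move=> ix0; have P0 : (0 < pow2 (box_level (val i0)) :> R)%R by exact: pow2_gt0.
have := HA x0 P0.
have H1 := box_measure_le sigma p'0 ix0; have H2 := box_measure_le omega q0 ix0.
have HS0 : 0 <= \int[sigma]_x (tail1 x0 (pow2 (box_level (val i0))) x `^ p')%:E.
  by apply: integral_ge0 => x _; rewrite lee_fin powR_ge0.
have HW0 : 0 <= \int[omega]_x (tail1 x0 (pow2 (box_level (val i0))) x `^ q)%:E.
  by apply: integral_ge0 => x _; rewrite lee_fin powR_ge0.
move: H1 H2 HS0 HW0.
set S := \int[sigma]_x _; set W := \int[omega]_x _.
move: S W => S W H1 H2 S0 W0 HSW.
have {}S0 : 0 < S.
  rewrite lt_neqAle S0 andbT eq_sym; apply/eqP => SE.
  by have := sI0 i0; rewrite ltNge => /negP; apply; move: H1; rewrite SE mule0.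
have {}W0 : 0 < W.
  rewrite lt_neqAle W0 andbT eq_sym; apply/eqP => WE.
  by have := wI0 i0; rewrite ltNge => /negP; apply; move: H2; rewrite WE mule0.
have l0 : 0 < (pow2 (box_level (val i0)) `^ (- th))%:E by rewrite lte_fin powR_gt0.
have Sy : S < +oo.
  rewrite ltNge leye_eq; apply/eqP => SE; move: HSW.
  rewrite SE poweRyr ?invr_eq0 ?gt_eqF// gt0_muley ?leye_eq//.
  by rewrite mule_gt0// poweR_gt0.
have Wy : W < +oo.
  rewrite ltNge leye_eq; apply/eqP => WE; move: HSW.
  rewrite WE poweRyr ?invr_eq0 ?gt_eqF// gt0_muley// gt0_mulye ?leye_eq//.
  by rewrite poweR_gt0.
case: S Sy S0 H1 HSW => // s _ s0 _; case: W Wy W0 H2 => // w _ w0 _.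
rewrite !poweR_EFin -!EFinM lee_fin => HSW.
by exists s, w; split.
Qed.

Lemma box_measure_lty (i : I) : sigma (box (val i)) < +oo /\ omega (box (val i)) < +oo.
Proof.
have [x ix] := good0 (valP i).
have [s [w [s0 w0 sE wE _]]] := box_tail_fin ix.
split.
  by apply: (le_lt_trans (box_measure_le sigma p'0 ix)); rewrite sE -EFinM ltry.
by apply: (le_lt_trans (box_measure_le omega q0 ix)); rewrite wE -EFinM ltry.
Qed.

(** The mass of the box and the sum over the boxes above it are bounded through the same tail, for
    [sigma] and for [omega]. The side length then occurs with exactly the power it has in the
    characteristic. *)
Lemma box_tail_testing (i0 : I) :
  (fine (sigma (box (val i0))) `^ (q / p') *
     \sum_(i : I | box_le (val i0) (val i))
       (box_weight (val i) / A) `^ q * fine (omega (box (val i))) <= testing_cst q)%R.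
Proof.
have [x0 ix0] := good0 (valP i0).
have [s [w [s0 w0 sE wE sw]]] := box_tail_fin ix0.
have P0 : (0 < pow2 (box_level (val i0)) :> R)%R by exact: pow2_gt0.
have c0 : (0 < 1 + m%:R :> R)%R by rewrite ltr_pwDl.
have thq0 : (0 < th * q)%R by rewrite mulr_gt0.
have fin (mu : {measure set (borel R m) -> \bar R}) (i : I) : mu (box (val i)) < +oo ->
    mu (box (val i)) = (fine (mu (box (val i))))%:E.
  by move=> h; rewrite fineK// ge0_fin_numE.
have H1 : (fine (sigma (box (val i0))) <= (1 + m%:R) `^ (th * p') * s)%R.
  have := box_measure_le sigma p'0 ix0; rewrite sE -EFinM.
  by rewrite (fin sigma) ?lee_fin//; case: (box_measure_lty i0).
have H2 : (\sum_(i : I | box_le (val i0) (val i)) box_weight (val i) `^ q * fine (omega (box (val i)))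
   <= geom_cst (th * q) * ((1 + m%:R) * pow2 (- box_level (val i0))) `^ (th * q) * w)%R.
  have := box_testing omega q0 ix0; rewrite wE -EFinM -lee_fin -sumEFin; apply: le_trans.
  apply: lee_sum => i _; rewrite EFinM -(fin omega)//.
  by case: (box_measure_lty i).
have -> : (\sum_(i : I | box_le (val i0) (val i))
    (box_weight (val i) / A) `^ q * fine (omega (box (val i))) =
    (A `^ q)^-1 * \sum_(i : I | box_le (val i0) (val i))
    box_weight (val i) `^ q * fine (omega (box (val i))))%R.
  rewrite mulr_sumr; apply: eq_bigr => i _.
  rewrite powRM ?powR_ge0 ?invr_ge0 ?(ltW A0)// -[A^-1%R]powR_inv1 ?(ltW A0)// -powRrM mulN1r powRN.
  by rewrite mulrAC mulrC mulrA.
rewrite mulrCA mulrC ler_pdivrMr ?powR_gt0//.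
apply: (@le_trans _ _ (((1 + m%:R) `^ (th * p') * s) `^ (q / p') *
  (geom_cst (th * q) * ((1 + m%:R) * pow2 (- box_level (val i0))) `^ (th * q) * w))%R).
  apply: ler_pM; rewrite ?powR_ge0//.
    by apply: sumr_ge0 => i _; rewrite mulr_ge0 ?powR_ge0 ?fine_ge0.
  by apply: le_powR_base; rewrite ?fine_ge0 ?divr_ge0 ?(ltW q0) ?(ltW p'0).
have E (P : R) : (0 < P)%R -> ((P `^ (- th) * w `^ q^-1 * s `^ p'^-1) `^ q =
    P^-1 `^ (th * q) * w * s `^ (q / p') :> R)%R.
  move=> P1; rewrite powRM ?mulr_ge0 ?powR_ge0// [((_ * _) `^ q)%R]powRM ?powR_ge0// -!powRrM.
  rewrite [(q^-1 * q)%R]mulVf ?gt_eqF// powRr1 ?(ltW w0)// [(p'^-1 * q)%R]mulrC.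
  by rewrite -[(P^-1)%R]powR_inv1 ?(ltW P1)// -powRrM mulN1r mulNr.
have : ((pow2 (box_level (val i0)) `^ (- th) * w `^ q^-1 * s `^ p'^-1) `^ q <= A `^ q)%R.
  by apply: le_powR_base => //; rewrite ?(ltW q0)// !mulr_ge0 ?powR_ge0.
rewrite E// -pow2N => H.
rewrite !powRM ?powR_ge0 ?(ltW s0) ?(ltW c0) ?(ltW (pow2_gt0 _))//.
rewrite -powRrM mulrA [(th * p' * _)%R]mulrACA [(p' * p'^-1)%R]mulfV ?gt_eqF// mulr1.
rewrite /testing_cst mulr_natl mulr2n powRD ?(gt_eqF c0) ?implybT//.
have K0 : (0 <= geom_cst (th * q) * ((1 + m%:R) `^ (th * q) * (1 + m%:R) `^ (th * q)))%R.
  by rewrite !mulr_ge0 ?powR_ge0 ?(ltW (geom_cst_gt0 _)).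
apply: le_trans (ler_wpM2l K0 H).
rewrite le_eqVlt; apply/orP; left; apply/eqP; ring.
Qed.

End testing.

End grid.

Local Open Scope ereal_scope.

(** * The one-parameter inequality *)

Section superlevel.
Context {d} {T : measurableType d} {R : realType} {sigma : {measure set T -> \bar R}}.
Variables (f : T -> \bar R) (p : R).
Hypotheses (mf : measurable_fun setT f) (f0 : forall x, 0 <= f x).
Hypotheses (p1 : (1 < p)%R) (fp : \int[sigma]_x (f x `^ p) <= 1).

Definition superlevel (i : int) : T -> \bar R :=
  fun x => if (pow2 (i - 1))%:E < f x then f x else 0.

(* If the average of [f] over [Q] is at least [2^i], then at least half of it comes from the
   points where [f > 2^(i-1)]. *)
Definition superlevel_int (i : int) : R :=
  ((pow2 (i - 1))^-1 * fine (\int[sigma]_x superlevel i x))%R.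

Lemma superlevel_ge0 i x : 0 <= superlevel i x.
Proof. by rewrite /superlevel; case: ifPn. Qed.

Lemma measurable_superlevel i : measurable_fun setT (superlevel i).
Proof.
apply: measurable_fun_ifT => //.
exact: measurable_fun_lte.
Qed.

Lemma measurable_powf : measurable_fun setT (fun x => f x `^ p).
Proof. exact: measurableT_comp (measurable_poweR _) mf. Qed.

(** Where [f] exceeds [2 ^ (i - 1)], the power [p - 1] of the quotient of the two is at least 1. *)
Lemma superlevel_le i x :
  superlevel i x <= ((pow2 (i - 1))`^ (1 - p))%:E * (f x `^ p).
Proof.
have h0 := @pow2_gt0 R (i - 1).
rewrite /superlevel; case: ifPn => [|_]; last by rewrite mule_ge0 ?poweR_ge0// lee_fin powR_ge0.
have := f0 x; case: (f x) => [v| |]// v0 hv.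
  rewrite poweR_EFin -EFinM lee_fin; rewrite !lte_fin in v0 hv *; rewrite lee_fin in v0.
  have vp : (0 < v)%R by exact: lt_trans hv.
  have -> : (v `^ p = v * v `^ (p - 1))%R by rewrite mulr_powRB1// (lt_trans _ p1).
  rewrite mulrCA ler_peMr// -(opprB p 1) powRN.
  rewrite mulrC ler_pdivlMr ?powR_gt0// mul1r; apply: le_powR_base.
  - by rewrite subr_ge0 ltW.
  - exact: ltW.
  - exact: ltW.
rewrite poweRyr ?gt_eqF// ?(lt_trans _ p1)//.
by rewrite gt0_muley// lte_fin powR_gt0.
Qed.

Lemma superlevel_int_lty i : \int[sigma]_x superlevel i x < +oo.
Proof.
apply: (@le_lt_trans _ _ (((pow2 (i - 1))`^ (1 - p))%:E * \int[sigma]_x (f x `^ p))).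
  rewrite -ge0_integralZl_EFin ?powR_ge0//; last 2 first.
    by move=> x _; exact: poweR_ge0.
    exact: measurable_powf.
  apply: ge0_le_integral => //.
  - by move=> x _; exact: superlevel_ge0.
  - exact: measurable_superlevel.
  - by apply: measurable_funeM; exact: measurable_powf.
  - by move=> x _; exact: superlevel_le.
apply: (@le_lt_trans _ _ (((pow2 (i - 1))`^ (1 - p))%:E * 1)).
  by rewrite lee_pmul2l// ?lte_fin ?powR_gt0// pow2_gt0.
by rewrite mule1 ltry.
Qed.

Lemma superlevel_intE i : (superlevel_int i)%:E =
  ((pow2 (i - 1))^-1)%:E * \int[sigma]_x superlevel i x.
Proof.
rewrite /superlevel_int EFinM fineK//.
rewrite ge0_fin_numE ?superlevel_int_lty//.
by apply: integral_ge0 => x _; exact: superlevel_ge0.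
Qed.

Definition superlevel_cst : R := (2 `^ p * geom_cst (p - 1))%R.

(** At a point [x] the levels with [2 ^ (i - 1) < f x] contribute [2 * f x * 2 ^ (i * (p - 1))]
    each: a geometric series, as [p > 1], whose levels satisfy [2 ^ i < 2 * f x]. *)
Lemma superlevel_int_sum r : uniq r ->
  (\sum_(i <- r) pow2 i `^ p * superlevel_int i <= superlevel_cst)%R.
Proof.
move=> ur; rewrite -lee_fin -sumEFin.
have K0 : (0 <= superlevel_cst)%R.
  by rewrite mulr_ge0 ?powR_ge0 ?ltW// geom_cst_gt0// subr_gt0.
have p0 : (0 < p)%R by exact: lt_trans p1.
apply: (@le_trans _ _ (superlevel_cst%:E * \int[sigma]_x (f x `^ p))); last first.
  by rewrite -[leRHS]mule1 lee_wpmul2l.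
under eq_bigr => i _.
  rewrite EFinM superlevel_intE muleA -EFinM -ge0_integralZl_EFin; last first.
  - by rewrite mulr_ge0 ?powR_ge0// invr_ge0 ltW// pow2_gt0.
  - exact: measurable_superlevel.
  - by move=> x _; exact: superlevel_ge0.
  - exact: measurableT.
  over.
rewrite -ge0_integral_sum//; last 2 first.
  by move=> i; apply: measurable_funeM; exact: measurable_superlevel.
  move=> i x _; rewrite mule_ge0 ?superlevel_ge0// lee_fin.
  by rewrite mulr_ge0 ?powR_ge0// invr_ge0 ltW// pow2_gt0.
rewrite -ge0_integralZl_EFin//; last 2 first.
  by move=> x _; exact: poweR_ge0.
  exact: measurable_powf.
apply: ge0_le_integral => //.
- move=> x _; apply: sume_ge0 => i _; rewrite mule_ge0 ?superlevel_ge0// lee_fin.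
  by rewrite mulr_ge0 ?powR_ge0// invr_ge0 ltW// pow2_gt0.
- by apply: emeasurable_sum => i; apply: measurable_funeM; exact: measurable_superlevel.
- by apply: measurable_funeM; exact: measurable_powf.
move=> x _; rewrite /superlevel; have := f0 x; case: (f x) => [v| |]// v0; last first.
  rewrite poweRyr ?gt_eqF// gt0_muley ?leey// lte_fin.
  by rewrite mulr_gt0 ?powR_gt0// geom_cst_gt0// subr_gt0.
rewrite lee_fin in v0; move: v0; rewrite le_eqVlt => /predU1P[<-|v0].
  rewrite big1; first by rewrite mule_ge0 ?poweR_ge0// lee_fin.
  by move=> i _; rewrite lte_fin ltNge ltW ?pow2_gt0//= mule0.
rewrite poweR_EFin -EFinM.
apply: (@le_trans _ _ (\sum_(i <- [seq i <- r | (pow2 (i - 1) < v)%R])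
    (2 * v * pow2 i `^ (p - 1))%:E)).
  rewrite big_filter [leRHS]big_mkcond/=; apply: lee_sum => i _; rewrite lte_fin.
  case: ifPn => _; last by rewrite mule0.
  rewrite -EFinM lee_fin pow2B1 le_eqVlt; apply/orP; left; apply/eqP.
  have i0 := @pow2_gt0 R i.
  rewrite -(@mulr_powRB1 _ (pow2 i) p (ltW i0) p0); field.
  by rewrite gt_eqF.
rewrite sumEFin lee_fin -mulr_sumr.
have H : (\sum_(i <- [seq i <- r | pow2 (i - 1) < v]) pow2 i `^ (p - 1) <=
    geom_cst (p - 1) * (2 * v) `^ (p - 1))%R.
  apply: geom_sum_seq; [by rewrite subr_gt0|by rewrite filter_uniq|].
  by move=> i; rewrite mem_filter pow2B1 ltr_pdivrMr// mulrC => /andP[/ltW].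
apply: (le_trans (ler_wpM2l _ H)); first by rewrite mulr_ge0 ?(ltW v0).
rewrite /superlevel_cst.
have -> : (2 `^ p = 2 * 2 `^ (p - 1) :> R)%R by rewrite mulr_powRB1.
have -> : (v `^ p = v * v `^ (p - 1) :> R)%R by rewrite mulr_powRB1 ?(ltW v0).
rewrite powRM ?(ltW v0)// le_eqVlt; apply/orP; left; apply/eqP; ring.
Qed.

(** Since [f <= 1 + f ^ p], the integral of [f] over a set of finite measure is finite. *)
Lemma integral_le1D (Q : set T) : measurable Q ->
  \int[sigma]_(x in Q) f x <= sigma Q + 1.
Proof.
move=> mQ; apply: (@le_trans _ _ (\int[sigma]_(x in Q) (1 + f x `^ p))).
  apply: ge0_le_integral => //.
  - exact: measurable_funTS.
  - by apply: emeasurable_funD => //; apply: measurable_funTS; exact: measurable_powf.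
  - move=> x _; have := f0 x; case: (f x) => [v| |]// v0; last first.
      by rewrite poweRyr ?addey// gt_eqF// (lt_trans _ p1).
    rewrite poweR_EFin -EFinD lee_fin; rewrite lee_fin in v0.
    have [v1|v1] := leP v 1%R.
      by rewrite (le_trans v1)// lerDl powR_ge0.
    by rewrite (le_trans (le1r_powR (ltW v1) (ltW p1)))// lerDr.
rewrite ge0_integralD//; last 2 first.
  by move=> x _; exact: poweR_ge0.
  by apply: measurable_funTS; exact: measurable_powf.
rewrite integral_cst// mul1e; apply: leeD2l.
apply: le_trans fp; apply: ge0_subset_integral => //.
- exact: measurable_powf.
- by move=> x _; exact: poweR_ge0.
Qed.

(** Weak-type bound for the maximal function: [2 ^ (i - 1) * sigma (Q j)] is at most the integral of
    the superlevel part over [Q j], and the sets of an antichain are disjoint. *)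
Lemma superlevel_antichain (I : finType) (le : rel I) (Q : I -> set T) (S : pred I) i :
  (forall j, measurable (Q j)) -> (forall j, sigma (Q j) < +oo) ->
  (forall j k, ~~ le j k -> ~~ le k j -> Q j `&` Q k = set0) ->
  (forall j, S j -> (pow2 i * fine (sigma (Q j)) <= fine (\int[sigma]_(x in Q j) f x))%R) ->
  antichain le S -> (\sum_(j | S j) fine (sigma (Q j)) <= superlevel_int i)%R.
Proof.
move=> mQ sQ disj Sf anti.
have h0 := @pow2_gt0 R (i - 1).
have sub j : S j -> ((pow2 (i - 1) * fine (sigma (Q j)))%:E <= \int[sigma]_(x in Q j) superlevel i x).
  move=> Sj.
  have fsQ : sigma (Q j) = (fine (sigma (Q j)))%:E by rewrite fineK// ge0_fin_numE.
  have E : \int[sigma]_(x in Q j) f x = (fine (\int[sigma]_(x in Q j) f x))%:E.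
    rewrite fineK// ge0_fin_numE ?integral_ge0//.
    by apply: (le_lt_trans (integral_le1D (mQ j))); rewrite lte_add_pinfty ?ltry.
  have H : \int[sigma]_(x in Q j) f x <=
      (pow2 (i - 1) * fine (sigma (Q j)))%:E + \int[sigma]_(x in Q j) superlevel i x.
    have -> : (pow2 (i - 1) * fine (sigma (Q j)))%:E = \int[sigma]_(x in Q j) (pow2 (i - 1))%:E.
      by rewrite integral_cst// EFinM -fsQ.
    rewrite -ge0_integralD//.
    - apply: ge0_le_integral => //.
      + exact: measurable_funTS.
      + by apply: emeasurable_funD => //; apply: measurable_funTS; exact: measurable_superlevel.
      + move=> x _; rewrite /superlevel; case: ifPn => [_|]; last by rewrite -leNgt adde0.
        by rewrite leeDr// lee_fin ltW.
    - by move=> x _; rewrite lee_fin ltW.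
    - by move=> x _; exact: superlevel_ge0.
    - by apply: measurable_funTS; exact: measurable_superlevel.
  rewrite -(leeD2lE (x := (pow2 (i - 1) * fine (sigma (Q j)))%:E))//.
  apply: le_trans H; rewrite E -EFinD lee_fin; apply: le_trans (Sf _ Sj).
  have := @pow2S R (i - 1); rewrite subrK => ->.
  by rewrite -mulrDl -mulr2n -[in leRHS]mulr_natl ?mulr1 mulr_natl.
rewrite -lee_fin superlevel_intE -sumEFin.
have -> : \sum_(j | S j) (fine (sigma (Q j)))%:E =
   ((pow2 (i - 1))^-1)%:E * \sum_(j | S j) (pow2 (i - 1) * fine (sigma (Q j)))%:E.
  rewrite !sumEFin -EFinM mulr_sumr; congr EFin; apply: eq_bigr => j _.
  by rewrite mulrA mulVf ?mul1r// gt_eqF.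
apply: lee_wpmul2l; first by rewrite lee_fin invr_ge0 ltW.
apply: (@le_trans _ _ (\sum_(j | S j) \int[sigma]_(x in Q j) superlevel i x)).
  by apply: lee_sum => j /sub.
rewrite -big_filter -ge0_integral_bigsetU//.
- apply: ge0_subset_integral => //.
  + exact: bigsetU_measurable.
  + exact: measurable_superlevel.
  + by move=> x _; exact: superlevel_ge0.
- by rewrite filter_uniq// /index_enum -enumT enum_uniq.
- move=> j k /=; rewrite !mem_filter => /andP[Sj _] /andP[Sk _] /set0P jk0.
  apply/eqP; apply: contraTT jk0 => jk; rewrite negbK; apply/eqP/disj; apply/negP => H.
    by move/eqP: jk; apply; exact: anti.
  by move/eqP: jk; apply; apply/esym; exact: anti.
- by apply: measurable_funTS; exact: measurable_superlevel.
- by move=> x _; exact: superlevel_ge0.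
Qed.

End superlevel.

Section cube_sum.
Context {d} {T : measurableType d} {R : realType}.
Variables (sigma omega : {measure set T -> \bar R}) (f g : T -> \bar R).
Variables (p p' q q' C0 M : R).
Hypotheses (mf : measurable_fun setT f) (f0 : forall x, 0 <= f x).
Hypotheses (mg : measurable_fun setT g) (g0 : forall x, 0 <= g x).
Hypotheses (p1 : (1 < p)%R) (p'1 : (1 < p')%R) (pp' : (p^-1 + p'^-1 = 1)%R).
Hypotheses (q1 : (1 < q)%R) (q'1 : (1 < q')%R) (qq' : (q^-1 + q'^-1 = 1)%R).
Hypotheses (pq : (p < q)%R) (M0 : (0 < M)%R) (C00 : (0 < C0)%R).
Hypotheses (Mp : (superlevel_cst p <= M)%R) (Mq : (superlevel_cst q' <= M)%R).
Hypotheses (fp : \int[sigma]_x (f x `^ p) <= 1) (gq : \int[omega]_x (g x `^ q') <= 1).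
Context {I : finType} {le : rel I} {gen : I -> nat}.
Variables (Q : I -> set T) (a : I -> R).
Hypothesis lam : laminar le gen.
Hypotheses (mQ : forall i, measurable (Q i))
  (leQ : forall i j, le i j -> Q i `<=` Q j)
  (disjQ : forall i j, ~~ le i j -> ~~ le j i -> Q i `&` Q j = set0).
Hypotheses (sQ0 : forall i, 0 < sigma (Q i)) (sQ : forall i, sigma (Q i) < +oo).
Hypotheses (wQ0 : forall i, 0 < omega (Q i)) (wQ : forall i, omega (Q i) < +oo).
Hypotheses (phi0 : forall i, 0 < \int[sigma]_(x in Q i) f x)
  (gam0 : forall i, 0 < \int[omega]_(x in Q i) g x).
Hypothesis a0 : forall i, (0 <= a i)%R.
Hypothesis aG : forall (S : pred I) i0, (forall i, S i -> le i0 i) ->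
  (\sum_(i | S i) a i <= C0 * a i0)%R.
Hypothesis aT : forall i0,
  (fine (sigma (Q i0)) `^ (q / p') *
    \sum_(i | le i0 i) a i `^ q * fine (omega (Q i)) <= M)%R.
Hypothesis aT' : forall i0,
  (fine (omega (Q i0)) `^ (p' / q) *
    \sum_(i | le i0 i) a i `^ p' * fine (sigma (Q i)) <= M)%R.

Lemma measure_laminar_weight (mu : {measure set T -> \bar R}) :
  (forall i, 0 < mu (Q i)) -> (forall i, mu (Q i) < +oo) ->
  laminar_weight le (fun i => fine (mu (Q i))).
Proof.
move=> mu0 muy; have fmu i : mu (Q i) \is a fin_num by rewrite ge0_fin_numE.
split=> [i|i j ij|i j k ik jk ij ji].
- by rewrite fine_gt0// mu0 muy.
- by rewrite fine_le//; apply: le_measure; rewrite ?inE//; exact: leQ.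
- rewrite -fineD// -lee_fin fineK ?fineK ?fin_numD ?fmu//.
  rewrite -measureU//; last exact: disjQ.
  apply: le_measure; rewrite ?inE//; first exact: measurableU.
  by rewrite subUset; split; exact: leQ.
Qed.

(** [superlevel_int] of [f] and of [g] serve as [Phi] and [Gam] in the abstract estimate. *)
Lemma cube_sum : (\sum_i a i *
   (fine (\int[sigma]_(x in Q i) f x) * fine (\int[omega]_(x in Q i) g x)) <=
   laminar_cst p p' q q' C0 M)%R.
Proof.
have ff i : \int[sigma]_(x in Q i) f x < +oo.
  by apply: (le_lt_trans (integral_le1D mf f0 p1 fp (mQ i))); rewrite lte_add_pinfty ?ltry.
have gf i : \int[omega]_(x in Q i) g x < +oo.
  by apply: (le_lt_trans (integral_le1D mg g0 q'1 gq (mQ i))); rewrite lte_add_pinfty ?ltry.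
apply: (@laminar_sum _ _ _ _ (fun i => fine (sigma (Q i))) (fun i => fine (omega (Q i)))
  _ _ _ (superlevel_int (sigma := sigma) f) (superlevel_int (sigma := omega) g)) => //.
- exact: lam.
- exact: (@measure_laminar_weight sigma).
- exact: (@measure_laminar_weight omega).
- by move=> i; rewrite fine_gt0// phi0 ff.
- by move=> i; rewrite fine_gt0// gam0 gf.
- move=> i j ij; apply: fine_le; rewrite ?ge0_fin_numE ?integral_ge0//.
  by apply: ge0_subset_integral => //; [exact: measurable_funTS|exact: leQ].
- move=> i j ij; apply: fine_le; rewrite ?ge0_fin_numE ?integral_ge0//.
  by apply: ge0_subset_integral => //; [exact: measurable_funTS|exact: leQ].
- by move=> i S Sf anti; apply: (superlevel_antichain mf f0 p1 fp mQ sQ disjQ Sf anti).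
- by move=> r ur; apply: le_trans Mp; exact: superlevel_int_sum.
- by move=> i S Sf anti; apply: (superlevel_antichain mg g0 q'1 gq mQ wQ disjQ Sf anti).
- by move=> r ur; apply: le_trans Mq; exact: superlevel_int_sum.
- exact: aG.
Qed.

End cube_sum.

Section grid_bilinear.
Context {R : realType} {m : nat}.
Variables (th p p' q q' : R).
Hypothesis th0 : (0 < th)%R.
Hypotheses (p1 : (1 < p)%R) (p'1 : (1 < p')%R) (pp' : (p^-1 + p'^-1 = 1)%R).
Hypotheses (q1 : (1 < q)%R) (q'1 : (1 < q')%R) (qq' : (q^-1 + q'^-1 = 1)%R).
Hypotheses (pq : (p < q)%R).

(** A single [M] above the two maximal constants and the two testing constants. *)
Definition grid_bound : R := (superlevel_cst p + superlevel_cst q' +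
  testing_cst (m := m) th q + testing_cst (m := m) th p')%R.

Definition grid_cst : R := laminar_cst p p' q q' (geom_cst th) grid_bound.

Variables (sigma omega : {measure set (borel R m) -> \bar R}) (A : R).
Hypothesis A0 : (0 < A)%R.
Hypothesis HA : forall c l, (0 < l)%R -> (l `^ (- th))%:E *
     (\int[omega]_x (tail1 th c l x `^ q)%:E) `^ q^-1 *
     (\int[sigma]_x (tail1 th c l x `^ p')%:E) `^ p'^-1 <= A%:E.
Variables f g : borel R m -> \bar R.
Hypotheses (mf : measurable_fun setT f) (f0 : forall x, 0 <= f x).
Hypotheses (mg : measurable_fun setT g) (g0 : forall x, 0 <= g x).
Hypotheses (fp : \int[sigma]_x (f x `^ p) <= 1) (gq : \int[omega]_x (g x `^ q') <= 1).

Let superlevel_cst_gt0 (r : R) : (1 < r)%R -> (0 < superlevel_cst r)%R.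
Proof. by move=> r1; rewrite mulr_gt0 ?powR_gt0// geom_cst_gt0// subr_gt0. Qed.

Let testing_cst_gt0 (r : R) : (1 < r)%R -> (0 < testing_cst (m := m) th r)%R.
Proof.
move=> r1; rewrite mulr_gt0 ?powR_gt0 ?ltr_pwDl// geom_cst_gt0//.
by rewrite mulr_gt0// (lt_trans _ r1).
Qed.

(** Boxes where [f] or [g] has integral zero contribute nothing; on the others both measures are
    positive, and finite by the characteristic. Dividing the weights by [A] frees the testing
    constants from the measures, and [A] is restored at the end. *)
Lemma grid_bilinear t N :
  \sum_z (@box_weight R m th N z)%:E *
     (\int[sigma]_(u in @box R m t N z) f u * \int[omega]_(x in @box R m t N z) g x) <=
  (grid_cst * A)%:E.
Proof.
pose good := [pred z : 'I_N.*2.+1 * {ffun 'I_m -> 'I_N.*2.+1} |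
  (0 < \int[sigma]_(u in @box R m t N z) f u) && (0 < \int[omega]_(x in @box R m t N z) g x)].
have null (mu : {measure set (borel R m) -> \bar R}) (h : borel R m -> \bar R) E :
    measurable_fun setT h -> (forall x, 0 <= h x) -> measurable E ->
    0 < \int[mu]_(x in E) h x -> 0 < mu E.
  move=> mh h0 mE; apply: contraTT; rewrite -!leNgt => E0.
  have muE : mu E = 0 by apply/eqP; rewrite eq_le E0 measure_ge0.
  rewrite (ge0_negligible_integral mE mE)//; last exact: measurable_funTS.
  by rewrite setDv integral_set0.
have good0 z : z \in good -> @box R m t N z !=set0.
  move=> /andP[Hz _]; apply/set0P/eqP => z0; move: Hz.
  by rewrite z0 integral_set0 ltxx.
have If (z : {z | z \in good}) : 0 < \int[sigma]_(u in @box R m t N (val z)) f u.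
  by have /andP[] := valP z.
have Ig (z : {z | z \in good}) : 0 < \int[omega]_(u in @box R m t N (val z)) g u.
  by have /andP[] := valP z.
have s0 (z : {z | z \in good}) : 0 < sigma (@box R m t N (val z)).
  by apply: (null sigma f) => //; exact: measurable_box.
have w0 (z : {z | z \in good}) : 0 < omega (@box R m t N (val z)).
  by apply: (null omega g) => //; exact: measurable_box.
have p0 : (0 < p)%R by exact: lt_trans p1.
have q0 : (0 < q)%R by exact: lt_trans q1.
have p'0 : (0 < p')%R by exact: lt_trans p'1.
have q'0 : (0 < q')%R by exact: lt_trans q'1.
have HA' c l : (0 < l)%R -> (l `^ (- th))%:E *
     (\int[sigma]_x (tail1 th c l x `^ p')%:E) `^ p'^-1 *
     (\int[omega]_x (tail1 th c l x `^ q)%:E) `^ q^-1 <= A%:E.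
  by move=> l0; rewrite muleAC; exact: HA.
have sy (z : {z | z \in good}) : sigma (@box R m t N (val z)) < +oo.
  by case: (box_measure_lty th0 good0 q0 p'0 HA s0 w0 z).
have wy (z : {z | z \in good}) : omega (@box R m t N (val z)) < +oo.
  by case: (box_measure_lty th0 good0 q0 p'0 HA s0 w0 z).
have fy (z : {z | z \in good}) : \int[sigma]_(x in @box R m t N (val z)) f x < +oo.
  apply: (le_lt_trans (integral_le1D mf f0 p1 fp (measurable_box t (val z)))).
  by rewrite lte_add_pinfty ?ltry.
have gy (z : {z | z \in good}) : \int[omega]_(x in @box R m t N (val z)) g x < +oo.
  apply: (le_lt_trans (integral_le1D mg g0 q'1 gq (measurable_box t (val z)))).
  by rewrite lte_add_pinfty ?ltry.
have B := (superlevel_cst_gt0 p1, superlevel_cst_gt0 q'1, testing_cst_gt0 q1, testing_cst_gt0 p'1).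
have [[[B1 B2] B3] B4] := B.
have M0 : (0 < grid_bound)%R by rewrite !addr_gt0.
have Mp : (superlevel_cst p <= grid_bound)%R by rewrite /grid_bound; lra.
have Mq : (superlevel_cst q' <= grid_bound)%R by rewrite /grid_bound; lra.
have := @cube_sum _ _ _ sigma omega f g p p' q q' (geom_cst th) grid_bound
  mf f0 mg g0 p1 p'1 pp' q1 q'1 qq' pq M0 (geom_cst_gt0 th0) Mp Mq fp gq _ _ _
  (fun z : {z | z \in good} => @box R m t N (val z)) (fun z => @box_weight R m th N (val z) / A)%R
  (box_laminar good0).
have H1 (z : {z | z \in good}) : measurable (@box R m t N (val z)) by exact: measurable_box.
have H2 (z z' : {z | z \in good}) : relpre val (@box_le R m t N) z z' ->
  @box R m t N (val z) `<=` @box R m t N (val z') by exact: box_le_sub.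
have H3 (z z' : {z | z \in good}) : ~~ relpre val (@box_le R m t N) z z' -> ~~ relpre val (@box_le R m t N) z' z ->
  @box R m t N (val z) `&` @box R m t N (val z') = set0 by exact: box_le_disjoint.
have H4 (z : {z | z \in good}) : (0 <= @box_weight R m th N (val z) / A)%R.
  by rewrite divr_ge0 ?powR_ge0// ltW.
move=> /(_ H1 H2 H3 s0 sy w0 wy If Ig H4) H.
have {}H : (\sum_(z : {z | z \in good}) (@box_weight R m th N (val z) / A) *
    (fine (\int[sigma]_(x in @box R m t N (val z)) f x) * fine (\int[omega]_(x in @box R m t N (val z)) g x)) <=
     grid_cst)%R.
  apply: H.
  - move=> S z0 Sz; rewrite -mulr_suml mulrA ler_pM2r ?invr_gt0//.
    exact: (box_weight_sum th0 good0).
  - move=> z; apply: (le_trans (box_tail_testing th0 good0 q0 p'0 A0 HA s0 w0 z)).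
    by rewrite /grid_bound; lra.
  - move=> z; apply: (le_trans (box_tail_testing th0 good0 p'0 q0 A0 HA' w0 s0 z)).
    by rewrite /grid_bound; lra.
rewrite (bigID (mem good))/= [X in _ + X]big1 ?adde0; last first.
  move=> z; rewrite !inE negb_and -!leNgt => /orP[] z0.
    have -> : \int[sigma]_(u in @box R m t N z) f u = 0.
      by apply/eqP; rewrite eq_le z0 integral_ge0.
    by rewrite mul0e mule0.
  have -> : \int[omega]_(u in @box R m t N z) g u = 0.
    by apply/eqP; rewrite eq_le z0 integral_ge0.
  by rewrite !mule0.
rewrite big_sub.
apply: (@le_trans _ _ ((\sum_(z : {z | z \in good}) (@box_weight R m th N (val z) / A) *
    (fine (\int[sigma]_(x in @box R m t N (val z)) f x) *
     fine (\int[omega]_(x in @box R m t N (val z)) g x))) * A)%:E); last first.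
  by rewrite lee_fin ler_pM2r.
rewrite mulr_suml -sumEFin; apply: lee_sum => z _.
have -> : \int[sigma]_(x in @box R m t N (val z)) f x =
    (fine (\int[sigma]_(x in @box R m t N (val z)) f x))%:E.
  by rewrite fineK// ge0_fin_numE// integral_ge0.
have -> : \int[omega]_(x in @box R m t N (val z)) g x =
    (fine (\int[omega]_(x in @box R m t N (val z)) g x))%:E.
  by rewrite fineK// ge0_fin_numE// integral_ge0.
rewrite -!EFinM lee_fin /= mulrAC divfK ?gt_eqF//.
Qed.

End grid_bilinear.

(** * From truncated grids to the full kernel *)

Section limn_einf_facts.
Context {R : realType}.
Implicit Types (u : (\bar R)^nat) (c : \bar R).

Lemma limn_einfE u : limn_einf u = ereal_sup (range (einfs u)).
Proof. by rewrite limn_einf_lim; apply/cvg_lim => //; exact: cvg_einfs_sup. Qed.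

Lemma le_limn_einf u c N0 : (forall N, (N0 <= N)%N -> c <= u N) -> c <= limn_einf u.
Proof.
move=> H; rewrite limn_einfE; apply: (@le_trans _ _ (einfs u N0)).
  by apply: le_ereal_inf_tmp => _ [N /= N0N <-]; exact: H.
by apply: ereal_sup_ubound; exists N0.
Qed.

Lemma limn_einf_le u c : (forall N, u N <= c) -> limn_einf u <= c.
Proof.
move=> H; rewrite limn_einfE; apply: ge_ereal_sup => _ [N _ <-].
by apply: le_trans (H N); apply: ereal_inf_lbound; exists N => /=.
Qed.

Lemma limn_einf_scale u (r : R) : (0 <= r)%R ->
  r%:E * limn_einf u <= limn_einf (fun N => r%:E * u N).
Proof.
move=> r0; rewrite !limn_einf_lim -limeMl//; last exact: is_cvg_einfs.
apply: lee_lim; [|exact: is_cvg_einfs|].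
  by apply: is_cvgeMl => //; exact: is_cvg_einfs.
apply: nearW => N; apply: le_ereal_inf_tmp => _ [k /= Nk <-].
by apply: lee_wpmul2l; rewrite ?lee_fin//; apply: ereal_inf_lbound; exists k.
Qed.

End limn_einf_facts.

Section kernel.
Context {R : realType} {m : nat}.
Variable th : R.
Hypothesis th0 : (0 < th)%R.

(* Truncation to finitely many cells; Fatou's lemma recovers the full sum. *)
Definition grid_kernel (N : nat) (x u : borel R m) : \bar R :=
  \sum_(t : {ffun 'I_m -> bool})
    \sum_z ((@box_weight R m th N z)%:E * (\1_(@box R m t N z) x)%:E) *
           (\1_(@box R m t N z) u)%:E.

Lemma grid_kernel_ge0 N x u : 0 <= grid_kernel N x u.
Proof.
apply: sume_ge0 => t _; apply: sume_ge0 => z _.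
by rewrite -!EFinM lee_fin !mulr_ge0// powR_ge0.
Qed.

Lemma box_exists N k (v : 'I_m -> int) : (`|k| <= N)%N -> (forall i, `|v i| <= N)%N ->
  exists z : 'I_N.*2.+1 * {ffun 'I_m -> 'I_N.*2.+1},
    box_level z = k /\ forall i, box_index z i = v i.
Proof.
move=> kN vN.
have H (j : int) : (`|j| <= N)%N -> exists a : 'I_N.*2.+1, ((a : nat)%:Z - N%:Z)%R = j.
  move=> jN; have a : (`|(j + N%:Z)%R| < N.*2.+1)%N by lia.
  by exists (Ordinal a) => /=; lia.
have [a aE] := H k kN.
pose b := [ffun i => projT1 (cid (H (v i) (vN i)))].
by exists (a, b); split => // i; rewrite /box_index /= ffunE; case: cid.
Qed.

(** The common cell belongs to the truncation once [N] exceeds its level and its indices in absolute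
    value. *)
Lemma grid_kernel_ge (t : {ffun 'I_m -> bool}) k (x u : borel R m) :
  (forall i, grid_index (t i) k ((x : 'rV[R]_m) ord0 i) =
             grid_index (t i) k ((u : 'rV[R]_m) ord0 i)) ->
  exists N0, forall N, (N0 <= N)%N -> (pow2 (- k) `^ th)%:E <= grid_kernel N x u.
Proof.
move=> xu; pose v i := grid_index (t i) k ((x : 'rV[R]_m) ord0 i).
exists (`|k| + \sum_i `|v i|)%N => N kN.
have [||z [zk zv]] := @box_exists N k v.
- by apply: leq_trans kN; rewrite leq_addr.
- move=> i; apply: leq_trans kN; apply: leq_trans (leq_addl _ _).
  by rewrite (bigD1 i)//= leq_addr.
have xz : @box R m t N z x by move=> i; rewrite zk zv.
have uz : @box R m t N z u by move=> i; rewrite zk zv -xu.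
rewrite /grid_kernel (bigD1 t)//=; apply: (@le_trans _ _ (_ + 0)); last first.
  apply: leeD; last first.
    apply: sume_ge0 => t' _; apply: sume_ge0 => z' _.
    by rewrite -!EFinM lee_fin !mulr_ge0// powR_ge0.
  exact: lexx.
rewrite adde0 (bigD1 z)//= !indicE !mem_set// !mule1 /box_weight zk leeDl//.
by apply: sume_ge0 => z' _; rewrite -!EFinM lee_fin !mulr_ge0// powR_ge0.
Qed.

(** The kernel is compared through real numbers [B] below it because it is infinite on the diagonal,
    where ever smaller cells make the grid sum exceed any [B]. *)
Lemma kernel_le_grid (x u : borel R m) (B : R) : B%:E <= enorm_npow (x - u : 'rV[R]_m)%R (- th)%R ->
  exists N0, forall N, (N0 <= N)%N -> B%:E <= (6 `^ th)%:E * grid_kernel N x u.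
Proof.
have c1 : (1 <= 6 `^ th :> R)%R.
  by rewrite -[X in (X <= _)%R](congr1 (fun f => f th) (@powR1 R)) le_powR_base ?(ltW th0)// ler1n.
rewrite /enorm_npow; case: ifPn => [/eqP xu _|xu].
  have {}xu : (x : 'rV[R]_m) = u by apply/eqP; rewrite -subr_eq0 xu.
  have [j jB] : exists j : nat, (B <= pow2 j%:Z `^ th)%R.
    pose b : R := (Num.max B 0)%R; have b0 : (0 <= b)%R by rewrite le_max lexx orbT.
    exists (Num.truncn (b `^ th^-1)).+1.
    apply: (@le_trans _ _ b); first by rewrite le_max lexx.
    have := powRrM b th^-1 th; rewrite mulVf ?gt_eqF// powRr1// => {1}->.
    apply: le_powR_base; rewrite ?powR_ge0 ?(ltW th0)//.
    set y := (b `^ th^-1)%R.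
    have y1 : (y <= (Num.truncn y).+1%:R)%R by apply/ltW/truncnS_gt.
    apply: (le_trans y1); rewrite /pow2 -pmulrn powR_mulrn//.
    by rewrite -natrX ler_nat ltnW// ltn_expl.
  have [|N0 HN0] := @grid_kernel_ge [ffun=> false] (- j%:Z) x u.
    by move=> i; rewrite xu.
  exists N0 => N /HN0; rewrite opprK => H.
  apply: (@le_trans _ _ (pow2 j%:Z `^ th)%:E); first by rewrite lee_fin.
  apply: (le_trans H); rewrite -[leLHS]mul1e; apply: lee_wpmul2r; rewrite ?lee_fin//.
  exact: grid_kernel_ge0.
have e0 : (0 < enorm (x - u : 'rV[R]_m)%R)%R by exact: enorm_gt0.
set e := enorm _ in e0 *; rewrite lee_fin => Be.
have e30 : (0 < 3 * e)%R by rewrite mulr_gt0.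
(* This level satisfies [3 * e < 2 ^ k <= 6 * e]: large enough for a common cell, small enough to
   lose only the factor [6 ^ th]. *)
pose k := (lg (3 * e) + 1)%R.
have k1 : (3 * e < pow2 k)%R by rewrite pow2S lt_pow2_lg.
have k2 : (pow2 k <= 6 * e)%R.
  rewrite pow2S; have := pow2_lg e30.
  have -> : (6 * e = 2 * (3 * e) :> R)%R by rewrite mulrA -natrM.
  by rewrite ler_pM2l.
have [t tP] := common_cell k1.
have [N0 HN0] := grid_kernel_ge tP.
exists N0 => N /HN0 H.
apply: le_trans (lee_wpmul2l _ H); last by rewrite lee_fin powR_ge0.
rewrite -EFinM lee_fin; apply: (le_trans Be).
rewrite -powRM// ?(ltW (pow2_gt0 _))//.
have -> : (e `^ (- th) = e^-1 `^ th)%R by rewrite -[e^-1%R]powR_inv1 ?(ltW e0)// -powRrM mulN1r.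
apply: le_powR_base; rewrite ?(ltW th0) ?invr_ge0 ?(ltW e0)//.
by rewrite pow2N ler_pdivlMr ?pow2_gt0// mulrC ler_pdivrMr.
Qed.

Lemma kernel_mul_le (x u : borel R m) (y : R) : (0 <= y)%R ->
  enorm_npow (x - u : 'rV[R]_m)%R (- th)%R * y%:E <=
  limn_einf (fun N => (6 `^ th)%:E * grid_kernel N x u * y%:E).
Proof.
rewrite le_eqVlt => /predU1P[<-|y0].
  rewrite mule0; apply: (@le_limn_einf _ _ _ 0%N) => N _.
  by rewrite mule0.
have HB (B : R) : B%:E <= enorm_npow (x - u : 'rV[R]_m)%R (- th)%R ->
    (B * y)%:E <= limn_einf (fun N => (6 `^ th)%:E * grid_kernel N x u * y%:E).
  move=> /kernel_le_grid[N0 H]; apply: (@le_limn_einf _ _ _ N0) => N /H {}H.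
  by rewrite EFinM; apply: lee_wpmul2r => //; rewrite lee_fin ltW.
have : 0 <= enorm_npow (x - u : 'rV[R]_m)%R (- th)%R.
  by rewrite /enorm_npow; case: ifPn => // _; rewrite lee_fin powR_ge0.
move: (enorm_npow _ _) HB => [k HB _|HB _|//].
  by rewrite -EFinM; exact: HB.
rewrite gt0_mulye ?lte_fin//.
set L := limn_einf _ in HB *; suff -> : L = +oo by [].
apply/eqyP => A A0; have := HB (A / y)%R (leey _).
by rewrite divfK ?gt_eqF.
Qed.

Lemma measurable_grid_kernel N x : measurable_fun setT (grid_kernel N x).
Proof.
apply: emeasurable_sum => t; apply: emeasurable_sum => z.
apply: measurable_funeM; apply/measurable_EFinP; apply: measurable_indic.
exact: measurable_box.
Qed.

End kernel.

(** The case distinction is moved from a vector to a real number, where its measurability is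
    immediate. *)
Lemma enorm_npowE (R : realType) (m : nat) (x : 'rV[R]_m) s :
  enorm_npow x s = if enorm x == 0%R then +oo else (enorm x `^ s)%:E.
Proof.
rewrite /enorm_npow; have [->|x0] := eqVneq x 0%R.
  suff -> : enorm (0 : 'rV[R]_m)%R = 0%R by rewrite eqxx.
  by rewrite /enorm big1 ?sqrtr0// => i _; rewrite mxE expr0n.
by rewrite gt_eqF// enorm_gt0.
Qed.

Lemma enorm_npow_ge0 (R : realType) (m : nat) (x : 'rV[R]_m) s : 0 <= enorm_npow x s.
Proof. by rewrite /enorm_npow; case: ifPn => // _; rewrite lee_fin powR_ge0. Qed.

Lemma measurable_enorm_npow (R : realType) (m : nat) d (T : measurableType d)
    (f g : T -> borel R m) s : measurable_fun setT f -> measurable_fun setT g ->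
  measurable_fun setT (fun x => enorm_npow (f x - g x : 'rV[R]_m)%R s).
Proof.
move=> mf mg; under eq_fun do rewrite enorm_npowE.
have me := measurable_enorm_sub mf mg.
apply: measurable_fun_ifT => //.
  apply: (measurable_fun_eqr me); exact: measurable_cst.
apply/measurable_EFinP.
by apply: (@measurableT_comp _ _ _ _ _ _ (fun x : R => x `^ s)%R).
Qed.

Lemma measurable_fun_limn_einf (R : realType) d (T : measurableType d)
    (f : (T -> \bar R)^nat) : (forall N, measurable_fun setT (f N)) ->
  measurable_fun setT (fun x => limn_einf (f ^~ x)).
Proof.
move=> mf; have -> : (fun x => limn_einf (f ^~ x)) =
    (fun x => - limn_esup ((fun N x => - f N x) ^~ x)).
  by apply/funext => x; rewrite -[LHS]oppeK -limn_esupN.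
apply: measurableT_comp => //; apply: measurable_fun_limn_esup => N.
exact: measurableT_comp.
Qed.

Section one_param.
Context {R : realType} {m : nat}.
Variables (th p p' q q' : R).
Hypothesis th0 : (0 < th)%R.
Hypotheses (p1 : (1 < p)%R) (p'1 : (1 < p')%R) (pp' : (p^-1 + p'^-1 = 1)%R).
Hypotheses (q1 : (1 < q)%R) (q'1 : (1 < q')%R) (qq' : (q^-1 + q'^-1 = 1)%R).
Hypotheses (pq : (p < q)%R).

(** [6 ^ th] comes from the comparison of kernels; each of the [2 ^ m] grids contributes one
    [grid_cst]. *)
Definition one_param_cst : R :=
  (6 `^ th * (#|{ffun 'I_m -> bool}|%:R * grid_cst (m := m) th p p' q q'))%R.

Variables (sigma : {sigma_finite_measure set (borel R m) -> \bar R})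
  (omega : {measure set (borel R m) -> \bar R}) (A : R).
Hypothesis A0 : (0 < A)%R.
Hypothesis HA : forall c l, (0 < l)%R -> (l `^ (- th))%:E *
     (\int[omega]_x (tail1 th c l x `^ q)%:E) `^ q^-1 *
     (\int[sigma]_x (tail1 th c l x `^ p')%:E) `^ p'^-1 <= A%:E.

Section real_valued.
Variables f g : borel R m -> R.
Hypotheses (mf : measurable_fun setT f) (f0 : forall x, (0 <= f x)%R).
Hypotheses (mg : measurable_fun setT g) (g0 : forall x, (0 <= g x)%R).
Hypotheses (fp : \int[sigma]_x ((f x)%:E `^ p) <= 1) (gq : \int[omega]_x ((g x)%:E `^ q') <= 1).

Let J N x : \bar R := (6 `^ th)%:E * \sum_(t : {ffun 'I_m -> bool})
    \sum_z ((@box_weight R m th N z)%:E * (\1_(@box R m t N z) x)%:E) *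
           \int[sigma]_(u in @box R m t N z) (f u)%:E.

Let int_grid_kernel N x :
  \int[sigma]_u ((6 `^ th)%:E * grid_kernel th N x u * (f u)%:E) = J N x.
Proof.
have mfE : measurable_fun setT (EFin \o f) by exact/measurable_EFinP.
have c0 : (0 <= 6 `^ th :> R)%R by rewrite powR_ge0.
under eq_integral do rewrite -muleA.
rewrite ge0_integralZl_EFin//; last 2 first.
  by move=> u _; rewrite mule_ge0 ?grid_kernel_ge0// lee_fin.
  by apply: emeasurable_funM => //; exact: measurable_grid_kernel.
congr (_ * _).
transitivity (\int[sigma]_u \sum_(t : {ffun 'I_m -> bool})
    \sum_z ((@box_weight R m th N z * \1_(@box R m t N z) x)%:E *
       ((\1_(@box R m t N z) u)%:E * (f u)%:E))).
  apply: eq_integral => u _; rewrite /grid_kernel ge0_sume_distrl; last first.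
    move=> t _; apply: sume_ge0 => z _.
    by rewrite -!EFinM lee_fin !mulr_ge0// powR_ge0.
  apply: eq_bigr => t _; rewrite ge0_sume_distrl; last first.
    by move=> z _; rewrite -!EFinM lee_fin !mulr_ge0// powR_ge0.
  by apply: eq_bigr => z _; rewrite EFinM !muleA.
have m1 t z : measurable_fun setT (fun u => (\1_(@box R m t N z) u)%:E * (f u)%:E).
  apply: emeasurable_funM => //; apply/measurable_EFinP/measurable_indic.
  exact: measurable_box.
have w0 t z : (0 <= @box_weight R m th N z * \1_(@box R m t N z) x)%R.
  by rewrite mulr_ge0// powR_ge0.
rewrite ge0_integral_sum//; last 2 first.
  by move=> t; apply: emeasurable_sum => z; exact: measurable_funeM.
  move=> t u _; apply: sume_ge0 => z _.
  by rewrite -!EFinM lee_fin !mulr_ge0// powR_ge0.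
apply: eq_bigr => t _; rewrite ge0_integral_sum//; last 2 first.
  by move=> z; exact: measurable_funeM.
  by move=> z u _; rewrite -!EFinM lee_fin !mulr_ge0// powR_ge0.
apply: eq_bigr => z _; rewrite ge0_integralZl_EFin//; last first.
  by move=> u _; rewrite -EFinM lee_fin mulr_ge0.
rewrite EFinM; congr (_ * _); rewrite [RHS]integral_mkcond.
apply: eq_integral => u _; rewrite patchE indicE.
by case: ifPn => _; rewrite ?mul1e ?mul0e.
Qed.

Let measurable_J N : measurable_fun setT (J N).
Proof.
apply: measurable_funeM; apply: emeasurable_sum => t; apply: emeasurable_sum => z.
apply: emeasurable_funM => //; apply: measurable_funeM.
by apply/measurable_EFinP/measurable_indic; exact: measurable_box.
Qed.

Let J_ge0 N x : 0 <= J N x.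
Proof.
rewrite mule_ge0 ?lee_fin ?powR_ge0//; apply: sume_ge0 => t _; apply: sume_ge0 => z _.
rewrite mule_ge0//; first by rewrite -EFinM lee_fin mulr_ge0// powR_ge0.
by apply: integral_ge0 => u _; rewrite lee_fin.
Qed.

Let int_J_le N : \int[omega]_x ((g x)%:E * J N x) <= (one_param_cst * A)%:E.
Proof.
have mfE : measurable_fun setT (EFin \o f) by exact/measurable_EFinP.
have mgE : measurable_fun setT (EFin \o g) by exact/measurable_EFinP.
have f0E x : 0 <= (EFin \o f) x by rewrite lee_fin.
have g0E x : 0 <= (EFin \o g) x by rewrite lee_fin.
have c0 : (0 <= 6 `^ th :> R)%R by rewrite powR_ge0.
pose F t z := \int[sigma]_(u in @box R m t N z) (f u)%:E.
have F0 t z : 0 <= F t z by apply: integral_ge0 => u _; rewrite lee_fin.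
pose h t z x := ((@box_weight R m th N z)%:E * F t z) * ((\1_(@box R m t N z) x)%:E * (g x)%:E).
have h0 t z x : 0 <= h t z x.
  by rewrite /h !mule_ge0// lee_fin// powR_ge0.
have mh0 t z : measurable_fun setT (fun x => (\1_(@box R m t N z) x)%:E * (g x)%:E).
  apply: emeasurable_funM => //; apply/measurable_EFinP/measurable_indic.
  exact: measurable_box.
have mh t z : measurable_fun setT (h t z) by exact: measurable_funeM.
have -> : \int[omega]_x ((g x)%:E * J N x) = (6 `^ th)%:E *
    \sum_(t : {ffun 'I_m -> bool}) \sum_z ((@box_weight R m th N z)%:E *
      (F t z * \int[omega]_(x in @box R m t N z) (g x)%:E)).
  transitivity (\int[omega]_x ((6 `^ th)%:E *
      \sum_(t : {ffun 'I_m -> bool}) \sum_z h t z x)).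
    apply: eq_integral => x _; rewrite /J muleCA; congr (_ * _).
    rewrite ge0_sume_distrr; last first.
      by move=> t _; apply: sume_ge0 => z _; rewrite !mule_ge0 ?F0// lee_fin// powR_ge0.
    apply: eq_bigr => t _; rewrite ge0_sume_distrr; last first.
      by move=> z _; rewrite !mule_ge0 ?F0// lee_fin// powR_ge0.
    by apply: eq_bigr => z _; rewrite -/(F t z) /h muleC -!muleA; congr (_ * _); rewrite muleCA.
  rewrite ge0_integralZl_EFin//; last 2 first.
    by move=> x _; apply: sume_ge0 => t _; apply: sume_ge0 => z _; exact: h0.
    by apply: emeasurable_sum => t; apply: emeasurable_sum => z; exact: mh.
  congr (_ * _); rewrite ge0_integral_sum//; last 2 first.
    by move=> t; apply: emeasurable_sum => z; exact: mh.
    by move=> t x _; apply: sume_ge0 => z _; exact: h0.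
  apply: eq_bigr => t _; rewrite ge0_integral_sum//.
  apply: eq_bigr => z _; rewrite ge0_integralZl//; last 2 first.
    by move=> x _; rewrite -EFinM lee_fin mulr_ge0.
    by rewrite mule_ge0 ?F0// lee_fin powR_ge0.
  rewrite -muleA; congr (_ * (_ * _)); rewrite [RHS]integral_mkcond.
  apply: eq_integral => x _; rewrite patchE indicE.
  by case: ifPn => _; rewrite ?mul1e ?mul0e.
apply: (@le_trans _ _ ((6 `^ th)%:E * \sum_(t : {ffun 'I_m -> bool})
    (grid_cst (m := m) th p p' q q' * A)%:E)).
  apply: lee_wpmul2l; rewrite ?lee_fin//; apply: lee_sum => t _.
  exact: (grid_bilinear th0 p1 p'1 pp' q1 q'1 qq' pq A0 HA mfE f0E mgE g0E fp gq).
rewrite sumEFin -EFinM sumr_const lee_fin /one_param_cst -!mulrA ler_wpM2l//.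
by rewrite -[leLHS]mulr_natl.
Qed.

(** Fatou's lemma is applied in [u], then in [x], with [g x] moved inside the lower limit in
    between; the bilinear bound is uniform in [N]. *)
Lemma one_param_real :
  \int[omega]_x ((g x)%:E *
    \int[sigma]_u (enorm_npow (x - u : 'rV[R]_m)%R (- th)%R * (f u)%:E)) <=
  (one_param_cst * A)%:E.
Proof.
pose K (x u : borel R m) := enorm_npow (x - u : 'rV[R]_m)%R (- th)%R.
have mK : measurable_fun setT (fun w : borel R m * borel R m => K w.1 w.2 * (f w.2)%:E).
  apply: emeasurable_funM; first exact: measurable_enorm_npow.
  by apply/measurable_EFinP; exact: measurableT_comp.
have K0 (w : borel R m * borel R m) : 0 <= K w.1 w.2 * (f w.2)%:E.
  by rewrite mule_ge0 ?enorm_npow_ge0// lee_fin.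
have mKx x : measurable_fun setT (fun u => K x u * (f u)%:E).
  apply: emeasurable_funM; last exact/measurable_EFinP.
  by apply: measurable_enorm_npow => //; exact: measurable_cst.
have mFN x N : measurable_fun setT (fun u => (6 `^ th)%:E * grid_kernel th N x u * (f u)%:E).
  apply: emeasurable_funM; last exact/measurable_EFinP.
  by apply: measurable_funeM; exact: measurable_grid_kernel.
have FN0 x N u : 0 <= (6 `^ th)%:E * grid_kernel th N x u * (f u)%:E.
  by rewrite !mule_ge0 ?grid_kernel_ge0// lee_fin// powR_ge0.
have H1 x : \int[sigma]_u (K x u * (f u)%:E) <= limn_einf (J ^~ x).
  apply: (@le_trans _ _ (\int[sigma]_u limn_einf
      (fun N => (6 `^ th)%:E * grid_kernel th N x u * (f u)%:E))).
    apply: ge0_le_integral => //.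
    - by move=> u _; rewrite mule_ge0 ?enorm_npow_ge0// lee_fin.
    - exact: measurable_fun_limn_einf.
    - by move=> u _; exact: kernel_mul_le.
  apply: (le_trans (fatou _ _ _ _)) => //.
  by under eq_fun do rewrite int_grid_kernel.
apply: (@le_trans _ _ (\int[omega]_x limn_einf (fun N => (g x)%:E * J N x))).
  apply: ge0_le_integral => //.
  - move=> x _; rewrite mule_ge0 ?lee_fin//; apply: integral_ge0 => u _.
    by rewrite mule_ge0 ?enorm_npow_ge0// lee_fin.
  - apply: emeasurable_funM; first exact/measurable_EFinP.
    exact: (measurable_fun_fubini_tonelli_F _ mK K0).
  - apply: measurable_fun_limn_einf => N.
    by apply: emeasurable_funM; first exact/measurable_EFinP.
  - move=> x _; apply: le_trans (limn_einf_scale _ (g0 x)).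
    by apply: lee_wpmul2l; [rewrite lee_fin | exact: H1].
apply: (le_trans (fatou _ _ _ _)) => //.
- move=> N; apply: emeasurable_funM => //; exact/measurable_EFinP.
- by move=> N x _; rewrite mule_ge0 ?lee_fin.
by apply: limn_einf_le => N; exact: int_J_le.
Qed.

End real_valued.
End one_param.

(** * Duality and Minkowski's integral inequality *)

Section poweR_facts.
Context {R : realType}.
Implicit Types (x y : \bar R) (r : R).

Lemma le_poweR x y r : (0 <= r)%R -> 0 <= x -> x <= y -> x `^ r <= y `^ r.
Proof.
move=> r0 x0 xy; apply: gt0_ler_poweR => //; rewrite in_itv/= leey andbT//.
exact: le_trans xy.
Qed.

Lemma poweR_le_inv x y r : (0 < r)%R -> 0 <= x -> 0 <= y -> x <= y `^ r -> x `^ r^-1 <= y.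
Proof.
move=> r0 x0 y0 xy; have := le_poweR (ltW (_ : 0 < r^-1)%R) x0 xy.
by rewrite invr_gt0 r0 -poweRrM divff ?gt_eqF// poweRe1//; exact.
Qed.

Lemma poweR_inv_le x y r : (0 < r)%R -> 0 <= x -> 0 <= y -> x `^ r^-1 <= y -> x <= y `^ r.
Proof.
move=> r0 x0 y0 xy; have := le_poweR (ltW r0) (poweR_ge0 _ _) xy.
by rewrite -poweRrM mulVf ?gt_eqF// poweRe1.
Qed.

(* Reduces an estimate by a power of an integral to the case of a positive finite bound. *)
Lemma le_poweR_real x y r (C : R) : (0 < r)%R -> (0 < C)%R -> 0 <= x -> 0 <= y ->
  (forall Y : R, (0 < Y)%R -> y < Y%:E -> x <= (C * Y `^ r)%:E) ->
  x <= C%:E * y `^ r.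
Proof.
move=> r0 C0 x0 y0 H; case: y y0 H => [y|_ _|//]; last first.
  by rewrite poweRyr ?gt_eqF// gt0_muley ?leey// lte_fin.
rewrite lee_fin => y0 H; rewrite poweR_EFin -EFinM.
apply/lee_addgt0Pr => e e0; rewrite -EFinD.
set b := (C * y `^ r + e)%R.
have b0 : (0 < b)%R by rewrite ltr_wpDl// mulr_ge0 ?powR_ge0// ltW.
have Cb0 : (0 < b / C)%R by rewrite divr_gt0.
have := H ((b / C) `^ r^-1)%R (powR_gt0 _ Cb0).
rewrite -powRrM mulVf ?gt_eqF// powRr1 ?(ltW Cb0)// mulrCA divff ?gt_eqF// mulr1; apply.
rewrite lte_fin -[X in (X < _)%R](_ : (y `^ r) `^ r^-1 = y)%R; last first.
  by rewrite -powRrM divff ?gt_eqF// powRr1.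
apply: gt0_ltr_powR; rewrite ?invr_gt0// ?nnegrE ?powR_ge0 ?(ltW Cb0)//.
by rewrite ltr_pdivlMr// mulrC ltrDl.
Qed.

End poweR_facts.

Section hoelder_dual.
Context {d} {T : measurableType d} {R : realType}.
Variables (r r' : R).
Hypotheses (r1 : (1 < r)%R) (r'1 : (1 < r')%R) (rr' : (r^-1 + r'^-1 = 1)%R).

Lemma hoelder_le (mu : {measure set T -> \bar R}) (h : T -> \bar R) (g : T -> R) :
  measurable_fun setT h -> (forall x, 0 <= h x) ->
  measurable_fun setT g -> (forall x, (0 <= g x)%R) ->
  \int[mu]_x ((g x)%:E `^ r') <= 1 ->
  \int[mu]_x (h x * (g x)%:E) <= (\int[mu]_x (h x `^ r)) `^ r^-1.
Proof.
move=> mh h0 mg g0 g1.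
have r0 : (0 < r)%R by exact: lt_trans r1.
have r'0 : (0 < r')%R by exact: lt_trans r'1.
have mhr : measurable_fun setT (fun x => h x `^ r).
  exact: measurableT_comp (measurable_poweR _) mh.
have mgr : measurable_fun setT (fun x => (g x)%:E `^ r').
  by apply: measurableT_comp (measurable_poweR _) _; exact/measurable_EFinP.
rewrite -[leRHS]mul1e; apply: le_poweR_real; rewrite ?invr_gt0//.
- by apply: integral_ge0 => x _; rewrite mule_ge0 ?lee_fin.
- by apply: integral_ge0 => x _; exact: poweR_ge0.
move=> Y Y0 hY; rewrite mul1r.
(* Young's inequality is applied to [l * h] and [g / l]. This [l] makes its two terms at most
   [Y ^ (1 / r)] times [1 / r] and [1 / r'], whose sum is 1. *)
pose l := (Y `^ (- (r * r')^-1))%R; have l0 : (0 < l)%R by rewrite powR_gt0.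
have lr : (l `^ r * Y = Y `^ r^-1)%R.
  rewrite -powRrM -[X in (_ * X)%R](powRr1 (ltW Y0)) -powRD; last by rewrite (gt_eqF Y0) implybT.
  congr (_ `^ _)%R; rewrite invfM mulNr mulrAC mulVf ?gt_eqF// mul1r.
  by rewrite -rr' addrC addrK.
have lr' : (l^-1 `^ r' = Y `^ r^-1)%R.
  rewrite -powR_inv1 ?(ltW l0)// -!powRrM; congr (_ `^ _)%R.
  by field; rewrite !gt_eqF.
apply: (@le_trans _ _ (\int[mu]_x ((l `^ r / r)%:E * (h x `^ r) +
   (l^-1 `^ r' / r')%:E * ((g x)%:E `^ r')))).
  apply: ge0_le_integral => //.
  - by move=> x _; rewrite mule_ge0 ?lee_fin.
  - by apply: emeasurable_funM => //; exact/measurable_EFinP.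
  - by apply: emeasurable_funD; exact: measurable_funeM.
  - move=> x _; have := h0 x; case: (h x) => [v| |]//; last first.
      move=> _; rewrite poweRyr ?gt_eqF// gt0_muley; last by rewrite lte_fin divr_gt0 ?powR_gt0.
      by rewrite addye ?leey// -ltNye (lt_le_trans _ (mule_ge0 _ (poweR_ge0 _ _)))// lee_fin divr_ge0 ?powR_ge0 ?ltW.
    rewrite lee_fin => v0; rewrite !poweR_EFin -!EFinM -EFinD lee_fin.
    have := @conjugate_powR _ (l * v)%R (l^-1 * g x)%R r r'.
    rewrite !mulr_ge0 ?(ltW l0) ?invr_ge0 ?(ltW l0)// => /(_ isT isT r0 r'0 rr').
    rewrite mulrACA divff ?gt_eqF// mul1r !powRM ?invr_ge0 ?(ltW l0)//.
    by rewrite ![(_ `^ _ * _ / _)%R]mulrAC.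
rewrite ge0_integralD//; last 4 first.
- by move=> x _; rewrite mule_ge0 ?poweR_ge0// lee_fin divr_ge0 ?powR_ge0 ?ltW.
- exact: measurable_funeM.
- by move=> x _; rewrite mule_ge0 ?poweR_ge0// lee_fin divr_ge0 ?powR_ge0 ?ltW.
- exact: measurable_funeM.
rewrite !ge0_integralZl_EFin//; last 4 first.
- by move=> x _; exact: poweR_ge0.
- by rewrite divr_ge0 ?powR_ge0 ?ltW.
- by move=> x _; exact: poweR_ge0.
- by rewrite divr_ge0 ?powR_ge0 ?ltW.
apply: (@le_trans _ _ ((l `^ r / r)%:E * Y%:E + (l^-1 `^ r' / r')%:E * 1)).
  apply: leeD; apply: lee_wpmul2l => //; rewrite ?lee_fin ?divr_ge0 ?powR_ge0 ?(ltW r0) ?(ltW r'0)//.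
  exact: ltW.
rewrite mule1 -EFinM -EFinD lee_fin mulrAC lr lr' -mulrDr rr' mulr1.
exact: lexx.
Qed.

(** The extremal function is a normalised power [h ^ (r - 1)], which requires a finite norm. So [h]
    is cut off at height [n] and restricted to a set [F n] of finite measure; Fatou's lemma removes
    the cut-off. *)
Lemma dual_norm_le (mu : {sigma_finite_measure set T -> \bar R}) (h : T -> \bar R) (C : R) :
  measurable_fun setT h -> (forall x, 0 <= h x) -> (0 <= C)%R ->
  (forall g : T -> R, measurable_fun setT g -> (forall x, (0 <= g x)%R) ->
    \int[mu]_x ((g x)%:E `^ r') <= 1 -> \int[mu]_x (h x * (g x)%:E) <= C%:E) ->
  (\int[mu]_x (h x `^ r)) `^ r^-1 <= C%:E.
Proof.
move=> mh h0 C0 H.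
have r0 : (0 < r)%R by exact: lt_trans r1.
have r'0 : (0 < r')%R by exact: lt_trans r'1.
have [F [FT Fmono Ffin]] := (sigma_finiteP _ _).1 (sigma_finiteT mu).
have mF n : measurable (F n) by case: (Ffin n).
pose k (n : nat) x : R := (fine (mine (h x) n%:R%:E) * \1_(F n) x)%R.
have kE n x : (fine (mine (h x) n%:R%:E))%:E = mine (h x) n%:R%:E.
  rewrite fineK// ge0_fin_numE; first by rewrite gt_min ltry orbT.
  by rewrite le_min h0 lee_fin ler0n.
have mine0 n x : (0 <= fine (mine (h x) n%:R%:E))%R.
  by rewrite -lee_fin kE le_min h0 lee_fin ler0n.
have k0 n x : (0 <= k n x)%R by rewrite mulr_ge0.
have mk n : measurable_fun setT (k n).
  apply: measurable_funM; last exact: measurable_indic.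
  apply: measurableT_comp => //.
  by apply: measurable_mine => //; exact: measurable_cst.
have kh n x : (k n x)%:E <= h x.
  rewrite /k indicE; case: (_ \in _); rewrite ?mulr1 ?mulr0 ?h0// kE.
  by rewrite ge_min lexx.
have kn n x : (k n x <= n%:R * \1_(F n) x)%R.
  rewrite ler_wpM2r// -lee_fin kE.
  by rewrite ge_min lexx orbT.
have mkr n : measurable_fun setT (fun x => (k n x)%:E `^ r).
  by apply: measurableT_comp (measurable_poweR _) _; exact/measurable_EFinP.
have Ifin n : \int[mu]_x ((k n x)%:E `^ r) < +oo.
  apply: (@le_lt_trans _ _ (\int[mu]_x ((n%:R `^ r)%:E * (\1_(F n) x)%:E))).
    apply: ge0_le_integral => //.
    - by move=> x _; exact: poweR_ge0.
    - by apply: measurable_funeM; exact/measurable_EFinP/measurable_indic.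
    - move=> x _; rewrite poweR_EFin -EFinM lee_fin.
      apply: (le_trans (le_powR_base (ltW r0) (k0 n x) (kn n x))).
      rewrite powRM// indicE; case: (_ \in _) => /=; first by rewrite powR1.
      by rewrite powR0 ?gt_eqF.
  rewrite ge0_integralZl_EFin ?powR_ge0//; last exact/measurable_EFinP/measurable_indic.
  rewrite integral_indic// setIT; have [_ Fy] := Ffin n.
  by rewrite lte_mul_pinfty// lee_fin powR_ge0.
have Ile n : \int[mu]_x ((k n x)%:E `^ r) <= C%:E `^ r.
  have : 0 <= \int[mu]_x ((k n x)%:E `^ r).
    by apply: integral_ge0 => x _; exact: poweR_ge0.
  have := Ifin n; case E : (\int[mu]_x ((k n x)%:E `^ r)) => [v| |]// _.
  rewrite lee_fin le_eqVlt => /predU1P[<-|v0]; first exact: poweR_ge0.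
  apply: poweR_inv_le; rewrite ?lee_fin ?(ltW v0)//.
  (* Of unit norm in [L ^ r'], since [(r - 1) * r' = r] and [v] is the integral of [k n ^ r]. *)
  pose g x := (v `^ (- r'^-1) * (k n x) `^ (r - 1))%R.
  have g0 x : (0 <= g x)%R by rewrite mulr_ge0 ?powR_ge0.
  have mkr1 : measurable_fun setT (fun x => (k n x `^ (r - 1))%R).
    by apply: (@measurableT_comp _ _ _ _ _ _ (fun x : R => x `^ (r - 1))%R).
  have mg : measurable_fun setT g by exact: measurable_funM.
  have g1 : \int[mu]_x ((g x)%:E `^ r') <= 1.
    have -> : \int[mu]_x ((g x)%:E `^ r') = \int[mu]_x ((v^-1)%:E * ((k n x)%:E `^ r)).
      apply: eq_integral => x _; rewrite !poweR_EFin -EFinM; congr EFin.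
      rewrite powRM ?powR_ge0// -!powRrM mulNr mulVf ?gt_eqF// powR_inv1 ?(ltW v0)//.
      congr (_ * _ `^ _)%R; have rE : (r' + r = r * r')%R.
        by rewrite -[RHS]mul1r -rr'; field; rewrite !gt_eqF.
      by rewrite mulrBl mul1r -rE addrAC subrr add0r.
    rewrite ge0_integralZl_EFin ?invr_ge0 ?(ltW v0)//; last by move=> x _; exact: poweR_ge0.
    by rewrite E -EFinM mulVf ?gt_eqF.
  rewrite -lee_fin; apply: le_trans (H _ mg g0 g1).
  apply: (@le_trans _ _ (\int[mu]_x ((v `^ (- r'^-1))%:E * ((k n x)%:E `^ r)))).
    rewrite ge0_integralZl_EFin ?powR_ge0//; last by move=> x _; exact: poweR_ge0.
    rewrite E -EFinM lee_fin -[X in (_ <= _ * X)%R](powRr1 (ltW v0)).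
    rewrite -powRD; last by rewrite (gt_eqF v0) implybT.
    by rewrite addrC -rr' addrK.
  apply: ge0_le_integral => //.
  - by move=> x _; rewrite mule_ge0 ?lee_fin ?powR_ge0 ?poweR_ge0.
  - exact: measurable_funeM.
  - by apply: emeasurable_funM => //; exact/measurable_EFinP.
  - move=> x _; rewrite /g [X in _ <= _ * X]EFinM muleCA; apply: lee_wpmul2l.
      by rewrite lee_fin powR_ge0.
    apply: le_trans (lee_wpmul2r _ (kh n x)); last by rewrite lee_fin powR_ge0.
    by rewrite poweR_EFin -EFinM lee_fin mulr_powRB1.
apply: poweR_le_inv; rewrite ?lee_fin//.
  by apply: integral_ge0 => x _; exact: poweR_ge0.
apply: (@le_trans _ _ (\int[mu]_x limn_einf (fun n => (k n x)%:E `^ r))).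
  apply: ge0_le_integral => //.
  - by move=> x _; exact: poweR_ge0.
  - exact: measurableT_comp (measurable_poweR _) mh.
  - exact: measurable_fun_limn_einf.
  move=> x _.
  have [n0 Fn0] : exists n0, F n0 x.
    by have : [set: T] x by []; rewrite FT => -[n _ Fnx]; exists n.
  have Fx n : (n0 <= n)%N -> \1_(F n) x = 1%R :> R.
    by move=> n0n; rewrite indicE mem_set//; have /subsetPset := Fmono _ _ n0n; exact.
  have := h0 x; case E : (h x) => [v| |]// v0.
    apply: (@le_limn_einf _ _ _ (maxn n0 (Num.truncn v).+1)) => n.
    rewrite geq_max => /andP[n0n vn].
    rewrite /k Fx// mulr1 kE E min_l// lee_fin.
    by apply: (le_trans (ltW (truncnS_gt v))); rewrite ler_nat.
  set L := limn_einf _; suff -> : L = +oo by exact: leey.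
  apply/eqyP => A A0.
  apply: (@le_limn_einf _ _ _ (maxn n0 (Num.truncn A).+1)) => n.
  rewrite geq_max => /andP[n0n An].
  rewrite /k Fx// mulr1 E min_r ?leey//= lee_fin.
  have An' : (A <= n%:R)%R by apply: (le_trans (ltW (truncnS_gt A))); rewrite ler_nat.
  have n1 : (1 <= n%:R :> R)%R by rewrite ler1n (leq_trans _ An).
  by rewrite (le_trans An')// le1r_powR ?(ltW r1).
apply: (le_trans (fatou _ _ _ _)) => //.
  by move=> n x _; exact: poweR_ge0.
exact: limn_einf_le.
Qed.

End hoelder_dual.

Section minkowski_integral.
Context {d1 d2} {T1 : measurableType d1} {T2 : measurableType d2} {R : realType}.
Variables (m1 : {sigma_finite_measure set T1 -> \bar R})
  (m2 : {sigma_finite_measure set T2 -> \bar R}).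

(** The norm on the left is tested against [g]; Tonelli's theorem exchanges the integrals, and
    Hoelder's inequality is used for each fixed [u]. *)
Lemma minkowski_integral (H : T1 * T2 -> \bar R) (r : R) : (1 < r)%R ->
  measurable_fun setT H -> (forall z, 0 <= H z) ->
  (\int[m2]_y ((\int[m1]_u H (u, y)) `^ r)) `^ r^-1 <=
  \int[m1]_u ((\int[m2]_y (H (u, y) `^ r)) `^ r^-1).
Proof.
move=> r1 mH H0.
have r0 : (0 < r)%R by exact: lt_trans r1.
have r10 : (0 < r - 1)%R by rewrite subr_gt0.
pose r' := (r / (r - 1))%R.
have r'1 : (1 < r')%R by rewrite ltr_pdivlMr// mul1r gtrBl.
have rr' : (r^-1 + r'^-1 = 1)%R.
  by rewrite /r' invfM invrK; field; rewrite gt_eqF.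
have : 0 <= \int[m1]_u ((\int[m2]_y (H (u, y) `^ r)) `^ r^-1).
  by apply: integral_ge0 => u _; exact: poweR_ge0.
case E : (\int[m1]_u ((\int[m2]_y (H (u, y) `^ r)) `^ r^-1)) => [C| |]// C0; last by rewrite leey.
have mHr : measurable_fun setT (fun z => H z `^ r) by exact: measurableT_comp (measurable_poweR _) mH.
apply: (dual_norm_le r1 r'1 rr') => //.
- exact: (measurable_fun_fubini_tonelli_G _ mH H0).
- by move=> y; exact: integral_ge0.
move=> g mg g0 g1.
have mHg : measurable_fun setT (fun z : T1 * T2 => H z * (g z.2)%:E).
  by apply: emeasurable_funM => //; apply/measurable_EFinP; exact: measurableT_comp.
have Hg0 (z : T1 * T2) : 0 <= H z * (g z.2)%:E by rewrite mule_ge0 ?lee_fin.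
have -> : \int[m2]_y ((\int[m1]_u H (u, y)) * (g y)%:E) =
    \int[m2]_y \int[m1]_u (H (u, y) * (g y)%:E).
  apply: eq_integral => y _; rewrite ge0_integralZr ?lee_fin//.
  exact: measurableT_comp mH (measurable_pair2 _).
rewrite -(fubini_tonelli (m1 := m1) (m2 := m2) _ mHg Hg0) -E.
apply: ge0_le_integral => //.
- by move=> u _; apply: integral_ge0 => y _; exact: (Hg0 (u, y)).
- exact: (measurable_fun_fubini_tonelli_F _ mHg Hg0).
- apply: measurableT_comp (measurable_poweR _) _.
  by apply: (measurable_fun_fubini_tonelli_F _ mHr) => z; exact: poweR_ge0.
move=> u _; apply: (hoelder_le r1 r'1 rr') => //.
exact: measurableT_comp mH (measurable_pair1 _).
Qed.

End minkowski_integral.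

(** * Norm form of the one-parameter estimate *)

Section strong_one_param.
Context {R : realType} {m : nat}.
Variables (th p p' q q' : R).
Hypothesis th0 : (0 < th)%R.
Hypotheses (p1 : (1 < p)%R) (p'1 : (1 < p')%R) (pp' : (p^-1 + p'^-1 = 1)%R).
Hypotheses (q1 : (1 < q)%R) (q'1 : (1 < q')%R) (qq' : (q^-1 + q'^-1 = 1)%R).
Hypotheses (pq : (p < q)%R).

(** The maximum with 1 makes positivity evident. *)
Definition strong_cst : R := Num.max (one_param_cst (m := m) th p p' q q') 1%R.

Lemma strong_cst_gt0 : (0 < strong_cst)%R.
Proof. by rewrite lt_max ltr01 orbT. Qed.

Variables (sigma : {sigma_finite_measure set (borel R m) -> \bar R})
  (omega : {sigma_finite_measure set (borel R m) -> \bar R}) (A : R).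
Hypothesis A0 : (0 < A)%R.
Hypothesis HA : forall c l, (0 < l)%R -> (l `^ (- th))%:E *
     (\int[omega]_x (tail1 th c l x `^ q)%:E) `^ q^-1 *
     (\int[sigma]_x (tail1 th c l x `^ p')%:E) `^ p'^-1 <= A%:E.

Definition riesz (f : borel R m -> \bar R) (x : borel R m) : \bar R :=
  \int[sigma]_u (enorm_npow (x - u : 'rV[R]_m)%R (- th)%R * f u).

Lemma riesz_ge0 f x : (forall u, 0 <= f u) -> 0 <= riesz f x.
Proof. by move=> f0; apply: integral_ge0 => u _; rewrite mule_ge0// enorm_npow_ge0. Qed.

Lemma measurable_riesz_kernel x :
  measurable_fun setT (fun u : borel R m => enorm_npow (x - u : 'rV[R]_m)%R (- th)%R).
Proof. by apply: measurable_enorm_npow => //; exact: measurable_cst. Qed.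

Lemma measurable_riesz f : measurable_fun setT f -> (forall u, 0 <= f u) ->
  measurable_fun setT (riesz f).
Proof.
move=> mf f0.
apply: (measurable_fun_fubini_tonelli_F
  (fun w : borel R m * borel R m => enorm_npow (w.1 - w.2 : 'rV[R]_m)%R (- th)%R * f w.2)).
  by apply: emeasurable_funM; [exact: measurable_enorm_npow|exact: measurableT_comp].
by move=> w; rewrite mule_ge0// enorm_npow_ge0.
Qed.

Let riesz_norm_unit (f : borel R m -> R) : measurable_fun setT f ->
  (forall x, (0 <= f x)%R) -> \int[sigma]_x ((f x)%:E `^ p) <= 1 ->
  (\int[omega]_x (riesz (EFin \o f) x `^ q)) `^ q^-1 <= (strong_cst * A)%:E.
Proof.
move=> mf f0 f1.
have mfE : measurable_fun setT (EFin \o f) by exact/measurable_EFinP.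
apply: (dual_norm_le q1 q'1 qq').
- by apply: measurable_riesz => // u; rewrite lee_fin.
- by move=> x; apply: riesz_ge0 => u; rewrite lee_fin.
- by rewrite mulr_ge0 ?(ltW A0) ?(ltW strong_cst_gt0).
move=> g mg g0 g1; apply: le_trans (_ : (one_param_cst (m := m) th p p' q q' * A)%:E <= _).
  under eq_integral do rewrite muleC.
  exact: (one_param_real th0 p1 p'1 pp' q1 q'1 qq' pq A0 HA).
by rewrite lee_fin ler_pM2r// le_max lexx.
Qed.

(** The scaling [c = Y ^ (1 / p)] reduces to unit norm. As the integral of [f ^ p] is finite, [f]
    agrees almost everywhere with the real function [c * h] and has the same fractional integral. *)
Lemma riesz_norm (f : borel R m -> \bar R) : measurable_fun setT f ->
  (forall x, 0 <= f x) ->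
  (\int[omega]_x (riesz f x `^ q)) `^ q^-1 <=
  (strong_cst * A)%:E * (\int[sigma]_x (f x `^ p)) `^ p^-1.
Proof.
move=> mf f0.
have p0 : (0 < p)%R by exact: lt_trans p1.
have q0 : (0 < q)%R by exact: lt_trans q1.
have mfp : measurable_fun setT (fun x => f x `^ p) by exact: measurableT_comp (measurable_poweR _) mf.
apply: le_poweR_real; rewrite ?invr_gt0 ?mulr_gt0 ?strong_cst_gt0 ?poweR_ge0//.
  by apply: integral_ge0 => x _; exact: poweR_ge0.
move=> Y Y0 fY.
pose c : R := (Y `^ p^-1)%R; have c0 : (0 < c)%R by rewrite powR_gt0.
pose h x : R := (c^-1 * fine (f x))%R.
have h0 x : (0 <= h x)%R by rewrite mulr_ge0 ?fine_ge0 ?invr_ge0 ?(ltW c0).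
have mh : measurable_fun setT h by apply: measurable_funM => //; exact: measurableT_comp.
have fin_f : {ae sigma, forall x, [set: borel R m] x -> f x = (c * h x)%:E}.
  have : sigma.-integrable setT (fun x => f x `^ p).
    apply/integrableP; split => //.
    under eq_integral do rewrite gee0_abs ?poweR_ge0//.
    by apply: lt_trans fY _; rewrite ltry.
  move=> /(integrable_ae measurableT); apply: filterS => x /(_ I) fx _.
  have fxfin : f x \is a fin_num.
    rewrite ge0_fin_numE// ltey; apply/eqP => fxy; move: fx.
    by rewrite fxy poweRyr ?gt_eqF.
  by rewrite /h mulrA divff ?gt_eqF// mul1r fineK.
have mch : measurable_fun setT (fun x => (c * h x)%:E).
  by apply/measurable_EFinP; exact: measurable_funM.
have hp : \int[sigma]_x ((h x)%:E `^ p) <= 1.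
  apply: (@le_trans _ _ (\int[sigma]_x ((Y^-1)%:E * (f x `^ p)))); last first.
    rewrite ge0_integralZl_EFin ?invr_ge0 ?(ltW Y0)//; last by move=> x _; exact: poweR_ge0.
    apply: (@le_trans _ _ ((Y^-1)%:E * Y%:E)); last by rewrite -EFinM mulVf ?gt_eqF.
    by apply: lee_wpmul2l; rewrite ?lee_fin ?invr_ge0 ?(ltW Y0)//; exact: ltW.
  apply: ge0_le_integral => //.
  - by move=> x _; exact: poweR_ge0.
  - by apply: measurableT_comp (measurable_poweR _) _; exact/measurable_EFinP.
  - exact: measurable_funeM.
  move=> x _; have := f0 x; rewrite /h; case: (f x) => [v| |]// v0.
    rewrite [fine _]/= !poweR_EFin -EFinM lee_fin powRM ?invr_ge0 ?(ltW c0)//.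
    suff -> : (c^-1 `^ p = Y^-1)%R by [].
    rewrite -[(c^-1)%R]powR_inv1 ?(ltW c0)// -[RHS]powR_inv1 ?(ltW Y0)// /c -!powRrM.
    by congr (_ `^ _)%R; field; rewrite gt_eqF.
  (* At an infinite value of [f], [fine] returns 0. *)
  rewrite [fine _]/= mulr0 poweR0r ?gt_eqF// mule_ge0 ?poweR_ge0//.
  by rewrite lee_fin invr_ge0 ltW.
have E x : riesz f x = c%:E * riesz (EFin \o h) x.
  rewrite /riesz -ge0_integralZl_EFin ?(ltW c0)//; last 2 first.
    by move=> u _; rewrite mule_ge0 ?enorm_npow_ge0// lee_fin.
    by apply: emeasurable_funM; [exact: measurable_riesz_kernel|exact/measurable_EFinP].
  apply: ge0_ae_eq_integral => //.
  - by apply: emeasurable_funM => //; exact: measurable_riesz_kernel.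
  - apply: measurable_funeM; apply: emeasurable_funM; [exact: measurable_riesz_kernel|exact/measurable_EFinP].
  - by move=> u _; rewrite mule_ge0 ?enorm_npow_ge0.
  - by move=> u _; rewrite !mule_ge0 ?enorm_npow_ge0// lee_fin ?(ltW c0).
  apply: filterS fin_f => u fu _; rewrite fu// EFinM.
  by rewrite muleCA.
have r0 x : 0 <= riesz (EFin \o h) x by apply: riesz_ge0 => u; rewrite lee_fin.
have mr : measurable_fun setT (riesz (EFin \o h)).
  by apply: measurable_riesz => [|u]; [exact/measurable_EFinP|rewrite lee_fin].
under eq_integral do rewrite E poweRM ?lee_fin ?(ltW c0) ?r0//.
under eq_integral do rewrite poweR_EFin.
rewrite ge0_integralZl_EFin ?powR_ge0//; last 2 first.
  by move=> x _; exact: poweR_ge0.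
  exact: measurableT_comp (measurable_poweR _) mr.
rewrite poweRM ?lee_fin ?powR_ge0//; last by apply: integral_ge0 => x _; exact: poweR_ge0.
rewrite poweR_EFin -powRrM divff ?gt_eqF// powRr1 ?(ltW c0)//.
rewrite -/c mulrC EFinM; apply: lee_wpmul2l; first by rewrite lee_fin ltW.
exact: riesz_norm_unit.
Qed.

End strong_one_param.

(** * Product measures *)

Section product_norm.
Context {R : realType} {m n : nat}.
Variables (th1 th2 p p' q q' : R).
Hypotheses (th10 : (0 < th1)%R) (th20 : (0 < th2)%R).
Hypotheses (p1 : (1 < p)%R) (p'1 : (1 < p')%R) (pp' : (p^-1 + p'^-1 = 1)%R).
Hypotheses (q1 : (1 < q)%R) (q'1 : (1 < q')%R) (qq' : (q^-1 + q'^-1 = 1)%R).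
Hypotheses (pq : (p < q)%R).
Variables (sigma1 omega1 : {sigma_finite_measure set (borel R m) -> \bar R})
  (sigma2 omega2 : {sigma_finite_measure set (borel R n) -> \bar R}) (A1 A2 : R).
Hypotheses (A10 : (0 < A1)%R) (A20 : (0 < A2)%R).
Hypothesis HA1 : forall c l, (0 < l)%R -> (l `^ (- th1))%:E *
     (\int[omega1]_x (tail1 th1 c l x `^ q)%:E) `^ q^-1 *
     (\int[sigma1]_x (tail1 th1 c l x `^ p')%:E) `^ p'^-1 <= A1%:E.
Hypothesis HA2 : forall c l, (0 < l)%R -> (l `^ (- th2))%:E *
     (\int[omega2]_x (tail1 th2 c l x `^ q)%:E) `^ q^-1 *
     (\int[sigma2]_x (tail1 th2 c l x `^ p')%:E) `^ p'^-1 <= A2%:E.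

Definition product_kernel (z w : borel R m * borel R n) : \bar R :=
  enorm_npow (z.1 - w.1 : 'rV[R]_m)%R (- th1)%R * enorm_npow (z.2 - w.2 : 'rV[R]_n)%R (- th2)%R.

Lemma product_kernel_ge0 z w : 0 <= product_kernel z w.
Proof. by rewrite mule_ge0// enorm_npow_ge0. Qed.

Lemma measurable_product_kernel d (T : measurableType d)
    (f g : T -> borel R m * borel R n) :
  measurable_fun setT f -> measurable_fun setT g ->
  measurable_fun setT (fun t => product_kernel (f t) (g t)).
Proof.
move=> mf mg; apply: emeasurable_funM; apply: measurable_enorm_npow;
  by [apply: measurableT_comp measurable_fst _|apply: measurableT_comp measurable_snd _].
Qed.

Variable f : borel R m * borel R n -> \bar R.
Hypotheses (mf : measurable_fun setT f) (f0 : forall w, 0 <= f w).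

(** The intermediate function of the iteration: the kernel in the second variable has been applied,
    the one in the first variable not yet. *)
Let h (z : borel R m * borel R n) : \bar R :=
  riesz th2 sigma2 (fun t => f (z.1, t)) z.2.

Let mfu u : measurable_fun setT (fun t => f (u, t)).
Proof. exact: measurableT_comp mf (measurable_pair1 _). Qed.

Let h0 z : 0 <= h z.
Proof. by apply: riesz_ge0. Qed.

Let mh : measurable_fun setT h.
Proof.
apply: (measurable_fun_fubini_tonelli_F
  (fun w : (borel R m * borel R n) * borel R n =>
     enorm_npow (w.1.2 - w.2 : 'rV[R]_n)%R (- th2)%R * f (w.1.1, w.2))).
  apply: emeasurable_funM.
    apply: measurable_enorm_npow => //.
    exact: measurableT_comp measurable_snd measurable_fst.
  apply: measurableT_comp mf _; apply/measurable_fun_pair => //=.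
  exact: measurableT_comp measurable_fst measurable_fst.
by move=> w; rewrite mule_ge0// enorm_npow_ge0.
Qed.

Let mhy y : measurable_fun setT (fun u => h (u, y)).
Proof. exact: measurableT_comp mh (measurable_pair2 _). Qed.

Lemma product_rieszE z :
  \int[sigma1 \x sigma2]_w (product_kernel z w * f w) =
  riesz th1 sigma1 (fun u => h (u, z.2)) z.1.
Proof.
have mK : measurable_fun setT (fun w => product_kernel z w * f w).
  apply: emeasurable_funM => //.
  by apply: measurable_product_kernel => //; exact: measurable_cst.
rewrite fubini_tonelli1//; last by move=> w; rewrite mule_ge0// product_kernel_ge0.
apply: eq_integral => u _; rewrite /fubini_F /product_kernel/=.
under eq_integral do rewrite -muleA.
rewrite ge0_integralZl ?enorm_npow_ge0//.
  by apply: emeasurable_funM => //; exact: measurable_riesz_kernel.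
by move=> t _; rewrite mule_ge0// enorm_npow_ge0.
Qed.

Lemma measurable_product_riesz :
  measurable_fun setT (fun z => riesz th1 sigma1 (fun u => h (u, z.2)) z.1).
Proof.
apply: (measurable_fun_fubini_tonelli_F
  (fun w : (borel R m * borel R n) * borel R m =>
     enorm_npow (w.1.1 - w.2 : 'rV[R]_m)%R (- th1)%R * h (w.2, w.1.2))).
  apply: emeasurable_funM.
    apply: measurable_enorm_npow => //.
    exact: measurableT_comp measurable_fst measurable_fst.
  apply: measurableT_comp mh _; apply/measurable_fun_pair => //=.
  exact: measurableT_comp measurable_snd measurable_fst.
by move=> w; rewrite mule_ge0// enorm_npow_ge0.
Qed.

Let C1 : R := (strong_cst (m := m) th1 p p' q q' * A1)%R.
Let C2 : R := (strong_cst (m := n) th2 p p' q q' * A2)%R.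

(** For fixed [y], the first one-parameter bound leads to the [L ^ p] norm of [h] in [sigma1].
    Minkowski's inequality for [h ^ p] with exponent [r = q / p] then moves the integral over
    [omega2] inside that over [sigma1], where the second bound applies for fixed [u]. *)
Lemma product_norm :
  (\int[omega1 \x omega2]_z ((\int[sigma1 \x sigma2]_w (product_kernel z w * f w)) `^ q)) `^ q^-1 <=
  (C1 * C2)%:E * (\int[sigma1 \x sigma2]_w (f w `^ p)) `^ p^-1.
Proof.
have p0 : (0 < p)%R by exact: lt_trans p1.
have q0 : (0 < q)%R by exact: lt_trans q1.
have C10 : (0 < C1)%R by rewrite mulr_gt0 ?strong_cst_gt0.
have C20 : (0 < C2)%R by rewrite mulr_gt0 ?strong_cst_gt0.
pose r := (q / p)%R.
have r1 : (1 < r)%R by rewrite ltr_pdivlMr// mul1r.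
have r0 : (0 < r)%R by exact: lt_trans r1.
have mpow (g : borel R m * borel R n -> \bar R) (s : R) : measurable_fun setT g ->
    measurable_fun setT (fun z => g z `^ s).
  by move=> mg; exact: measurableT_comp (measurable_poweR _) mg.
have mfp := mpow _ p mf; have mhp := mpow _ p mh; have mhq := mpow _ q mh.
under eq_integral do rewrite product_rieszE.
rewrite fubini_tonelli2; [|exact: mpow measurable_product_riesz|by move=> z; exact: poweR_ge0].
have X0 : 0 <= \int[sigma1 \x sigma2]_w (f w `^ p).
  by apply: integral_ge0 => w _; exact: poweR_ge0.
set X := \int[sigma1 \x sigma2]_w (f w `^ p) in X0 *.
apply: poweR_le_inv => //.
- apply: integral_ge0 => y _; apply: integral_ge0 => x _; exact: poweR_ge0.
- by rewrite mule_ge0 ?poweR_ge0// lee_fin mulr_ge0 ?ltW.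
apply: (@le_trans _ _ (\int[omega2]_y ((C1 `^ q)%:E * ((\int[sigma1]_u (h (u, y) `^ p)) `^ r)))).
  apply: ge0_le_integral => //.
  - by move=> y _; apply: integral_ge0 => x _; exact: poweR_ge0.
  - apply: (measurable_fun_fubini_tonelli_G (fun z => riesz th1 sigma1 (fun u => h (u, z.2)) z.1 `^ q)).
      exact: mpow measurable_product_riesz.
    by move=> z; exact: poweR_ge0.
  - apply: measurable_funeM; apply: measurableT_comp (measurable_poweR _) _.
    by apply: (measurable_fun_fubini_tonelli_G _ mhp) => z; exact: poweR_ge0.
  move=> y _.
  have := riesz_norm th10 p1 p'1 pp' q1 q'1 qq' pq A10 HA1 (mhy y) (fun u => h0 (u, y)).
  move=> /(poweR_inv_le q0) H; apply: (le_trans (H _ _)).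
  - by apply: integral_ge0 => x _; exact: poweR_ge0.
  - by rewrite mule_ge0 ?poweR_ge0// lee_fin ltW.
  rewrite poweRM ?poweR_ge0 ?lee_fin ?(ltW C10)// poweR_EFin -poweRrM.
  by rewrite [(p^-1 * q)%R]mulrC.
rewrite ge0_integralZl_EFin ?powR_ge0//; last 2 first.
- by move=> y _; exact: poweR_ge0.
- apply: measurableT_comp (measurable_poweR _) _.
  by apply: (measurable_fun_fubini_tonelli_G _ mhp) => z; exact: poweR_ge0.
have -> : ((C1 * C2)%:E * X `^ p^-1) `^ q = (C1 `^ q)%:E * ((C2 `^ q)%:E * (X `^ p^-1) `^ q).
  rewrite poweRM ?poweR_ge0//; last by rewrite lee_fin mulr_ge0 ?(ltW C10) ?(ltW C20).
  by rewrite muleA -EFinM -powRM ?(ltW C10) ?(ltW C20).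
apply: lee_wpmul2l; first by rewrite lee_fin powR_ge0.
have := minkowski_integral sigma1 omega2 r1 mhp (fun z => poweR_ge0 _ _).
move=> /(poweR_inv_le r0) H; apply: (le_trans (H _ _)).
- by apply: integral_ge0 => y _; exact: poweR_ge0.
- by apply: integral_ge0 => y _; exact: poweR_ge0.
have -> : (C2 `^ q)%:E * (X `^ p^-1) `^ q = ((C2 `^ p)%:E * X) `^ r.
  rewrite poweRM ?lee_fin ?powR_ge0// poweR_EFin -powRrM -poweRrM [(p^-1 * q)%R]mulrC.
  by rewrite /r mulrCA divff ?mulr1// gt_eqF.
apply: le_poweR; first exact: ltW.
  by apply: integral_ge0 => u _; exact: poweR_ge0.
rewrite /X fubini_tonelli1//; last by move=> z; exact: poweR_ge0.
have mF : measurable_fun setT (fun u => \int[sigma2]_t (f (u, t) `^ p)).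
  by apply: (measurable_fun_fubini_tonelli_F _ mfp) => z; exact: poweR_ge0.
have F0 u : 0 <= \int[sigma2]_t (f (u, t) `^ p).
  by apply: integral_ge0 => t _; exact: poweR_ge0.
rewrite -ge0_integralZl_EFin ?powR_ge0 /fubini_F//.
apply: ge0_le_integral => //.
- by move=> u _; exact: poweR_ge0.
- apply: measurableT_comp (measurable_poweR _) _.
  apply: (measurable_fun_fubini_tonelli_F (fun z => (h z `^ p) `^ r)).
    exact: mpow.
  by move=> z; exact: poweR_ge0.
- exact: measurable_funeM.
move=> u _; have pr : (p * r = q)%R by rewrite /r mulrCA divff ?mulr1// gt_eqF.
have -> : \int[omega2]_y (h (u, y) `^ p) `^ r = \int[omega2]_y (h (u, y) `^ q).
  by apply: eq_integral => y _; rewrite -poweRrM pr.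
have := riesz_norm th20 p1 p'1 pp' q1 q'1 qq' pq A20 HA2 (mfu u) (fun t => f0 (u, t)).
have -> : (r^-1 = q^-1 * p)%R by rewrite /r invfM invrK.
rewrite poweRrM => Hu; apply: (le_trans (le_poweR (ltW p0) (poweR_ge0 _ _) Hu)).
rewrite poweRM ?poweR_ge0 ?lee_fin ?(ltW C20)// poweR_EFin -poweRrM mulVf ?gt_eqF// poweRe1//.
Qed.

End product_norm.

(** * Densities and sigma-finiteness *)

Section density.
Context {d} {T : measurableType d} {R : realType}.
Variables (f : T -> \bar R) (sigma : {measure set T -> \bar R}).
Hypotheses (mf : measurable_fun setT f) (f0 : forall x, 0 <= f x).

Let nu := density f sigma.

Let nu0 : nu set0 = 0.
Proof. exact: integral_set0. Qed.

Let nu_ge0 A : 0 <= nu A.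
Proof. exact: integral_ge0. Qed.

Let nu_sigma_additive : semi_sigma_additive nu.
Proof.
move=> F mF tF mUF; rewrite /nu /density ge0_integral_bigcup//; last exact: measurable_funTS.
by apply: is_cvg_ereal_nneg_natsum => n _; exact: nu_ge0.
Qed.

HB.instance Definition _ := isMeasure.Build d T R nu nu0 nu_ge0 nu_sigma_additive.

Import HBNNSimple.

Let integral_density_nnsfun (h : {nnsfun T >-> R}) :
  \int[nu]_x (h x)%:E = \int[sigma]_x ((h x)%:E * f x).
Proof.
have pos y x : (0 <= y)%R -> 0 <= (y * \1_(h @^-1` [set y]) x)%:E * f x.
  by move=> y0; rewrite mule_ge0// lee_fin mulr_ge0.
have neg (y : R) x : (y < 0)%R -> (y * \1_(h @^-1` [set y]) x)%:E * f x = 0.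
  by move=> y0; rewrite preimage_nnfun0// indic0 mulr0 mul0e.
rewrite integralT_nnsfun sintegralE.
transitivity (\int[sigma]_x \sum_(y \in range h) ((y * \1_(h @^-1` [set y]) x)%:E * f x)); last first.
  apply: eq_integral => x _; rewrite [in RHS](fimfunE h x) -fsumEFin//.
  rewrite ge0_mule_fsuml// => y; have [y0|y0] := leP 0%R y.
    by rewrite lee_fin mulr_ge0.
  by rewrite preimage_nnfun0// indic0 mulr0.
rewrite ge0_integral_fsum//; last 2 first.
- by move=> y; apply: emeasurable_funM => //; apply/measurable_EFinP; exact: measurable_funM.
- by move=> y x _; have [/pos//|/neg->] := leP 0%R y.
apply: eq_fsbigr => y _; have [y0|y0] := leP 0%R y; last first.
  by rewrite preimage_nnfun0// measure0 mule0 integral0_eq// => x _; rewrite indic0 mulr0 mul0e.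
under eq_integral do rewrite EFinM -muleA.
rewrite ge0_integralZl_EFin//; last 2 first.
- by move=> x _; rewrite mule_ge0.
- by apply: emeasurable_funM => //; exact/measurable_EFinP.
congr (_ * _); rewrite /nu /density [LHS]integral_mkcond; apply: eq_integral => x _.
by rewrite epatch_indic muleC.
Qed.

(** Both sides are limits along simple functions increasing to [g], for which the formula reduces to
    the definition of the density. *)
Lemma integral_density (g : T -> \bar R) : measurable_fun setT g -> (forall x, 0 <= g x) ->
  \int[density f sigma]_x g x = \int[sigma]_x (g x * f x).
Proof.
move=> mg g0; pose h := nnsfun_approx measurableT mg.
have hg x : (h n x)%:E @[n --> \oo] --> g x by exact: cvg_nnsfun_approx.
have hle x a b : (a <= b)%N -> (h a x <= h b x)%R by move=> ab; exact/lefP/nd_nnsfun_approx.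
have hg_le n x : (h n x)%:E <= g x.
  have <- : lim ((h n x)%:E @[n --> \oo]) = g x by exact/cvg_lim.
  apply: lime_ge; first by apply/cvg_ex; exists (g x).
  by near=> a; rewrite lee_fin hle//; near: a; exact: nbhs_infty_ge.
have -> : \int[density f sigma]_x g x = lim (\int[nu]_x (h n x)%:E @[n --> \oo]).
  rewrite -/nu -monotone_convergence//.
  - by apply: eq_integral => x _; apply/esym/cvg_lim.
  - by move=> n; exact/measurable_EFinP.
  - by move=> n x _; rewrite lee_fin.
  - by move=> x _ a b ab; rewrite lee_fin hle.
under eq_fun do rewrite integral_density_nnsfun.
rewrite -monotone_convergence//.
- apply: eq_integral => x _; apply/cvg_lim => //.
  (* The zero cases are removed first, because multiplication is not continuous at the forms 0 times
     infinity. *)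
  have [fx0|fx0] := eqVneq (f x) 0.
    by rewrite fx0 mule0; under eq_fun do rewrite mule0; exact: cvg_cst.
  have [gx0|gx0] := eqVneq (g x) 0.
    have hx0 n : (h n x)%:E = 0.
      apply/eqP; rewrite eq_le lee_fin; apply/andP; split; last by rewrite lee_fin.
      by rewrite -lee_fin -[leRHS]gx0 hg_le.
    by under eq_fun do rewrite hx0 mul0e; rewrite gx0 mul0e; exact: cvg_cst.
  apply: cvgeM; [|exact: hg|exact: cvg_cst].
  by apply: neq0_mule_def; rewrite mule_eq0 negb_or gx0.
- by move=> n; apply: emeasurable_funM => //; exact/measurable_EFinP.
- by move=> n x _; rewrite mule_ge0 ?lee_fin.
- by move=> x _ a b ab; apply: lee_wpmul2r => //; rewrite lee_fin hle.
Unshelve. all: by end_near. Qed.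

End density.

Section sigma_finite_pack.
Context d (T : measurableType d) (R : realType).
Variables (mu : {measure set T -> \bar R}) (sf : sigma_finite setT mu).

Let packed of sigma_finite setT mu : set T -> \bar R := mu.

HB.instance Definition _ := Measure.copy (packed sf) mu.
HB.instance Definition _ := Measure_isSigmaFinite.Build d T R (packed sf) sf.

(** Tonelli's theorem and duality take sigma-finiteness as a structure on the measure; this passes
    from the property to the structure without changing the set function. *)
Lemma sigma_finite_pack :
  exists nu : {sigma_finite_measure set T -> \bar R}, (nu : set T -> \bar R) = mu.
Proof. by exists (packed sf). Qed.

End sigma_finite_pack.

Section locally_finite.
Context {R : realType} {m : nat}.
Variable mu : {measure set (borel R m) -> \bar R}.
Hypothesis lf : locally_finite mu.

(** [A] is the union of a finite subcover by open sets of finite measure. *)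
Lemma compact_measure_lty (K : set 'rV[R]_m) : compact K ->
  exists2 A : set (borel R m), measurable A & K `<=` A /\ mu A < +oo.
Proof.
move=> cK.
have [U HU] := choice lf.
have := cK; rewrite compact_cover => /(_ _ setT U).
case=> [x _|x Kx|D _ KD]; first by case: (HU x).
  by exists x => //; case: (HU x).
exists (\big[setU/set0]_(x <- finmap.enum_fset D) U x).
  apply: bigsetU_measurable => x _; apply: sub_sigma_algebra; by case: (HU x).
split.
  by move=> x /KD[y yD Uyx]; rewrite -bigcup_seq; exists y.
elim: (finmap.enum_fset D) => [|x s IH]; first by rewrite big_nil measure0.
rewrite big_cons; apply: (@le_lt_trans _ _ (mu (U x) + mu (\big[setU/set0]_(y <- s) U y))).
  apply: measureU2.
    by apply: sub_sigma_algebra; case: (HU x).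
  by apply: bigsetU_measurable => y _; apply: sub_sigma_algebra; case: (HU y).
by rewrite lte_add_pinfty//; case: (HU x).
Qed.

(** The closed balls around 0 of integer radius are compact and exhaust the space. *)
Lemma locally_finite_sigma_finite : sigma_finite setT mu.
Proof.
pose K (N : nat) : set 'rV[R]_m := [set x | (`|x| <= N%:R)%R].
have cK N : compact (K N).
  apply: bounded_closed_compact.
    by exists N%:R; split; [exact: num_real | move=> M NM x Kx; exact: (le_trans Kx (ltW NM))].
  apply: (@closed_comp _ _ (fun x : 'rV[R]_m => `|x|%R) [set y | (y <= N%:R)%R]); last exact: closed_le.
  by move=> x _; exact: norm_continuous.
have H N : exists A : set (borel R m), [/\ measurable A, K N `<=` A & mu A < +oo].
  by have [A mA [KA Ay]] := compact_measure_lty (cK N); exists A.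
have [A HA] := choice H.
exists A; last by move=> N; case: (HA N).
apply/seteqP; split => // x _; exists (Num.truncn `|x|%R).+1 => //.
have [_ KA _] := HA (Num.truncn `|x|%R).+1; apply: KA.
exact/ltW/truncnS_gt.
Qed.

End locally_finite.

Section product_facts.
Context {d1 d2} {T1 : measurableType d1} {T2 : measurableType d2} {R : realType}.
Variables (m1 : {sigma_finite_measure set T1 -> \bar R})
  (m2 : {sigma_finite_measure set T2 -> \bar R}).

Lemma product_sigma_finite : sigma_finite setT (m1 \x m2).
Proof.
have [F1 [FT1 Fmono1 F1fin]] := (sigma_finiteP _ _).1 (sigma_finiteT m1).
have [F2 [FT2 Fmono2 F2fin]] := (sigma_finiteP _ _).1 (sigma_finiteT m2).
exists (fun i => F1 i `*` F2 i).
  apply/seteqP; split => // -[x y] _.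
  have [i _ xi] : (\bigcup_i F1 i) x by rewrite -FT1.
  have [j _ yj] : (\bigcup_i F2 i) y by rewrite -FT2.
  exists (maxn i j) => //; split => /=.
    by have /subsetPset := Fmono1 _ _ (leq_maxl i j); exact.
  by have /subsetPset := Fmono2 _ _ (leq_maxr i j); exact.
move=> i; have [mF1 F1y] := F1fin i; have [mF2 F2y] := F2fin i.
split; first exact: measurableX.
by rewrite product_measure1E// lte_mul_pinfty// ge0_fin_numE.
Qed.

Lemma product_integral (f : T1 -> R) (g : T2 -> R) :
  measurable_fun setT f -> (forall x, (0 <= f x)%R) ->
  measurable_fun setT g -> (forall x, (0 <= g x)%R) ->
  \int[m1 \x m2]_z (f z.1 * g z.2)%:E = (\int[m1]_x (f x)%:E) * (\int[m2]_y (g y)%:E).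
Proof.
move=> mf f0 mg g0.
rewrite fubini_tonelli1; last 2 first.
- apply/measurable_EFinP; apply: measurable_funM;
    by [exact: measurableT_comp mf measurable_fst|exact: measurableT_comp mg measurable_snd].
- by move=> z; rewrite lee_fin mulr_ge0.
rewrite -ge0_integralZr//; last 3 first.
- exact/measurable_EFinP.
- by move=> x _; rewrite lee_fin.
- by apply: integral_ge0 => y _; rewrite lee_fin.
apply: eq_integral => x _; rewrite /fubini_F/=.
under eq_integral do rewrite EFinM.
rewrite ge0_integralZl_EFin//; first by move=> y _; rewrite lee_fin.
exact/measurable_EFinP.
Qed.

End product_facts.

Lemma integral_zero_measure d (T : measurableType d) (R : realType)
    (mu : {measure set T -> \bar R}) (f : T -> \bar R) :
  mu setT = 0 -> measurable_fun setT f -> (forall x, 0 <= f x) -> \int[mu]_x f x = 0.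
Proof.
move=> mu0 mf f0.
by rewrite (ge0_negligible_integral measurableT measurableT)// setDv integral_set0.
Qed.

(** A vanishing integral would make [f] zero almost everywhere; as [f] is nowhere zero, the whole
    space would be null. *)
Lemma integral_pos_gt0 d (T : measurableType d) (R : realType)
    (mu : {measure set T -> \bar R}) (f : T -> R) :
  mu setT != 0 -> measurable_fun setT f -> (forall x, (0 < f x)%R) ->
  0 < \int[mu]_x (f x)%:E.
Proof.
move=> mu0 mf f0; rewrite lt_neqAle integral_ge0; last by move=> x _; rewrite lee_fin ltW.
rewrite andbT; apply: contra mu0 => /eqP/esym H.
have mfE : measurable_fun setT (EFin \o f) by exact/measurable_EFinP.
have : \int[mu]_x `|(EFin \o f) x| = 0.
  by rewrite -[RHS]H; apply: eq_integral => x _; rewrite gee0_abs// lee_fin ltW.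
move=> /(ae_eq_integral_abs mu measurableT mfE).1 [A [mA A0 subA]].
rewrite -A0; apply/eqP; congr (mu _); apply/esym/seteqP; split => // x _; apply: subA => /=.
by move=> /(_ I) [] /eqP; rewrite gt_eqF.
Qed.

Lemma volume_root (R : realType) (m : nat) (I : cube R m) : (0 < m)%N ->
  (volume I `^ m%:R^-1 = cube_side I)%R.
Proof.
move=> m0; have l0 := cube_side_gt0 I.
rewrite /volume -powR_mulrn ?(ltW l0)// -powRrM divff ?powRr1 ?(ltW l0)//.
by rewrite pnatr_eq0 -lt0n.
Qed.

Lemma volume_powR (R : realType) (m : nat) (I : cube R m) (a : R) : (0 < m)%N ->
  (volume I `^ (a / m%:R - 1) = cube_side I `^ (- (m%:R - a)))%R.
Proof.
move=> m0; have l0 := cube_side_gt0 I.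
rewrite /volume -powR_mulrn ?(ltW l0)// -powRrM; congr (_ `^ _)%R.
by field; rewrite pnatr_eq0 -lt0n.
Qed.

(** * The lower bound for the best constant *)

Section product_tails.
Context {R : realType} {m n : nat}.
Variables (alpha beta p q p' : R).
Hypotheses (hm : (0 < m)%N) (hn : (0 < n)%N).
Hypotheses (halpha : (0 < m%:R - alpha)%R) (hbeta : (0 < n%:R - beta)%R).
Hypotheses (p1 : (1 < p)%R) (p'1 : (1 < p')%R) (pp' : (p^-1 + p'^-1 = 1)%R).
Hypothesis q1 : (1 < q)%R.

Local Notation th1 := (m%:R - alpha)%R.
Local Notation th2 := (n%:R - beta)%R.

Lemma tailE (I : cube R m) (J : cube R n) z :
  tail alpha beta I J z = (tail1 th1 (cube_center I) (cube_side I) z.1 *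
    tail1 th2 (cube_center J) (cube_side J) z.2)%R.
Proof. by rewrite /tail /tail1 !volume_root// !opprB. Qed.

Lemma tail_gt0 (I : cube R m) (J : cube R n) z : (0 < tail alpha beta I J z)%R.
Proof. by rewrite tailE mulr_gt0// tail1_gt0// cube_side_gt0. Qed.

Lemma measurable_tail (I : cube R m) (J : cube R n) :
  measurable_fun setT (tail alpha beta I J).
Proof.
rewrite (_ : tail _ _ _ _ = fun z => tail1 th1 (cube_center I) (cube_side I) z.1 *
    tail1 th2 (cube_center J) (cube_side J) z.2)%R; last by apply/funext => z; rewrite tailE.
by apply: measurable_funM;
  [exact: measurableT_comp (measurable_tail1 _ _ _) measurable_fst|
   exact: measurableT_comp (measurable_tail1 _ _ _) measurable_snd].
Qed.

Lemma frac_integralE (sigma : {measure set (borel R m * borel R n) -> \bar R}) f z :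
  measurable_fun setT f -> (forall w, 0 <= f w) ->
  frac_integral alpha beta (density f sigma) z =
  \int[sigma]_w (product_kernel th1 th2 z w * f w).
Proof.
move=> mf f0; have -> : frac_integral alpha beta (density f sigma) z =
    \int[density f sigma]_w product_kernel th1 th2 z w.
  by rewrite /frac_integral /product_kernel !opprB.
apply: integral_density => //.
  by apply: measurable_product_kernel => //; exact: measurable_cst.
by move=> w; exact: product_kernel_ge0.
Qed.

(** With [a] and [b] the bases of the two tails, [|x - u| <= 2 * l * ((a - 1) + (b - 1))], and this
    sum is at most [a * b] because [(a - 1) * (b - 1)] is nonnegative. *)
Lemma kernel_ge_tail (k : nat) (th : R) (c : 'rV[R]_k) l (x u : borel R k) : (0 < th)%R -> (0 < l)%R ->
  ((2 `^ (- th) * l `^ (- th)) * (tail1 th c l x * tail1 th c l u))%:E <=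
  enorm_npow (x - u : 'rV[R]_k)%R (- th)%R.
Proof.
move=> th0 l0; rewrite /enorm_npow; case: ifPn => [_|xu]; first exact: leey.
have e0 : (0 < enorm (x - u : 'rV[R]_k)%R)%R by rewrite enorm_gt0.
rewrite lee_fin /tail1.
set a := (1 + _)%R; set b := (1 + enorm (u - c)%R / l)%R.
have a1 : (1 <= a)%R by rewrite lerDl divr_ge0 ?enorm_ge0// ltW.
have b1 : (1 <= b)%R by rewrite lerDl divr_ge0 ?enorm_ge0// ltW.
have a0 : (0 < a)%R by exact: lt_le_trans a1.
have b0 : (0 < b)%R by exact: lt_le_trans b1.
have H : (enorm (x - u : 'rV[R]_k)%R <= 2 * l * (a * b))%R.
  apply: (le_trans (enorm_subr_le _ _ c)); rewrite -mulrA ler_pM2l//.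
  have -> : (enorm (x - c : 'rV[R]_k)%R = l * (a - 1))%R.
    by rewrite /a addrAC subrr add0r mulrCA divff ?mulr1// gt_eqF.
  have -> : (enorm (u - c : 'rV[R]_k)%R = l * (b - 1))%R.
    by rewrite /b addrAC subrr add0r mulrCA divff ?mulr1// gt_eqF.
  rewrite -mulrDr ler_pM2l//.
  have : (0 <= (a - 1) * (b - 1))%R by rewrite mulr_ge0// subr_ge0.
  rewrite mulrBl !mulrBr; lra.
rewrite -!powRM ?mulr_ge0 ?(ltW a0) ?(ltW b0) ?(ltW l0)// !powRN lef_pV2 ?posrE ?powR_gt0 ?mulr_gt0//.
by apply: le_powR_base; rewrite ?(ltW th0) ?(ltW e0).
Qed.

Definition lower_cst : R := (2 `^ th1 * 2 `^ th2)%R.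

Lemma product_kernel_ge (I : cube R m) (J : cube R n) z w :
  (lower_cst^-1 * (cube_side I `^ (- th1) * cube_side J `^ (- th2)) *
    (tail alpha beta I J z * tail alpha beta I J w))%:E <= product_kernel th1 th2 z w.
Proof.
have HI := kernel_ge_tail (cube_center I) z.1 w.1 halpha (cube_side_gt0 I).
have HJ := kernel_ge_tail (cube_center J) z.2 w.2 hbeta (cube_side_gt0 J).
apply: le_trans (lee_pmul _ _ HI HJ); last 2 first.
- by rewrite lee_fin !mulr_ge0 ?powR_ge0.
- by rewrite lee_fin !mulr_ge0 ?powR_ge0.
rewrite -EFinM lee_fin !tailE /lower_cst invfM -!powRN.
rewrite le_eqVlt; apply/orP; left; apply/eqP; ring.
Qed.

Section lower.
Variables (sigma omega : {sigma_finite_measure set (borel R m * borel R n)%type -> \bar R}).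
Variable N : R.
Hypotheses (N0 : (0 <= N)%R) (HN : norm_inequality alpha beta p q sigma omega N).

Lemma lower_bound (I : cube R m) (J : cube R n) :
  (cube_side I `^ (- th1) * cube_side J `^ (- th2))%:E *
    (\int[omega]_z (tail alpha beta I J z `^ q)%:E) `^ q^-1 *
    (\int[sigma]_z (tail alpha beta I J z `^ p')%:E) `^ p'^-1 <= (lower_cst * N)%:E.
Proof.
have p0 : (0 < p)%R by exact: lt_trans p1.
have q0 : (0 < q)%R by exact: lt_trans q1.
have p'0 : (0 < p')%R by exact: lt_trans p'1.
have p'p : (p'^-1 + p^-1 = 1)%R by rewrite addrC.
have L0 : (0 < lower_cst)%R by rewrite mulr_gt0 ?powR_gt0.
set v := (_ * _)%R; have v0 : (0 < v)%R by rewrite mulr_gt0// powR_gt0// cube_side_gt0.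
pose t := tail alpha beta I J; have t0 z : (0 < t z)%R by exact: tail_gt0.
have mt : measurable_fun setT t by exact: measurable_tail.
have mtq (r : R) : measurable_fun setT (fun z => (t z `^ r)%:E).
  by apply/measurable_EFinP; apply: (@measurableT_comp _ _ _ _ _ _ (fun x : R => x `^ r)%R).
have W0 : 0 <= \int[omega]_z (t z `^ q)%:E by apply: integral_ge0 => z _; rewrite lee_fin powR_ge0.
have S0 : 0 <= \int[sigma]_z (t z `^ p')%:E by apply: integral_ge0 => z _; rewrite lee_fin powR_ge0.
rewrite -/t; set W := \int[omega]_z _ in W0 *.
(* The fractional integral of [g] is at least a multiple of the tail, the factor being the pairing
   of the tail with [g]; taking the [L ^ q] norm in [omega] produces [W ^ (1 / q)]. *)
have test (g : borel R m * borel R n -> R) : measurable_fun setT g -> (forall w, (0 <= g w)%R) ->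
    \int[sigma]_w ((g w)%:E `^ p) <= 1 ->
    (lower_cst^-1 * v)%:E * W `^ q^-1 * \int[sigma]_w ((t w)%:E * (g w)%:E) <= N%:E.
  move=> mg g0 g1.
  have mgE : measurable_fun setT (EFin \o g) by exact/measurable_EFinP.
  have g0E w : 0 <= (EFin \o g) w by rewrite lee_fin.
  have G0 : 0 <= \int[sigma]_w ((t w)%:E * (g w)%:E).
    by apply: integral_ge0 => w _; rewrite -EFinM lee_fin mulr_ge0// ltW.
  set G := \int[sigma]_w _ in G0 *.
  have := HN mgE g0E.
  have c0 : 0 <= (lower_cst^-1 * v)%:E by rewrite lee_fin mulr_ge0 ?invr_ge0 ?(ltW L0) ?(ltW v0).
  have fr z : ((lower_cst^-1 * v)%:E * G) * (t z)%:E <=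
      frac_integral alpha beta (density (EFin \o g) sigma) z.
    have mtg : measurable_fun setT (fun w => (t w)%:E * (g w)%:E).
      by apply: emeasurable_funM => //; exact/measurable_EFinP.
    have tg0 w : 0 <= (t w)%:E * (g w)%:E by rewrite -EFinM lee_fin mulr_ge0// ltW.
    have ct0 : 0 <= (lower_cst^-1 * v)%:E * (t z)%:E by rewrite mule_ge0// lee_fin ltW.
    rewrite frac_integralE// muleAC /G -(ge0_integralZl sigma measurableT mtg (fun w _ => tg0 w) ct0).
    apply: ge0_le_integral => //.
    - by move=> w _; rewrite mule_ge0.
    - exact: measurable_funeM.
    - by apply: emeasurable_funM => //; apply: measurable_product_kernel.
    - move=> w _; rewrite muleA; apply: lee_wpmul2r; first by rewrite lee_fin.
      by apply: le_trans (product_kernel_ge I J z w); rewrite -!EFinM lee_fin !mulrA.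
  move=> H; apply: le_trans (_ : N%:E * 1 <= _); last by rewrite mule1.
  apply: (@le_trans _ _ (N%:E * (\int[sigma]_z ((EFin \o g) z `^ p)) `^ p^-1)); last first.
    apply: lee_wpmul2l; rewrite ?lee_fin// -(poweR1r p^-1); apply: le_poweR => //.
      by rewrite invr_ge0 ltW.
    by apply: integral_ge0 => w _; exact: poweR_ge0.
  apply: le_trans H.
  have -> : (lower_cst^-1 * v)%:E * W `^ q^-1 * G =
      ((((lower_cst^-1 * v)%:E * G) `^ q) * W) `^ q^-1.
    rewrite poweRM ?poweR_ge0// -poweRrM divff ?gt_eqF// poweRe1 ?mule_ge0//.
    by rewrite muleAC.
  apply: le_poweR; first by rewrite invr_ge0 ltW.
    by rewrite mule_ge0 ?poweR_ge0.
  rewrite /W -ge0_integralZl ?poweR_ge0//; last by move=> z _; rewrite lee_fin powR_ge0.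
  have mfr : measurable_fun setT (fun z => frac_integral alpha beta (density (EFin \o g) sigma) z).
    have -> : (fun z => frac_integral alpha beta (density (EFin \o g) sigma) z) =
       (fun z => \int[sigma]_w (product_kernel th1 th2 z w * (EFin \o g) w)).
      by apply/funext => z; exact: frac_integralE.
    apply: (measurable_fun_fubini_tonelli_F (fun x : (borel R m * borel R n) * (borel R m * borel R n) =>
      product_kernel th1 th2 x.1 x.2 * (EFin \o g) x.2)).
      by apply: emeasurable_funM; [exact: measurable_product_kernel|exact: measurableT_comp].
    by move=> x; rewrite mule_ge0// product_kernel_ge0.
  apply: ge0_le_integral => //.
  - by move=> z _; rewrite mule_ge0 ?poweR_ge0// lee_fin powR_ge0.
  - exact: measurable_funeM.
  - exact: measurableT_comp (measurable_poweR _) mfr.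
  - move=> z _; rewrite -poweR_EFin -poweRM ?mule_ge0 ?lee_fin ?(ltW (t0 z))//.
    apply: le_poweR => //; first exact: ltW.
    by rewrite !mule_ge0// lee_fin ltW.
have key (C : R) : (0 <= C)%R ->
   (forall g : borel R m * borel R n -> R, measurable_fun setT g -> (forall w, (0 <= g w)%R) ->
    \int[sigma]_w ((g w)%:E `^ p) <= 1 -> \int[sigma]_w ((t w)%:E * (g w)%:E) <= C%:E) ->
   (\int[sigma]_z (t z `^ p')%:E) `^ p'^-1 <= C%:E.
  move=> C0 HC; have := @dual_norm_le _ _ _ p' p p'1 p1 p'p sigma (EFin \o t) C.
  apply => //; first exact/measurable_EFinP.
  by move=> z; rewrite lee_fin ltW.
(* Only a positive finite [W] can be divided out. If [W] is infinite, [test] forces the pairing of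
   the tail with every admissible [g] to vanish, so the [sigma] factor is 0. *)
have [WE|Wn0] := eqVneq W 0.
  by rewrite WE poweR0r ?invr_eq0 ?gt_eqF// mule0 mul0e lee_fin mulr_ge0 ?(ltW L0).
have {Wn0}W0' : 0 < W by rewrite lt_neqAle eq_sym Wn0.
have cp : 0 < (lower_cst^-1 * v)%:E by rewrite lte_fin mulr_gt0 ?invr_gt0.
case: W W0' W0 test => [w w0 _ test|_ _ test|//]; last first.
  have -> : (\int[sigma]_z (t z `^ p')%:E) `^ p'^-1 = 0.
    apply/eqP; rewrite eq_le poweR_ge0 andbT; apply: key => // g mg g0 g1.
    have := test g mg g0 g1; rewrite poweRyr ?invr_eq0 ?gt_eqF// gt0_muley//.
    rewrite leNgt => H; rewrite leNgt; apply: contra H => Gp.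
    by rewrite gt0_mulye// ltry.
  by rewrite mule0 lee_fin mulr_ge0 ?(ltW L0).
rewrite lte_fin in w0; rewrite poweR_EFin in test *.
set wq := (w `^ q^-1)%R in test *; have wq0 : (0 < wq)%R by rewrite powR_gt0.
have /key H : (0 <= lower_cst * N / (v * wq))%R.
  by apply: divr_ge0; apply: mulr_ge0 => //; exact: ltW.
apply: (@le_trans _ _ ((v * wq)%:E * (lower_cst * N / (v * wq))%:E)); last first.
  by rewrite -EFinM lee_fin mulrCA divff ?mulr1// gt_eqF// mulr_gt0.
rewrite -EFinM; apply: lee_wpmul2l; first by rewrite lee_fin mulr_ge0 ?(ltW v0) ?(ltW wq0).
apply: H => g mg g0 g1.
have := test g mg g0 g1; rewrite -EFinM => H.
rewrite -lee_pdivlMl in H; last by rewrite mulr_gt0// mulr_gt0// invr_gt0.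
apply: (le_trans H); rewrite -EFinM lee_fin le_eqVlt; apply/orP; left; apply/eqP.
by field; rewrite !gt_eqF.
Qed.

End lower.
End product_tails.

(** * The upper bound for the best constant *)

Section upper.
Context {R : realType} {m n : nat}.
Variables (alpha beta p q q' : R).
Hypotheses (hm : (0 < m)%N) (hn : (0 < n)%N).
Hypotheses (halpha : (0 < m%:R - alpha)%R) (hbeta : (0 < n%:R - beta)%R).
Local Notation p' := (p / (p - 1))%R.
Hypotheses (p1 : (1 < p)%R) (p'1 : (1 < p')%R) (pp' : (p^-1 + p'^-1 = 1)%R).
Hypotheses (q1 : (1 < q)%R) (q'1 : (1 < q')%R) (qq' : (q^-1 + q'^-1 = 1)%R).
Hypotheses (pq : (p < q)%R).
Local Notation th1 := (m%:R - alpha)%R.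
Local Notation th2 := (n%:R - beta)%R.

Definition char_term (k : nat) (th : R) (sigma omega : set (borel R k) -> \bar R)
    (c : 'rV[R]_k) (l : R) : \bar R :=
  (l `^ (- th))%:E * (\int[omega]_x (tail1 th c l x `^ q)%:E) `^ q^-1 *
     (\int[sigma]_x (tail1 th c l x `^ p')%:E) `^ p'^-1.

Lemma char_term_ge0 k th sigma omega (c : 'rV[R]_k) l : 0 <= char_term th sigma omega c l.
Proof. by rewrite /char_term !mule_ge0 ?poweR_ge0// lee_fin powR_ge0. Qed.

Lemma measurable_tail1_powR k th (c : 'rV[R]_k) l (r : R) :
  measurable_fun setT (fun x => tail1 th c l x `^ r)%R.
Proof.
by apply: (@measurableT_comp _ _ _ _ _ _ (fun x : R => x `^ r)%R) => //; exact: measurable_tail1.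
Qed.

Lemma char_term_gt0 k th (sigma omega : {measure set (borel R k) -> \bar R}) (c : 'rV[R]_k) l :
  (0 < l)%R -> sigma setT != 0 -> omega setT != 0 -> 0 < char_term th sigma omega c l.
Proof.
move=> l0 s0 o0; rewrite /char_term !mule_gt0 ?poweR_gt0//.
- by rewrite lte_fin powR_gt0.
- apply: integral_pos_gt0 => //; first exact: measurable_tail1_powR.
  by move=> x; rewrite powR_gt0// tail1_gt0.
- apply: integral_pos_gt0 => //; first exact: measurable_tail1_powR.
  by move=> x; rewrite powR_gt0// tail1_gt0.
Qed.

Variables (s1 w1 : {sigma_finite_measure set (borel R m) -> \bar R})
  (s2 w2 : {sigma_finite_measure set (borel R n) -> \bar R}).

Local Notation char := (two_tailed_char alpha beta p q (s1 \x s2) (w1 \x w2)).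

(** The tail is a product, so Tonelli's theorem factors its integrals against product measures. *)
Lemma char_termE (I : cube R m) (J : cube R n) :
  (volume I `^ (alpha / m%:R - 1) * volume J `^ (beta / n%:R - 1))%:E *
    (\int[w1 \x w2]_z (tail alpha beta I J z `^ q)%:E) `^ q^-1 *
    (\int[s1 \x s2]_z (tail alpha beta I J z `^ p')%:E) `^ p'^-1 =
  char_term th1 s1 w1 (cube_center I) (cube_side I) *
  char_term th2 s2 w2 (cube_center J) (cube_side J).
Proof.
have H (m1 : {sigma_finite_measure set (borel R m) -> \bar R})
    (m2 : {sigma_finite_measure set (borel R n) -> \bar R}) (r : R) :
    \int[m1 \x m2]_z (tail alpha beta I J z `^ r)%:E =
    (\int[m1]_x (tail1 th1 (cube_center I) (cube_side I) x `^ r)%:E) *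
    (\int[m2]_x (tail1 th2 (cube_center J) (cube_side J) x `^ r)%:E).
  rewrite -(product_integral m1 m2 (measurable_tail1_powR _ _ _ _) (fun x => powR_ge0 _ _)
    (measurable_tail1_powR _ _ _ _) (fun x => powR_ge0 _ _)).
  apply: eq_integral => z _; rewrite tailE//.
  by rewrite powRM ?(ltW (tail1_gt0 _ _ _ _)) ?cube_side_gt0.
have int0 k (mu : {measure set (borel R k) -> \bar R}) th c l (r : R) :
    0 <= \int[mu]_x (tail1 th c l x `^ r)%:E.
  by apply: integral_ge0 => x _; rewrite lee_fin powR_ge0.
rewrite !H !volume_powR// !poweRM ?int0// EFinM /char_term.
by rewrite [X in X * _ = _]muleACA [LHS]muleACA.
Qed.

Lemma char_ge (I : cube R m) (J : cube R n) :
  char_term th1 s1 w1 (cube_center I) (cube_side I) *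
  char_term th2 s2 w2 (cube_center J) (cube_side J) <= char.
Proof. by rewrite -char_termE; apply: ereal_sup_ubound; exists (I, J). Qed.

Lemma char_ge0 : 0 <= char.
Proof.
apply: le_trans (char_ge (Cube (0 : 'rV[R]_m)%R ltr01) (Cube (0 : 'rV[R]_n)%R ltr01)).
by rewrite mule_ge0// char_term_ge0.
Qed.

Definition upper_cst : R :=
  (strong_cst (m := m) th1 p p' q q' * strong_cst (m := n) th2 p p' q q')%R.

Lemma upper_cst_gt0 : (0 < upper_cst)%R.
Proof. by rewrite mulr_gt0// strong_cst_gt0. Qed.

Lemma best_constant_le N : (0 <= N)%R ->
  norm_inequality alpha beta p q (s1 \x s2) (w1 \x w2) N ->
  best_constant alpha beta p q (s1 \x s2) (w1 \x w2) <= N%:E.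
Proof. by move=> N0 HN; apply: ereal_inf_lbound; exists N. Qed.

Let p0 : (0 < p)%R. Proof. exact: lt_trans p1. Qed.
Let q0 : (0 < q)%R. Proof. exact: lt_trans q1. Qed.

Let measurable_frac f : measurable_fun setT f -> (forall w, 0 <= f w) ->
  measurable_fun setT (frac_integral alpha beta (density f (s1 \x s2))).
Proof.
move=> mf f0; have -> : frac_integral alpha beta (density f (s1 \x s2)) =
   (fun z => \int[s1 \x s2]_w (product_kernel th1 th2 z w * f w)).
  by apply/funext => z; exact: frac_integralE.
rewrite (_ : (fun z => _) = (fun z => riesz th1 s1 (fun u => riesz th2 s2 (fun t => f (u, t)) z.2) z.1)).
  exact: measurable_product_riesz.
by apply/funext => z; exact: product_rieszE.
Qed.

(** Treated apart because splitting the supremum needs positive one-parameter terms. If either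
    measure is zero, the left side of the norm inequality is 0, and so is the best constant. *)
Let trivial_upper : (s1 \x s2) setT = 0 \/ (w1 \x w2) setT = 0 ->
  best_constant alpha beta p q (s1 \x s2) (w1 \x w2) <= upper_cst%:E * char.
Proof.
move=> H; apply: (@le_trans _ _ 0%:E); last first.
  by rewrite mule_ge0 ?char_ge0// lee_fin ltW// upper_cst_gt0.
apply: best_constant_le => // f mf f0; rewrite mul0e.
have q_neq0 : q != 0%R by rewrite gt_eqF.
suff -> : \int[w1 \x w2]_z (frac_integral alpha beta (density f (s1 \x s2)) z `^ q) = 0.
  by rewrite poweR0r// invr_eq0.
case: H => [S0|W0].
  apply: integral0_eq => z _; rewrite frac_integralE//.
  rewrite (integral_zero_measure S0) ?poweR0r//.
    by apply: emeasurable_funM => //; exact: measurable_product_kernel.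
  by move=> w; rewrite mule_ge0// product_kernel_ge0.
apply: (integral_zero_measure W0).
  apply: measurableT_comp (measurable_poweR _) _; exact: measurable_frac.
by move=> z; exact: poweR_ge0.
Qed.

Lemma upper_bound : best_constant alpha beta p q (s1 \x s2) (w1 \x w2) <= upper_cst%:E * char.
Proof.
have prodT (m1 : {sigma_finite_measure set (borel R m) -> \bar R})
    (m2 : {sigma_finite_measure set (borel R n) -> \bar R}) :
    (m1 \x m2) setT = m1 setT * m2 setT.
  by rewrite -setXTT product_measure1E.
have [S0|] := eqVneq ((s1 \x s2) setT) 0; first by apply: trivial_upper; left.
have [W0|] := eqVneq ((w1 \x w2) setT) 0; first by move=> _; apply: trivial_upper; right.
rewrite !prodT !mule_eq0 !negb_or => /andP[w10 w20] /andP[s10 s20].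
have pos1 (I : cube R m) : 0 < char_term th1 s1 w1 (cube_center I) (cube_side I).
  by apply: char_term_gt0 => //; exact: cube_side_gt0.
have pos2 (J : cube R n) : 0 < char_term th2 s2 w2 (cube_center J) (cube_side J).
  by apply: char_term_gt0 => //; exact: cube_side_gt0.
have := char_ge0; case E : char => [A| |]// A0; last first.
  by rewrite gt0_muley ?leey// lte_fin upper_cst_gt0.
have fin (x y : \bar R) : 0 < x -> 0 < y -> x * y <= A%:E -> x \is a fin_num.
  move=> x0 y0 xy; rewrite ge0_fin_numE ?ltW// ltey; apply/eqP => xE; move: xy.
  by rewrite xE gt0_mulye// leye_eq.
pose I0 := Cube (0 : 'rV[R]_m)%R (@ltr01 R).
pose J0 := Cube (0 : 'rV[R]_n)%R (@ltr01 R).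
have HA I J : char_term th1 s1 w1 (cube_center I) (cube_side I) *
  char_term th2 s2 w2 (cube_center J) (cube_side J) <= A%:E by rewrite -E; exact: char_ge.
pose a1 I := fine (char_term th1 s1 w1 (cube_center I) (cube_side I)).
pose a2 J := fine (char_term th2 s2 w2 (cube_center J) (cube_side J)).
have a1E I : char_term th1 s1 w1 (cube_center I) (cube_side I) = (a1 I)%:E.
  by rewrite fineK// (fin _ _ (pos1 I) (pos2 J0)).
have a2E J : char_term th2 s2 w2 (cube_center J) (cube_side J) = (a2 J)%:E.
  by rewrite fineK// (fin _ _ (pos2 J) (pos1 I0))// muleC.
have a10 I : (0 < a1 I)%R by rewrite -lte_fin -a1E.
have a20 J : (0 < a2 J)%R by rewrite -lte_fin -a2E.
have {}HA I J : (a1 I * a2 J <= A)%R by rewrite -lee_fin EFinM -a1E -a2E.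
(* Finite because [a2 J0] is positive. Since [a1 I * a2 J <= A] for independent [I] and [J], taking
   the supremum over [I] gives [a2 J <= A / A1], so the two bounds multiply to exactly [A]. *)
pose A1 := sup (range a1).
have supA1 : has_sup (range a1).
  split; first by exists (a1 I0), I0.
  by exists (A / a2 J0)%R => _ [I _ <-]; rewrite ler_pdivlMr.
have A1ub I : (a1 I <= A1)%R by apply: sup_ubound; [exact: supA1.2|exists I].
have A10 : (0 < A1)%R by apply: lt_le_trans (A1ub I0).
have A2ub J : (a2 J <= A / A1)%R.
  rewrite ler_pdivlMr// mulrC -ler_pdivlMr//; apply: ge_sup; first exact: supA1.1.
  by move=> _ [I _ <-]; rewrite ler_pdivlMr.
have A20 : (0 < A / A1)%R by apply: lt_le_trans (A2ub J0).
have HA1 c l : (0 < l)%R -> char_term th1 s1 w1 c l <= A1%:E.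
  by move=> l0; have := A1ub (Cube c l0); rewrite -lee_fin -a1E.
have HA2 c l : (0 < l)%R -> char_term th2 s2 w2 c l <= (A / A1)%:E.
  by move=> l0; have := A2ub (Cube c l0); rewrite -lee_fin -a2E.
have A0' : (0 < A)%R by rewrite -(divfK (lt0r_neq0 A10) A) mulr_gt0.
rewrite -EFinM; apply: best_constant_le.
  by rewrite mulr_ge0 ?(ltW upper_cst_gt0) ?(ltW A0').
move=> f mf f0.
rewrite (eq_integral (fun z => (\int[s1 \x s2]_w (product_kernel th1 th2 z w * f w)) `^ q));
  last by move=> z _; rewrite frac_integralE.
have H := product_norm halpha hbeta p1 p'1 pp' q1 q'1 qq' pq A10 A20 HA1 HA2 mf f0.
apply: (le_trans H); apply: lee_wpmul2r; first exact: poweR_ge0.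
have -> : (upper_cst * A = strong_cst (m := m) th1 p p' q q' * A1 *
    (strong_cst (m := n) th2 p p' q q' * (A / A1)))%R.
  by rewrite [RHS]mulrACA (mulrC A1) divfK ?lt0r_neq0.
exact: lexx.
Qed.

End upper.

(** * Exponents and the final comparison *)

Lemma conjugate_exponent (R : realType) (p : R) : (1 < p)%R ->
  (1 < p / (p - 1) /\ p^-1 + (p / (p - 1))^-1 = 1)%R.
Proof.
move=> p1; have p10 : (0 < p - 1)%R by rewrite subr_gt0.
split; first by rewrite ltr_pdivlMr// mul1r gtrDl ltrN10.
by field; rewrite !gt_eqF// (lt_trans _ p1).
Qed.

Lemma cube_exponent_gt0 (R : realType) (m : nat) (a : R) : (0 < m)%N ->
  (a / m%:R < 1)%R -> (0 < m%:R - a)%R.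
Proof. by move=> m0; rewrite subr_gt0 ltr_pdivrMr ?ltr0n// mul1r. Qed.

Lemma locally_finite_pack (R : realType) (m : nat) (mu : {measure set (borel R m) -> \bar R}) :
  locally_finite mu ->
  exists nu : {sigma_finite_measure set (borel R m) -> \bar R}, (nu : set _ -> \bar R) = mu.
Proof. by move=> /locally_finite_sigma_finite; exact: sigma_finite_pack. Qed.

Theorem theorem9 (R : realType) (m n : nat) (alpha beta p q : R)
    (hm : (1 <= m)%N) (hn : (1 <= n)%N)
    (hp : (1 < p)%R) (hpq : (p < q)%R)
    (halpha : (0 < alpha / m%:R < 1)%R) (hbeta : (0 < beta / n%:R < 1)%R) :
  exists c : R, (0 < c)%R /\
    forall (sigma1 omega1 : {measure set (borel R m) -> \bar R})
           (sigma2 omega2 : {measure set (borel R n) -> \bar R}),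
      locally_finite sigma1 -> locally_finite omega1 ->
      locally_finite sigma2 -> locally_finite omega2 ->
      comparable_up_to c
        (best_constant alpha beta p q (sigma1 \x sigma2) (omega1 \x omega2))
        (two_tailed_char alpha beta p q (sigma1 \x sigma2) (omega1 \x omega2)).
Proof.
have th1 : (0 < m%:R - alpha)%R by apply: cube_exponent_gt0 => //; case/andP: halpha.
have th2 : (0 < n%:R - beta)%R by apply: cube_exponent_gt0 => //; case/andP: hbeta.
have hq := lt_trans hp hpq.
have [p'1 pp'] := conjugate_exponent hp.
have [q'1 qq'] := conjugate_exponent hq.
pose cu : R := upper_cst (m := m) (n := n) alpha beta p q (q / (q - 1))%R.
pose cl : R := lower_cst (m := m) (n := n) alpha beta.
have cu0 : (0 < cu)%R by exact: upper_cst_gt0.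
have cl0 : (0 < cl)%R by rewrite mulr_gt0 ?powR_gt0.
exists (Num.max cu cl); split; first by rewrite lt_max cu0.
move=> sigma1 omega1 sigma2 omega2 /locally_finite_pack[s1 s1E] /locally_finite_pack[w1 w1E].
move=> /locally_finite_pack[s2 s2E] /locally_finite_pack[w2 w2E].
(* Both compared quantities depend on the set functions only, so the measures may be exchanged for
   copies carrying the sigma-finite structure. *)
have -> : sigma1 \x sigma2 = s1 \x s2 :> (set _ -> \bar R) by rewrite /product_measure1 s1E s2E.
have -> : omega1 \x omega2 = w1 \x w2 :> (set _ -> \bar R) by rewrite /product_measure1 w1E w2E.
(* The lower bound uses duality on the product space, so the product measures need the structure as
   well. *)
have [s sE] := sigma_finite_pack (product_sigma_finite s1 s2).
have [w wE] := sigma_finite_pack (product_sigma_finite w1 w2).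
have c0 : (0 < Num.max cu cl)%R by rewrite lt_max cu0.
split.
  rewrite lee_pdivrMl//.
  apply: le_trans (upper_bound hm hn th1 th2 hp p'1 pp' hq q'1 qq' hpq s1 w1 s2 w2) _.
  by apply: lee_wpmul2r; [exact: char_ge0|rewrite lee_fin le_max lexx].
have BC0 : 0 <= best_constant alpha beta p q (s1 \x s2) (w1 \x w2).
  by apply: le_ereal_inf_tmp => _ [N [N0 _] <-]; rewrite lee_fin.
apply: (@le_trans _ _ (cl%:E * best_constant alpha beta p q (s1 \x s2) (w1 \x w2))); last first.
  by apply: lee_wpmul2r => //; rewrite lee_fin le_max lexx orbT.
rewrite -lee_pdivrMl//; apply: le_ereal_inf_tmp => _ [N [N0 HN] <-].
rewrite lee_pdivrMl//; apply: ge_ereal_sup => _ [[I J] _ <-] /=.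
rewrite !volume_powR// -sE -wE -EFinM.
by apply: (lower_bound hm hn th1 th2 hp p'1 pp' hq) => //; rewrite sE wE.
Qed.
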